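(* Let $m,n\ge 1$ and let $K$ be any commutative $\mathscr A$-algebra, with $\zeta$ the image of $q$ in $K$. Then $$\varphi_C\bigl(\mathfrak B_n(-\zeta^{2m+1},\zeta)\bigr)=\operatorname{End}_{\mathbb U_K(\mathfrak{sp}_{2m})}\bigl(V_K^{\otimes n}\bigr).$$
   Context: Let $q$ be an indeterminate and $\mathscr A=\mathbb Z[q,q^{-1}]$. Let $X=\bigoplus_{i=1}^m\mathbb Z\varepsilon_i$ with $(\varepsilon_i,\varepsilon_j)=\delta_{ij}$, simple roots $\alpha_i=\varepsilon_i-\varepsilon_{i+1}$ ($1\le i<m$), $\alpha_m=2\varepsilon_m$, $\langle\lambda,\alpha_i^\vee\rangle=2(\lambda,\alpha_i)/(\alpha_i,\alpha_i)$, $a_{ij}=\langle\alpha_j,\alpha_i^\vee\rangle$. Put $q_i=q,\ \tilde k_i=k_i$ for $i<m$ and $q_m=q^2,\ \tilde k_m=k_m^2$; $[a]_i=(q_i^a-q_i^{-a})/(q_i-q_i^{-1})$, $[a]_i^!=[a]_i\cdots[1]_i$. $\mathbb U_{\mathbb Q(q)}(\mathfrak{sp}_{2m})$ is the $\mathbb Q(q)$-algebra generated by $e_i,f_i,k_i^{\pm1}$ ($1\le i\le m$) with relations $k_ik_i^{-1}=k_i^{-1}k_i=1$, the $k$'s commute, $k_ie_jk_i^{-1}=q^{a_{ij}}e_j$, $k_if_jk_i^{-1}=q^{-a_{ij}}f_j$, $e_if_j-f_je_i=\delta_{ij}(\tilde k_i-\tilde k_i^{-1})/(q_i-q_i^{-1})$,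 and for $i\neq j$ the quantum Serre relations $\sum_{s=0}^{1-a_{ij}}(-1)^se_i^{(s)}e_je_i^{(1-a_{ij}-s)}=0=\sum_{s=0}^{1-a_{ij}}(-1)^sf_i^{(s)}f_jf_i^{(1-a_{ij}-s)}$ with $e_i^{(s)}=e_i^s/[s]_i^!$, $f_i^{(s)}=f_i^s/[s]_i^!$; coproduct $\Delta(e_i)=e_i\otimes1+\tilde k_i\otimes e_i$, $\Delta(f_i)=1\otimes f_i+f_i\otimes\tilde k_i^{-1}$, $\Delta(k_i)=k_i\otimes k_i$. $\mathbb U_{\mathscr A}$ is the $\mathscr A$-subalgebra generated by $e_i^{(a)},f_i^{(a)},k_i^{\pm1}$, and $\mathbb U_K(\mathfrak{sp}_{2m})=\mathbb U_{\mathscr A}\otimes_{\mathscr A}K$. $V_{\mathscr A}$ is free on $v_1,\dots,v_{2m}$, $i'=2m+1-i$, with action (for $1\le i<m$): $e_iv_j=v_i$ if $j=i+1$, $-v_{(i+1)'}$ if $j=i'$, $0$ otherwise; $e_mv_j=v_m$ if $j=m'$, else $0$; $f_iv_j=v_{i+1}$ if $j=i$, $-v_{i'}$ if $j=(i+1)'$, else $0$; $f_mv_j=v_{m'}$ if $j=m$, else $0$; $k_iv_j=qv_j$ if $j\in\{i,(i+1)'\}$, $q^{-1}v_j$ if $j\in\{i+1,i'\}$, else $v_j$; $k_mv_j=qv_j$ if $j=m$, $q^{-1}v_j$ if $j=m'$, else $v_j$. Via $\Delta$, $\mathbb U_{\mathscr A}$ acts on $V_{\mathscr A}^{\otimes n}$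 and by base change $\mathbb U_K(\mathfrak{sp}_{2m})$ acts on $V_K^{\otimes n}$. $\mathfrak B_n(-q^{2m+1},q)_{\mathscr A}$ is the unital $\mathscr A$-algebra generated by invertible $T_i$ and $E_i$ ($1\le i\le n-1$) with relations $T_i-T_i^{-1}=z(1-E_i)$; $E_i^2=xE_i$; $T_iT_{i+1}T_i=T_{i+1}T_iT_{i+1}$; $T_iT_j=T_jT_i$ ($|i-j|>1$); $E_iE_{i+1}E_i=E_i$, $E_{i+1}E_iE_{i+1}=E_{i+1}$; $T_iT_{i+1}E_i=E_{i+1}E_i$, $T_{i+1}T_iE_{i+1}=E_iE_{i+1}$; $E_iT_i=T_iE_i=r^{-1}E_i$; $E_iT_{i+1}E_i=rE_i$, $E_{i+1}T_iE_{i+1}=rE_{i+1}$, with $r=-q^{2m+1}$, $z=q-q^{-1}$, $x=1-\sum_{i=-m}^mq^{2i}$; $\mathfrak B_n(-\zeta^{2m+1},\zeta)=\mathfrak B_n(-q^{2m+1},q)_{\mathscr A}\otimes_{\mathscr A}K$ where $\zeta$ is the image of $q$. With $(\rho_1,\dots,\rho_{2m})=(m,\dots,1,-1,\dots,-m)$, $\epsilon_i=\operatorname{sign}\rho_i$, matrix units $M_{i,j}v_k=\delta_{jk}v_i$, define $\beta'=\sum_i(qM_{i,i}\otimes M_{i,i}+q^{-1}M_{i,i'}\otimes M_{i',i})+\sum_{i\ne j,j'}M_{i,j}\otimes M_{j,i}+(q-q^{-1})\sum_{i<j}(M_{i,i}\otimes M_{j,j}-q^{\rho_j-\rho_i}\epsilon_i\epsilon_jM_{i,j'}\otimes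 M_{i',j})$ and $\gamma'=\sum_{i,j}q^{\rho_j-\rho_i}\epsilon_i\epsilon_jM_{i,j'}\otimes M_{i',j}$, and let $\beta'_i,\gamma'_i$ act on tensor positions $i,i+1$ of $V_K^{\otimes n}$. Then $T_i\mapsto\beta'_i$, $E_i\mapsto\gamma'_i$ defines a right action of $\mathfrak B_n(-\zeta^{2m+1},\zeta)$ on $V_K^{\otimes n}$ commuting with $\mathbb U_K(\mathfrak{sp}_{2m})$, i.e. an algebra homomorphism $\varphi_C:\mathfrak B_n(-\zeta^{2m+1},\zeta)^{\rm op}\to\operatorname{End}_K(V_K^{\otimes n})$. *)

(* Defs.v *)
From HB Require Import structures.
From mathcomp Require Import all_boot all_order all_algebra.
Set Implicit Arguments.
Unset Strict Implicit.
Unset Printing Implicit Defensive.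
Import Order.TTheory GRing.Theory Num.Theory.
Local Open Scope ring_scope.

(* Conventions (0-based indices):
   basis vector v_{p+1} of V  <->  p : 'I_(2m);   p' = rev_ord p (i' = 2m+1-i);
   generator index i (1<=i<=m)  <->  g : 'I_m with val g = i-1;
   tensor basis of V^{\otimes n}: functions 'I_n -> 'I_(2m) (position l <-> factor l+1);
   an operator on a free module with basis B is its matrix  B -> B -> R,
   entry (r,c) = coefficient of basis vector r in the image of basis vector c. *)

Section Generic.
Variables (R : comPzRingType) (x xi : R) (m n : nat).
(* x, xi are the images of q, q^{-1} *)

Local Notation I := 'I_(m.*2).
Definition tbasis := {ffun 'I_n -> I}.
Definition Op := tbasis -> tbasis -> R.

Definition zpow (z : int) : R :=
  match z with Posz k => x ^+ k | Negz k => xi ^+ k.+1 end.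

Definition pr (p : nat) : nat := (m.*2).-1 - p.
Definition prim (p : I) : I := rev_ord p.

Definition eV (g : 'I_m) (r c : I) : R :=
  if (val g < m.-1)%N then
    ((val c == (val g).+1) && (val r == val g))%:R
    - ((val c == pr (val g)) && (val r == pr (val g).+1))%:R
  else ((val c == m) && (val r == m.-1))%:R.

Definition fV (g : 'I_m) (r c : I) : R :=
  if (val g < m.-1)%N then
    ((val c == val g) && (val r == (val g).+1))%:R
    - ((val c == pr (val g).+1) && (val r == pr (val g)))%:R
  else ((val c == m.-1) && (val r == m))%:R.

Definition wt (g : 'I_m) (j : nat) : int :=
  if (val g < m.-1)%N then
    (if (j == val g) || (j == pr (val g).+1) then 1
     else if (j == (val g).+1) || (j == pr (val g)) then -1 else 0)
  else (if j == m.-1 then 1 else if j == m then -1 else 0).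

Definition kV (g : 'I_m) (s : int) (r c : I) : R :=
  (r == c)%:R * zpow (s * wt g (val c)).

(* \tilde k_i = k_i^{d_i}, d_i = 1 (i<m), 2 (i=m) *)
Definition dg (g : 'I_m) : int := if (val g < m.-1)%N then 1 else 2.

Definition idV (r c : I) : R := (r == c)%:R.

Definition tens (F : 'I_n -> I -> I -> R) : Op :=
  fun r c => \prod_(l < n) F l (r l) (c l).

(* action on V^{\otimes n} via the iterated coproduct
   Delta(e_i) = e_i (x) 1 + \tilde k_i (x) e_i,
   Delta(f_i) = 1 (x) f_i + f_i (x) \tilde k_i^{-1},  Delta(k_i) = k_i (x) k_i *)
Definition DeltaE (g : 'I_m) : Op :=
  fun r c => \sum_(j < n)
    tens (fun l => if (l < j)%N then kV g (dg g) else if l == j then eV g else idV) r c.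
Definition DeltaF (g : 'I_m) : Op :=
  fun r c => \sum_(j < n)
    tens (fun l => if (l < j)%N then idV else if l == j then fV g else kV g (- dg g)) r c.
Definition DeltaK (g : 'I_m) (s : int) : Op := tens (fun _ => kV g s).

Definition opmul (A B : Op) : Op := fun r c => \sum_(k : tbasis) A r k * B k c.
Definition opone : Op := fun r c => (r == c)%:R.
Definition oppow (A : Op) (a : nat) : Op := iter a (opmul A) opone.
Definition opcomm (A B : Op) : Prop := forall r c, opmul A B r c = opmul B A r c.

(* matrix units: mu a b c d = M_{a,b} (x) M_{c,d} on V (x) V *)
Definition mu (a b c d : I) (r1 r2 c1 c2 : I) : R :=
  [&& r1 == a, c1 == b, r2 == c & c2 == d]%:R.

Definition rho (p : I) : int :=
  if (val p < m)%N then (m - val p)%N%:Z else - ((val p - m).+1)%N%:Z.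
Definition eps (p : I) : R := if (val p < m)%N then 1 else -1.

Definition betaV (r1 r2 c1 c2 : I) : R :=
  \sum_(i : I) (x * mu i i i i r1 r2 c1 c2 + xi * mu i (prim i) (prim i) i r1 r2 c1 c2)
  + \sum_(i : I) \sum_(j : I | (i != j) && (i != prim j)) mu i j j i r1 r2 c1 c2
  + (x - xi) * \sum_(i : I) \sum_(j : I | (val i < val j)%N)
      (mu i i j j r1 r2 c1 c2
       - zpow (rho j - rho i) * eps i * eps j * mu i (prim j) (prim i) j r1 r2 c1 c2).

Definition gammaV (r1 r2 c1 c2 : I) : R :=
  \sum_(i : I) \sum_(j : I)
    zpow (rho j - rho i) * eps i * eps j * mu i (prim j) (prim i) j r1 r2 c1 c2.

Definition atpos2 (Bv : I -> I -> I -> I -> R) (i j : 'I_n) : Op :=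
  fun r c => Bv (r i) (r j) (c i) (c j) *
             \prod_(l < n | (l != i) && (l != j)) (r l == c l)%:R.

(* letters: (true, (i,i+1)) is T_i |-> beta'_i ; (false, (i,i+1)) is E_i |-> gamma'_i *)
Definition adjpos (p : bool * ('I_n * 'I_n)) : bool := val p.2.2 == (val p.2.1).+1.
Definition genop (p : bool * ('I_n * 'I_n)) : Op :=
  atpos2 (if p.1 then betaV else gammaV) p.2.1 p.2.2.
Definition word (w : seq (bool * ('I_n * 'I_n))) : Op :=
  foldr (fun p A => opmul (genop p) A) opone w.

(* X lies in the image of phi_C, i.e. in the unital subalgebra generated by the
   beta'_i and gamma'_i (= K-span of the words in them). *)
Definition in_phiC (X : Op) : Prop :=
  exists s : seq (R * seq (bool * ('I_n * 'I_n))),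
    all (fun p => all adjpos p.2) s /\
    forall r c, X r c = \sum_(p <- s) p.1 * word p.2 r c.

End Generic.

(* Q(q), realized as the fraction field of Z[q] *)
Definition Fq := {fraction {poly int}}.
Definition qF : Fq := FracField.tofrac ('X : {poly int}).

Definition qnum (m : nat) (g : 'I_m) (a : nat) : Fq :=
  let qg := zpow qF qF^-1 (dg g) in (qg ^+ a - qg ^- a) / (qg - qg^-1).
Definition qfact (m : nat) (g : 'I_m) (a : nat) : Fq :=
  \prod_(k < a) qnum g k.+1.

Definition EdivF (m n : nat) (g : 'I_m) (a : nat) : Op Fq m n :=
  fun r c => (qfact g a)^-1 * oppow (DeltaE qF qF^-1 g) a r c.
Definition FdivF (m n : nat) (g : 'I_m) (a : nat) : Op Fq m n :=
  fun r c => (qfact g a)^-1 * oppow (DeltaF qF qF^-1 g) a r c.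

(* y is an element of A = Z[q,q^{-1}] inside Q(q) whose image in K
   (under q |-> z, q^{-1} |-> zi) is k *)
Definition spec (K : comPzRingType) (z zi : K) (y : Fq) (k : K) : Prop :=
  exists (p : {poly int}) (N : nat),
    y = FracField.tofrac p / qF ^+ N /\
    k = (\sum_(i < size p) (p`_i)%:~R * z ^+ i) * zi ^+ N.

Definition specOp (K : comPzRingType) (z zi : K) (m n : nat)
  (A : Op Fq m n) (G : Op K m n) : Prop := forall r c, spec z zi (A r c) (G r c).

(* X is in End_{U_K(sp_2m)}(V_K^{\otimes n}): it commutes with the images of
   the generators e_i^{(a)}, f_i^{(a)}, k_i^{\pm 1} of U_A, base-changed to K *)
Definition in_EndU (K : comPzRingType) (z zi : K) (m n : nat) (X : Op K m n) : Prop :=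
  forall (g : 'I_m) (a : nat),
    (forall G, specOp z zi (@EdivF m n g a) G -> opcomm X G) /\
    (forall G, specOp z zi (@FdivF m n g a) G -> opcomm X G) /\
    opcomm X (@DeltaK K z zi m n g 1) /\ opcomm X (@DeltaK K z zi m n g (-1)).

(* Main.v *)
Require Import Defs.
From HB Require Import structures.
From mathcomp Require Import all_boot all_order all_algebra.
From mathcomp Require Import boolp functions.
From mathcomp Require Import ring zify.
Set Implicit Arguments.
Unset Strict Implicit.
Unset Printing Implicit Defensive.
Import Order.TTheory GRing.Theory Num.Theory.
Local Open Scope ring_scope.

(* The BMW generators commute with e_g by a computation on two tensor factors,
   and with f_g because beta' and gamma' are symmetric matrices while the
   transpose of e_g is f_g up to a power of k_g.

   Conversely let X be an endomorphism, and let (r, c) be the pair of words with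
   X r c != 0 for which the word c' r^rev (c' is c with primed letters) is
   lexicographically largest. Bending X gives a vector of V^{(x) 2n} with this
   leading word that is killed by every e_g^{(a)}, a > 0. An sl_2 argument, which
   divides by nothing because all divided powers are available, shows that every
   suffix of the leading word has nonnegative weight. Hence all prefixes of r and
   of c are dominant, and r and c have the same weight. For each such pair there is
   an operator in the image of the algebra with a unit at (r, c) and no other
   entry at a larger pair: it collapses c letter by letter into a product of
   q-wedges (the columns of the current Young diagram) followed by cups, and
   expands this into r. Subtracting a multiple of it from X lowers the leading
   pair, over any K. *)

(** * Coefficients of the generators *)

(** This shapes two steps. Commuting with the k_g only equates powers of ζ, so even the equality of
    the weights of r and c must come from divided powers: the bent word has weight wt r - wt c, and
    the sl_2 argument for X and for its transpose bounds this from both sides. And wedges are built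
    without normalization: only the sum over the shortest coset representatives that insert one new
    letter is applied, which turns the wedge of the first c letters into that of the first c + 1
    with coefficient 1. The order on pairs suits both halves. As e_g replaces a letter by a smaller
    one, the leading word can lose its first letter and still lead a killed vector. As priming
    reverses the alphabet, a larger c' means a smaller c, and those are the words that the collapse
    of c kills, while the expansion yields r plus words with smaller reversal. *)

Section Coefficients.
Variables (K : comPzRingType) (q qi : K) (m : nat).
Hypothesis qqi : q * qi = 1.
Local Notation I := 'I_(m.*2).
Local Notation zp := (zpow q qi).

Lemma zpowD1 (a : int) : zp (a + 1) = zp a * q.
Proof.
case: a => [a|[|a]].
- have -> : Posz a + 1 = Posz a.+1 by lia.
  by rewrite /= exprSr.
- by rewrite /= expr1 mulrC qqi.
- have -> : Negz a.+1 + 1 = Negz a by rewrite !NegzE; lia.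
  by rewrite /= [qi ^+ a.+2]exprSr -mulrA [qi * q]mulrC qqi mulr1.
Qed.

Lemma zpowB1 (a : int) : zp (a - 1) = zp a * qi.
Proof.
have := zpowD1 (a - 1); rewrite subrK => ->.
by rewrite -mulrA qqi mulr1.
Qed.

Lemma zpowD (a b : int) : zp (a + b) = zp a * zp b.
Proof.
elim/int_rec: b => [|b IH|b IH]; first by rewrite addr0 mulr1.
- have -> : b.+1%:Z = b%:Z + 1 by lia.
  by rewrite addrA !zpowD1 IH mulrA.
- have -> : - b.+1%:Z = - b%:Z - 1 by lia.
  by rewrite addrA !zpowB1 IH mulrA.
Qed.

Lemma zpowN (a : int) : zp a * zp (- a) = 1.
Proof. by rewrite -zpowD subrr. Qed.

(* gamma' is the product of a cup with coefficients kappai and a cap with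
   coefficients kappa. *)
Definition kappa (a : I) : K := zp (rho a) * eps K a.
Definition kappai (a : I) : K := zp (- rho a) * eps K a.

Lemma eps2 (a : I) : eps K a * eps K a = 1.
Proof. by rewrite /eps; case: ifP; rewrite ?mulr1 // mulrNN mulr1. Qed.

Lemma kappa_kappai (a : I) : kappa a * kappai a = 1.
Proof. by rewrite /kappa /kappai mulrACA zpowN eps2 mulr1. Qed.

Lemma primK : involutive (@prim m).
Proof. exact: rev_ordK. Qed.

Lemma prim_inj : injective (@prim m).
Proof. exact: rev_ord_inj. Qed.

Lemma val_prim (a : I) : val (prim a) = (m.*2 - a.+1)%N.
Proof. by []. Qed.

Lemma eq_prim (a b : I) : (prim a == b) = (a == prim b).
Proof. by rewrite -(inj_eq prim_inj) primK. Qed.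

Lemma prim_neq (a : I) : (prim a == a) = false.
Proof.
apply/negP => /eqP /(congr1 val); rewrite val_prim /=.
by have := ltn_ord a; lia.
Qed.

Lemma neq_prim (a : I) : (a == prim a) = false.
Proof. by rewrite eq_sym prim_neq. Qed.

Lemma rho_prim (a : I) : rho (prim a) = - rho a.
Proof.
rewrite /rho val_prim /=; have := ltn_ord a; move: (nat_of_ord a) => k hk.
by case: ifP => h1; case: ifP => h2; lia.
Qed.

Lemma eps_prim (a : I) : eps K (prim a) = - eps K a.
Proof.
rewrite /eps val_prim /=; have := ltn_ord a; move: (nat_of_ord a) => k hk.
by case: ifP => h1; case: ifP => h2; rewrite ?opprK //; lia.
Qed.

Lemma kappa_prim (a : I) : kappa (prim a) = - kappai a.
Proof. by rewrite /kappa /kappai rho_prim eps_prim mulrN. Qed.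

Lemma kappai_prim (a : I) : kappai (prim a) = - kappa a.
Proof. by rewrite -[in RHS](primK a) kappa_prim opprK. Qed.

Lemma sum_pred1 (F : I -> K) (a : I) (P : pred I) :
  (\sum_(i | P i) (i == a)%:R * F i) = (P a)%:R * F a.
Proof.
rewrite big_mkcond (bigD1 a) //= eqxx mul1r big1 ?addr0.
  by case: (P a); rewrite ?mul1r ?mul0r.
by move=> i /negbTE ->; rewrite mul0r if_same.
Qed.

Lemma mu_E (a b c d r1 r2 c1 c2 : I) :
  mu K a b c d r1 r2 c1 c2 = (a == r1)%:R * ((b == c1)%:R * ((c == r2)%:R * (d == c2)%:R)).
Proof.
by rewrite /mu -!natrM !mulnb (eq_sym a) (eq_sym b) (eq_sym c) (eq_sym d).
Qed.

Lemma gammaE (r1 r2 c1 c2 : I) :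
  gammaV q qi r1 r2 c1 c2 = ((r2 == prim r1) && (c1 == prim c2))%:R * (kappai r1 * kappa c2).
Proof.
rewrite /gammaV.
transitivity (\sum_(i : I) (i == r1)%:R * (\sum_(j : I) (j == c2)%:R *
   ((prim j == c1)%:R * (prim i == r2)%:R * (zp (rho j - rho i) * eps K i * eps K j)))).
  apply: eq_bigr => i _; rewrite big_distrr /=; apply: eq_bigr => j _.
  by rewrite mu_E; ring.
rewrite (sum_pred1 _ _ predT) mul1r (sum_pred1 _ _ predT) mul1r.
rewrite zpowD /kappa /kappai -mulnb natrM (eq_sym r2) (eq_sym c1); ring.
Qed.

Definition qgap : K := q - qi.

Lemma betaE (r1 r2 c1 c2 : I) :
  betaV q qi r1 r2 c1 c2 =
    ((r1 == c2) && (r2 == c1))%:R * (if c1 == c2 then q else if c1 == prim c2 then qi else 1)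
  + qgap * (((r1 == c1) && (r2 == c2) && (c1 < c2)%N)%:R
          - ((r2 == prim r1) && (c1 == prim c2) && (r1 < c2)%N)%:R * (kappai r1 * kappa c2)).
Proof.
rewrite /betaV; congr (_ + _ * _).
- rewrite (_ : \sum_(i | true) _ = (c1 == r1)%:R * ((c1 == r2)%:R * (c1 == c2)%:R) * q
     + (c2 == r1)%:R * ((c1 == r2)%:R * (c1 == prim c2)%:R) * qi :> K); last first.
    transitivity (\sum_(i : I) ((i == c1)%:R * ((i == r1)%:R * ((i == r2)%:R * (i == c2)%:R) * q)
      + (i == c2)%:R * ((i == r1)%:R * ((prim i == c1)%:R * (prim i == r2)%:R) * qi))).
      by apply: eq_bigr => i _; rewrite !mu_E; ring.
    rewrite big_split /= !(sum_pred1 _ _ predT) !mul1r; congr (_ + _); congr (_ * _ * _).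
    rewrite -!natrM !mulnb (eq_sym c1 (prim c2)); congr (_%:R).
    by case: (prim c2 =P c1) => [->|_]; rewrite ?andbF ?andbT.
  rewrite [X in _ + X = _](_ : _ = (c2 == r1)%:R * (c1 == r2)%:R * ((c2 != c1) && (c2 != prim c1))%:R);
      last first.
    transitivity (\sum_(i : I) (i == c2)%:R * (\sum_(j | (i != j) && (i != prim j))
       (j == c1)%:R * ((i == r1)%:R * (j == r2)%:R) : K)).
      apply: eq_bigr => i _; rewrite big_distrr; apply: eq_bigr => j _ /=.
      by rewrite mu_E; ring.
    by rewrite (sum_pred1 _ _ predT) mul1r sum_pred1 mulrC.
  rewrite (eq_sym r1) (eq_sym r2) (eq_sym c1 (prim c2)) eq_prim (eq_sym c2 c1).
  case: (eqVneq c1 c2) => [->|n12].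
    by rewrite neq_prim /= -mulnb natrM; ring.
  by case: (c2 == prim c1); case: (c2 == r1); case: (c1 == r2) => /=; ring.
- transitivity (\sum_(i : I) ((i == r1)%:R * \sum_(j : I | (i < j)%N) (j == c2)%:R * ((i == c1)%:R * (j ==
    r2)%:R))
    - \sum_(i : I) ((i == r1)%:R * \sum_(j : I | (i < j)%N) (j == c2)%:R * ((prim j == c1)%:R * (prim i ==
        r2)%:R
       * (zp (rho j - rho i) * eps K i * eps K j)))).
    rewrite -sumrB; apply: eq_bigr => i _; rewrite !big_distrr -sumrB /=.
    by apply: eq_bigr => j _; rewrite !mu_E; ring.
  rewrite !(sum_pred1 _ _ predT) !mul1r !sum_pred1.
  rewrite zpowD /kappa /kappai (eq_sym r2 c2) (eq_sym r2) (eq_sym c1 (prim c2)); congr (_ - _).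
    rewrite -!natrM !mulnb; congr (_%:R); case: eqP => [->|_] /=; last by rewrite andbF.
    by rewrite andbC; congr (nat_of_bool (_ && _)).
  rewrite -!mulnb !natrM; ring.
Qed.
End Coefficients.

(** * Operators on words *)
Section Tensors.
Variables (K : comPzRingType) (T : finType).

(* All tensor powers at once: a vector is a function on words of any length, and
   tn p x y is x (x) y when x lives on words of length p. *)
Definition vec : Type := seq T -> K^o.
HB.instance Definition _ := GRing.Lmodule.on vec.
Definition mat2 := T -> T -> T -> T -> K.

(** The default value 0 on words that are too short makes [op_tnr] an identity of functions on all
    words. *)
Definition act2 (M : mat2) (f : vec) : vec := fun w =>
  if w is a :: b :: u then \sum_c \sum_d M a b c d * f [:: c, d & u] else 0.
Definition skip (O : vec -> vec) (f : vec) : vec := fun w =>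
  if w is a :: u then O (fun v => f (a :: v)) u else 0.
Definition op (l : nat) (M : mat2) : vec -> vec := iter l skip (act2 M).
Definition tn (p : nat) (x y : vec) : vec := fun w => x (take p w) * y (drop p w).
Definition ev (u : seq T) : vec := fun w => (w == u)%:R.

Lemma vec_addE (f g : vec) w : (f + g) w = f w + g w. Proof. by []. Qed.
Lemma vec_scaleE k (f : vec) w : (k *: f) w = k * f w. Proof. by []. Qed.
Lemma vec_oppE (f : vec) w : (- f) w = - f w. Proof. by []. Qed.
Lemma vec_zeroE w : (0 : vec) w = 0. Proof. by []. Qed.
Lemma vec_sumE (J : Type) r (P : pred J) (F : J -> vec) w :
  (\sum_(j <- r | P j) F j) w = \sum_(j <- r | P j) F j w.
Proof. by rewrite fct_sumE. Qed.

Definition islin (B : vec -> vec) := forall k f g, B (k *: f + g) = k *: B f + B g.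

Lemma islin0 B : islin B -> B 0 = 0.
Proof. by move=> h; have := h (-1) 0 0; rewrite scaler0 addr0 scaleN1r addNr. Qed.
Lemma islinD B f g : islin B -> B (f + g) = B f + B g.
Proof. by move=> h; have := h 1 f g; rewrite !scale1r. Qed.
Lemma islinB B f g : islin B -> B (f - g) = B f - B g.
Proof. by move=> h; rewrite -scaleN1r addrC h scaleN1r addrC. Qed.
Lemma islinZ B k f : islin B -> B (k *: f) = k *: B f.
Proof. by move=> h; have := h k f 0; rewrite !addr0 islin0 // addr0. Qed.
Lemma islin_sum B (J : Type) r (P : pred J) (F : J -> vec) : islin B ->
  B (\sum_(j <- r | P j) F j) = \sum_(j <- r | P j) B (F j).
Proof.
move=> h; elim/big_rec2: _ => [|j y1 y2 _ <-]; first exact: islin0.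
by rewrite islinD.
Qed.

Lemma op_lin l M : islin (op l M).
Proof.
elim: l => [|l IH] k f g; apply/funext => w.
  case: w => [|a [|b u]]; rewrite ?vec_addE ?vec_scaleE /= ?mulr0 ?addr0 //.
  rewrite big_distrr -big_split; apply: eq_bigr => c _ /=.
  rewrite big_distrr -big_split; apply: eq_bigr => d _ /=.
  by rewrite vec_addE vec_scaleE mulrDr mulrCA.
case: w => [|a u]; rewrite ?vec_addE ?vec_scaleE /= ?mulr0 ?addr0 //.
exact: (congr1 (@^~ u) (IH k (fun v => f (a :: v)) (fun v => g (a :: v)))).
Qed.

Lemma tn_linl p y : islin (fun x => tn p x y).
Proof.
move=> k f g; apply/funext => w.
by rewrite vec_addE vec_scaleE /tn vec_addE vec_scaleE mulrDl mulrA.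
Qed.
Lemma tn_linr p x : islin (fun y => tn p x y).
Proof.
move=> k f g; apply/funext => w.
by rewrite vec_addE vec_scaleE /tn vec_addE vec_scaleE mulrDr mulrCA.
Qed.

Definition tnDl p x1 x2 y := islinD x1 x2 (@tn_linl p y).
Definition tnDr p x y1 y2 := islinD y1 y2 (@tn_linr p x).
Definition tnZl p k x y := islinZ k x (@tn_linl p y).
Definition tnZr p k x y := islinZ k y (@tn_linr p x).
Definition tn0l p y := islin0 (@tn_linl p y).
Definition tn0r p x := islin0 (@tn_linr p x).
Arguments islinD {B f g}.
Arguments islinB {B f g}.
Arguments islinZ {B k f}.
Arguments islin_sum {B J r P F}.
Arguments op_lin {l M}.

Lemma tn_suml p (J : Type) r (P : pred J) (F : J -> vec) y :
  tn p (\sum_(j <- r | P j) F j) y = \sum_(j <- r | P j) tn p (F j) y.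
Proof. exact: (islin_sum (@tn_linl p y)). Qed.
Lemma tn_sumr p (J : Type) r (P : pred J) (F : J -> vec) x :
  tn p x (\sum_(j <- r | P j) F j) = \sum_(j <- r | P j) tn p x (F j).
Proof. exact: (islin_sum (@tn_linr p x)). Qed.

Lemma tnA p s x y z : tn (p + s) (tn p x y) z = tn p x (tn s y z).
Proof.
apply/funext => w; rewrite /tn mulrA take_takel ?leq_addr //.
by rewrite take_drop drop_drop [(s + p)%N]addnC.
Qed.

Lemma tn_ev u v : tn (size u) (ev u) (ev v) = ev (u ++ v).
Proof.
apply/funext => w; rewrite /tn /ev -natrM mulnb; congr (nat_of_bool _)%:R.
rewrite -{3}(cat_take_drop (size u) w).
have [h|h] := leqP (size u) (size w).
  by rewrite eqseq_cat // size_take; case: ltngtP h.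
rewrite take_oversize ?(ltnW h) // drop_oversize ?(ltnW h) // cats0.
have -> : (w == u) = false by apply/eqP => e; rewrite e ltnn in h.
by apply/esym/negbTE; apply/eqP => e; rewrite e size_cat ltnNge leq_addr in h.
Qed.

Lemma tn_nil x : tn 0 (ev [::]) x = x.
Proof. by apply/funext => w; rewrite /tn take0 drop0 /ev eqxx mul1r. Qed.

Lemma act2_short M f w : (size w < 2)%N -> act2 M f w = 0.
Proof. by case: w => [|a [|b u]]. Qed.

Lemma op_short l M f w : (size w < l.+2)%N -> op l M f w = 0.
Proof.
elim: l f w => [|l IH] f w; first exact: act2_short.
by case: w => [|a u] //= h; rewrite IH.
Qed.

Lemma op_tnl l M p x y : (l.+2 <= p)%N -> op l M (tn p x y) = tn p (op l M x) y.
Proof.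
elim: l p x => [|l IH] [|p] x // h; apply/funext => w.
  case: p h => // p _; case: w => [|a [|b u]] /=; rewrite /tn /= ?mul0r //.
  rewrite big_distrl; apply: eq_bigr => c _ /=; rewrite big_distrl.
  by apply: eq_bigr => d _ /=; rewrite mulrA.
case: w => [|a u] /=; first by rewrite /tn /= mul0r.
exact: (congr1 (@^~ u) (IH p (fun v => x (a :: v)) h)).
Qed.

Lemma op_tnr l M p x y : op (p + l) M (tn p x y) = tn p x (op l M y).
Proof.
elim: p x => [|p IH] x; apply/funext => w.
  rewrite /tn add0n take0 drop0.
  rewrite (_ : (fun w => _) = x [::] *: y); last first.
    by apply/funext => u; rewrite /tn take0 drop0.
  by rewrite islinZ //; exact: op_lin.
case: w => [|a u] /=; first by rewrite /tn /= op_short // mulr0.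
exact: (congr1 (@^~ u) (IH (fun v => x (a :: v)))).
Qed.

Lemma op0_ev M a b y :
  op 0 M (tn 2 (ev [:: a; b]) y) = tn 2 (\sum_c \sum_d M c d a b *: ev [:: c; d]) y.
Proof.
rewrite (@op_tnl 0 M 2) //; congr (tn 2 _ y); apply/funext => w.
rewrite vec_sumE; case: w => [|c [|d u]].
- by rewrite big1 // => c _; rewrite vec_sumE big1 // => d _; rewrite vec_scaleE /ev mulr0.
- by rewrite big1 // => c' _; rewrite vec_sumE big1 // => d _; rewrite vec_scaleE /ev /= eqseq_cons andbF mulr0.
rewrite /op /=.
rewrite (bigD1 a) //= [X in _ + X]big1 ?addr0; last first.
  by move=> i /negbTE ni; apply: big1 => j _; rewrite /ev eqseq_cons ni mulr0.
rewrite (bigD1 b) //= [X in _ + X]big1 ?addr0; last first.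
  by move=> i /negbTE ni; rewrite /ev !eqseq_cons ni andbF mulr0.
rewrite (bigD1 c) //= [X in _ + X]big1 ?addr0; last first.
  move=> i ni; rewrite vec_sumE; apply: big1 => j _.
  by rewrite vec_scaleE /ev eqseq_cons eq_sym (negbTE ni) mulr0.
rewrite vec_sumE (bigD1 d) //= [X in _ + X]big1 ?addr0; last first.
  move=> i ni; rewrite vec_scaleE /ev !eqseq_cons [d == i]eq_sym (negbTE ni) andbF mulr0 //.
by rewrite vec_scaleE /ev !eqseq_cons !eqxx /=.
Qed.

(* With G spanned by beta', gamma' and 1, this is the image of the p-strand algebra,
   acting on the first p letters of words of every length. *)
Inductive alg (G : mat2 -> Prop) (p : nat) : (vec -> vec) -> Prop :=
| alg_id : alg G p id
| alg_op l M : (l.+2 <= p)%N -> G M -> alg G p (op l M)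
| alg_comp B C : alg G p B -> alg G p C -> alg G p (fun f => B (C f))
| alg_lc k B C : alg G p B -> alg G p C -> alg G p (fun f => k *: B f + C f).

Variable G : mat2 -> Prop.
Local Notation al := (alg G).

Lemma alg_lin p B : al p B -> islin B.
Proof.
elim=> {B} [|l M _ _|B C _ hB _ hC|k B C _ hB _ hC] c f g //.
- exact: op_lin.
- by rewrite hC hB.
by rewrite hC hB !scalerDr !scalerA [k * c]mulrC addrACA.
Qed.

Lemma alg_local p s B x y : al p B -> (p <= s)%N -> B (tn s x y) = tn s (B x) y.
Proof.
move=> hB ps; elim: hB x => {B} [|l M hl _|B C _ hB _ hC|k B C _ hB _ hC] x //.
- by rewrite op_tnl // (leq_trans hl).
- by rewrite hC hB.
by rewrite hC hB tn_linl.
Qed.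

Lemma alg_mono p s B : (p <= s)%N -> al p B -> al s B.
Proof.
move=> ps; elim=> {B} [|l M hl hM|B C _ hB _ hC|k B C _ hB _ hC].
- exact: alg_id.
- by apply: alg_op => //; apply: leq_trans ps.
- exact: alg_comp.
exact: alg_lc.
Qed.

(** [alg] is a predicate on plain functions, so the shifted operator is rebuilt along the
    derivation; what it does to tensors split after s letters is all that is recorded. *)
Lemma alg_shift s p B : al p B ->
  exists2 B', al (s + p) B' & forall x y, B' (tn s x y) = tn s x (B y).
Proof.
elim=> {B} [|l M hl hM|B C _ [B' aB hB] _ [C' aC hC]|k B C _ [B' aB hB] _ [C' aC hC]].
- by exists id => //; exact: alg_id.
- exists (op (s + l) M); last by move=> x y; rewrite op_tnr.
  by apply: alg_op; rewrite // -!addnS leq_add2l.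
- by exists (fun f => B' (C' f)); [exact: alg_comp | move=> x y; rewrite hC hB].
exists (fun f => k *: B' f + C' f); first exact: alg_lc.
by move=> x y; rewrite hB hC tn_linr.
Qed.
End Tensors.
Arguments islinD {K T B f g}.
Arguments islinB {K T B f g}.
Arguments islinZ {K T B k f}.
Arguments islin_sum {K T B J r P F}.
Arguments op_lin {K T l M}.

(** * Braiding past low letters *)
Section Low.
Variables (K : comPzRingType) (q qi : K) (m : nat).
Hypothesis qqi : q * qi = 1.
Local Notation I := 'I_(m.*2).
Local Notation vc := (vec K I).
Local Notation e := (@ev K I).
Local Notation B := (@betaV K q qi m).
Local Notation C := (@gammaV K q qi m).
Local Notation z := (qgap q qi).

(* The inverse of beta'. *)
Definition Smat : mat2 K I := fun a b c d =>
  B a b c d - z * ((a == c) && (b == d))%:R + z * C a b c d.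

Definition gen (M : mat2 K I) := exists k1 k2 k3, forall a b c d,
  M a b c d = k1 * B a b c d + k2 * C a b c d + k3 * ((a == c) && (b == d))%:R.

Local Notation al := (alg gen).

Lemma gen_B : gen B. Proof. by exists 1, 0, 0 => *; ring. Qed.
Lemma gen_C : gen C. Proof. by exists 0, 1, 0 => *; ring. Qed.
Lemma gen_S : gen Smat. Proof. by exists 1, z, (-z) => *; rewrite /Smat; ring. Qed.

Definition cup_vec : vc := \sum_a kappai q qi a *: e [:: a; prim a].

Lemma sum_pred1v (F : I -> vc) (a : I) :
  \sum_i (i == a)%:R *: F i = F a.
Proof.
rewrite (bigD1 a) //= eqxx scale1r big1 ?addr0 // => i /negbTE ->.
by rewrite scale0r.
Qed.

Lemma sum_e2 (a b : I) (k : K) :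
  \sum_c \sum_d (((c == a) && (d == b))%:R * k) *: e [:: c; d] = k *: e [:: a; b].
Proof.
transitivity (\sum_(c : I) (c == a)%:R *: (\sum_(d : I) (d == b)%:R *: (k *: e [:: c; d]))).
  apply: eq_bigr => c _; rewrite scaler_sumr; apply: eq_bigr => d _.
  by rewrite !scalerA -mulnb natrM.
by rewrite !sum_pred1v.
Qed.

Lemma op_gamma (a b : I) y :
  op 0 C (tn 2 (e [:: a; b]) y) = ((a == prim b)%:R * kappa q qi b) *: tn 2 cup_vec y.
Proof.
rewrite op0_ev -tnZl; congr (tn 2 _ y).
rewrite /cup_vec scaler_sumr; apply: eq_bigr => c _.
transitivity (\sum_d (d == prim c)%:R *: (((a == prim b)%:R * (kappai q qi c * kappa q qi b)) *: e [:: c; d])).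
  apply: eq_bigr => d _; rewrite gammaE // scalerA -mulnb natrM; congr (_ *: _); ring.
rewrite sum_pred1v scalerA; congr (_ *: _); ring.
Qed.

Lemma lt_prim_low (a b : I) : (a < m)%N -> (b < m)%N -> (a == prim b) = false.
Proof. by move=> ha hb; apply/eqP => /(congr1 val); rewrite val_prim /=; lia. Qed.

Lemma op_beta (a b : I) y : a != b -> a != prim b ->
  op 0 B (tn 2 (e [:: a; b]) y)
   = tn 2 (e [:: b; a]) y + (z * (a < b)%:R) *: tn 2 (e [:: a; b]) y.
Proof.
move=> nab /negbTE nap; rewrite op0_ev -tnZl -tnDl; congr (tn 2 _ y).
transitivity (\sum_c \sum_d (((c == b) && (d == a))%:R * 1) *: e [:: c; d] +
  \sum_c \sum_d (((c == a) && (d == b))%:R * (z * (a < b)%:R)) *: e [:: c; d]); last first.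
  by rewrite !sum_e2 scale1r.
rewrite -big_split; apply: eq_bigr => c _; rewrite -big_split; apply: eq_bigr => d _ /=.
rewrite -scalerDl; congr (_ *: _).
rewrite betaE // (negbTE nab) nap andbF /= -!mulnb !natrM; ring.
Qed.

(** No two letters below m are primes of each other, so γ' and its truncation inside β' vanish on
    them and the type A crossing remains. *)
Lemma Smat_low (a b c d : I) : (a < m)%N -> (b < m)%N ->
  Smat c d a b = ((c == b) && (d == a))%:R * (if a == b then qi else 1)
   - z * (((c == a) && (d == b))%:R * (b < a)%:R).
Proof.
move=> ha hb; rewrite /Smat betaE // gammaE // lt_prim_low // !andbF /= mulr0n mul0r mulr0 addr0 subr0.
rewrite -!mulnb !natrM.
have [->|nab] := eqVneq a b; first by rewrite ltnn /qgap /=; ring.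
have [h|h|h] := ltngtP (val a) (val b).
- by rewrite /=; ring.
- by rewrite /=; ring.
- by move/val_inj: h nab => ->; rewrite eqxx.
Qed.

Lemma op_S (a b : I) y : (a < m)%N -> (b < m)%N ->
  op 0 Smat (tn 2 (e [:: a; b]) y)
   = (if a == b then qi else 1) *: tn 2 (e [:: b; a]) y - (z * (b < a)%:R) *: tn 2 (e [:: a; b]) y.
Proof.
move=> ha hb; rewrite op0_ev -scaleNr -!tnZl -tnDl; congr (tn 2 _ y).
rewrite -!sum_e2 -big_split; apply: eq_bigr => c _; rewrite -big_split; apply: eq_bigr => d _ /=.
rewrite -scalerDl Smat_low //; congr (_ *: _); ring.
Qed.

(* x lives in degree k and involves only letters below c; for c <= m beta' acts on
   such vectors as in type A. *)
Definition lowvec (c k : nat) (x : vc) :=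
  forall w, ~~ ((size w == k) && all (fun a : I => a < c)%N w) -> x w = 0.

Lemma lowvec_sum c k (J : Type) r (P : pred J) (F : J -> vc) :
  (forall j, P j -> lowvec c k (F j)) -> lowvec c k (\sum_(j <- r | P j) F j).
Proof. by move=> h w hw; rewrite vec_sumE big1 // => j /h ->. Qed.

Lemma lowvecZ c k t x : lowvec c k x -> lowvec c k (t *: x).
Proof. by move=> hx w hw; rewrite vec_scaleE hx // mulr0. Qed.

Lemma lowvec_tn c p s x y : lowvec c p x -> lowvec c s y -> lowvec c (p + s) (tn p x y).
Proof.
move=> hx hy w hw; rewrite /tn; case: (boolP ((size (take p w) == p) && all (fun a : I => a < c)%N (take p
    w))) => [|/hx ->]; last by rewrite mul0r.
case: (boolP ((size (drop p w) == s) && all (fun a : I => a < c)%N (drop p w))) => [|/hy ->]; last by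
    rewrite mulr0.
move=> /andP [/eqP h1 h2] /andP [/eqP h3 h4]; case/negP: hw.
have ew := esym (cat_take_drop p w).
by rewrite [X in size X]ew [X in all _ X]ew size_cat all_cat h1 h2 h3 h4 eqxx.
Qed.

Lemma lowvec_ev c (a : I) : (a < c)%N -> lowvec c 1 (e [:: a]).
Proof.
move=> h w hw; rewrite /ev; case: eqP => // e1; move: hw; rewrite e1 /= h //.
Qed.

Lemma lowvec_nil c : lowvec c 0 (e [::]).
Proof. by move=> w hw; rewrite /ev; case: eqP => // e1; move: hw; rewrite e1. Qed.

Lemma lowvec_mono c d k x : (c <= d)%N -> lowvec c k x -> lowvec d k x.
Proof.
move=> cd hx w hw; apply: hx; apply: contra hw => /andP [-> /=].
by apply: sub_all => a h; apply: leq_trans h cd.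
Qed.

Lemma lowvec_consE c k x : lowvec c k.+1 x ->
  x = \sum_(a | (val a < c)%N) tn 1 (e [:: a]) (fun w => x (a :: w)).
Proof.
move=> hx; apply/funext => w; rewrite vec_sumE.
case: w => [|b w]; first by rewrite hx // big1 // => a _; rewrite /tn /= /ev mul0r.
have [hb|hb] := boolP (val b < c)%N.
  rewrite (bigD1 b) //= /tn /= take0 drop0 /ev eqxx mul1r big1 ?addr0 // => i /andP [_ /negbTE ni].
  by rewrite eqseq_cons eq_sym ni mul0r.
rewrite hx /= ?(negbTE hb) ?andbF // big1 // => i hi; rewrite /tn /= take0 drop0 /ev eqseq_cons.
by case: eqP => [ib|]; [rewrite ib hi in hb | rewrite mul0r].
Qed.

Lemma lowvec_cons c k x (a : I) : lowvec c k.+1 x -> lowvec c k (fun w => x (a :: w)).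
Proof.
move=> hx w hw; apply: hx; apply: contra hw => /=.
by rewrite eqSS => /and3P [-> _ ->].
Qed.

Lemma lowvec_rconsE c k x : lowvec c k.+1 x ->
  x = \sum_(a | (val a < c)%N) tn k (fun w => x (rcons w a)) (e [:: a]).
Proof.
move=> hx; apply/funext => w; rewrite vec_sumE.
have [hw|hw] := boolP ((size w == k.+1) && all (fun a : I => a < c)%N w); last first.
  rewrite hx // big1 // => a ha; rewrite /tn /ev; case: eqP => [ed|]; last by rewrite mulr0.
  by rewrite mulr1 -cats1 -ed cat_take_drop hx.
move: hw; case/lastP: w => // w b; rewrite size_rcons eqSS => /andP [/eqP sw].
rewrite all_rcons => /andP [hb _].
rewrite (bigD1 b) //= /tn -cats1 take_size_cat // drop_size_cat // /ev eqxx mulr1 cats1.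
rewrite big1 ?addr0 // => i /andP [_ /negbTE ni].
by rewrite eqseq_cons eq_sym ni mulr0.
Qed.

Lemma lowvec_rcons c k x (a : I) : lowvec c k.+1 x -> lowvec c k (fun w => x (rcons w a)).
Proof.
move=> hx w hw; apply: hx; apply: contra hw.
by rewrite size_rcons eqSS all_rcons => /and3P [-> _ ->].
Qed.

Lemma lowvec_op c k l (M : mat2 K I) x : (c <= m)%N ->
  (forall a b a' b' : I, (a < m)%N -> (b < m)%N -> M a' b' a b = 0 \/ (a' = a /\ b' = b) \/ (a' = b /\ b' =
      a)) ->
  lowvec c k x -> lowvec c k (op l M x).
Proof.
move=> cm hM; elim: l k x => [|l IH] k x hx w hw; last first.
  case: w hw => [|a w] // hw /=; case: k hx hw => [|k] hx hw.
    rewrite (_ : (fun v => _) = 0) ?(islin0 op_lin) //.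
    by apply/funext => v; rewrite hx.
  have [ha|ha] := boolP (val a < c)%N.
    apply: (IH k) => //; first exact: lowvec_cons.
    by apply: contra hw => /= /andP [/eqP -> ->]; rewrite eqxx ha.
  rewrite (_ : (fun v => _) = 0) ?(islin0 op_lin) //.
  by apply/funext => v; rewrite hx //= (negbTE ha) andbF.
case: w hw => [|a [|b w]] // hw; rewrite /op /=.
apply: big1 => c1 _; apply: big1 => c2 _.
have [hl|hl] := boolP ((size [:: c1, c2 & w] == k) && all (fun a : I => a < c)%N [:: c1, c2 & w]); last by
    rewrite hx // mulr0.
move: (hl) => /= /and4P [/eqP sk h1 h2 h3].
have [->|h] := hM c1 c2 a b (leq_trans h1 cm) (leq_trans h2 cm); first by rewrite mul0r.
case/negP: hw; rewrite /= sk eqxx h3.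
by case: h => [[-> ->]|[-> ->]]; rewrite h1 h2.
Qed.

Lemma betaV_low_supp (a b a' b' : I) : (a < m)%N -> (b < m)%N ->
  B a' b' a b = 0 \/ (a' = a /\ b' = b) \/ (a' = b /\ b' = a).
Proof.
move=> ha hb; rewrite betaE // lt_prim_low // andbF /= mul0r subr0.
case: (altP (a' =P b)) => [->|n1]; case: (altP (b' =P a)) => [->|n2]; rewrite /= ?mul0r ?add0r; auto;
  case: (altP (_ =P _)) => e1; try case: (altP (_ =P _)) => e2; rewrite /= ?mulr0; auto.
Qed.

Lemma Smat_low_supp (a b a' b' : I) : (a < m)%N -> (b < m)%N ->
  Smat a' b' a b = 0 \/ (a' = a /\ b' = b) \/ (a' = b /\ b' = a).
Proof.
move=> ha hb; rewrite Smat_low //.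
case: (altP (a' =P b)) => [->|n1]; case: (altP (b' =P a)) => [->|n2]; rewrite /= ?mul0r ?add0r; auto;
  case: (altP (_ =P _)) => e1; try case: (altP (_ =P _)) => e2; rewrite /= ?mulr0 ?mul0r ?mulr0 ?oppr0; auto.
Qed.

(** Each direction uses the crossing that has no correction term: among letters below m, [Smat]
    simply exchanges a and b if a < b, and β' does so if b < a. A letter larger than all those it
    passes thus travels cleanly, to the left by [Smat] and to the right by β'. *)
Fixpoint pull_left k : vc -> vc := if k is k'.+1 then fun f => pull_left k' (op k' Smat f) else id.
Fixpoint push_right k : vc -> vc := if k is k'.+1 then fun f => op k' B (push_right k' f) else id.

Lemma pull_left_alg k : al k.+1 (pull_left k).
Proof.
elim: k => [|k IH]; first exact: alg_id.
apply: (alg_comp (B := pull_left k)); first exact: alg_mono IH.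
by apply: alg_op => //; exact: gen_S.
Qed.

Lemma push_right_alg k : al k.+1 (push_right k).
Proof.
elim: k => [|k IH]; first exact: alg_id.
apply: (alg_comp (B := op k B) (C := push_right k)); last exact: alg_mono IH.
by apply: alg_op => //; exact: gen_B.
Qed.

Lemma pull_left_low c k l x : (c <= m)%N -> lowvec c k x -> lowvec c k (pull_left l x).
Proof.
move=> cm; elim: l x => [|l IH] x hx //=; apply: IH.
by apply: lowvec_op => //; exact: Smat_low_supp.
Qed.

Lemma push_right_low c k l x : (c <= m)%N -> lowvec c k x -> lowvec c k (push_right l x).
Proof.
move=> cm; elim: l x => [|l IH] x hx //=.
by apply: lowvec_op => //; [exact: betaV_low_supp | exact: IH].
Qed.

Lemma tn1_ev (a b : I) : tn 1 (e [:: a]) (e [:: b]) = e [:: a; b].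
Proof. exact: (tn_ev _ [:: a]). Qed.

Lemma tn2_nil (x : vc) : (forall w, size w != 2 -> x w = 0) -> tn 2 x (e [::]) = x.
Proof.
move=> h; apply/funext => w; rewrite /tn /ev.
have [sw|sw] := ltnP 2 (size w).
  rewrite [x w]h ?gtn_eqF // -size_eq0 size_drop subn_eq0 leqNgt sw.
  by rewrite mulr0.
by rewrite take_oversize // drop_oversize // eqxx mulr1.
Qed.

Lemma tn2_ev_nil (a b : I) : tn 2 (e [:: a; b]) (e [::]) = e [:: a; b].
Proof.
by apply: tn2_nil => w hw; rewrite /ev; case: eqP => // e1; rewrite e1 in hw.
Qed.

Lemma op_S1 (a b : I) : (a < b)%N -> (b < m)%N -> op 0 Smat (e [:: a; b]) = e [:: b; a].
Proof.
move=> hab hb; rewrite -tn2_ev_nil op_S //; last exact: leq_ltn_trans (ltnW hab) hb.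
rewrite ltnNge (ltnW hab) mulr0 scale0r subr0 -[a == b]/(val a == val b) ltn_eqF //.
by rewrite scale1r tn2_ev_nil.
Qed.

Lemma op_B1 (a b : I) : (b < a)%N -> (a < m)%N -> op 0 B (e [:: a; b]) = e [:: b; a].
Proof.
move=> hab hb; rewrite -tn2_ev_nil op_beta //; first last.
- by rewrite lt_prim_low // (leq_ltn_trans (ltnW hab)).
- by rewrite -val_eqE gtn_eqF.
by rewrite ltnNge (ltnW hab) mulr0 scale0r addr0 tn2_ev_nil.
Qed.

Lemma pull_left_main (c : I) k x : (c < m)%N -> lowvec c k x ->
  pull_left k (tn k x (e [:: c])) = tn 1 (e [:: c]) x.
Proof.
move=> cm; elim: k x => [|k IH] x hx.
  have -> : x = x [::] *: e [::].
    apply/funext => w; rewrite vec_scaleE /ev; case: eqP => [->|nw]; first by rewrite mulr1.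
    by rewrite mulr0 hx //; case: w nw.
  rewrite /= tnZl tnZr tn_nil; congr (_ *: _).
  exact: esym (tn_ev _ [:: c] [::]).
rewrite {1}(lowvec_rconsE hx) tn_suml islin_sum; last exact: alg_lin (pull_left_alg k.+1).
rewrite [in RHS](lowvec_rconsE hx) tn_sumr; apply: eq_bigr => a ha /=.
rewrite -[k.+1]addn1 tnA tn1_ev -{2}[k]addn0 op_tnr op_S1 // -tn1_ev -(tnA k 1) .
rewrite (alg_local _ _ (pull_left_alg k)) ?addn1 // IH; last exact: lowvec_rcons hx.
by rewrite -[k.+1]/(1 + k)%N tnA.
Qed.

Lemma push_right_main (c : I) k x : (c < m)%N -> lowvec c k x ->
  push_right k (tn 1 (e [:: c]) x) = tn k x (e [:: c]).
Proof.
move=> cm; elim: k x => [|k IH] x hx.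
  have -> : x = x [::] *: e [::].
    apply/funext => w; rewrite vec_scaleE /ev; case: eqP => [->|nw]; first by rewrite mulr1.
    by rewrite mulr0 hx //; case: w nw.
  rewrite /= tnZl tnZr tn_nil; congr (_ *: _).
  exact: (tn_ev _ [:: c] [::]).
rewrite {1}(lowvec_rconsE hx) tn_sumr islin_sum; last exact: alg_lin (push_right_alg k.+1).
rewrite [in RHS](lowvec_rconsE hx) tn_suml; apply: eq_bigr => a ha /=.
rewrite -(tnA 1 k) (alg_local _ _ (push_right_alg k)) // IH; last exact: lowvec_rcons hx.
rewrite -[(1 + k)%N]/(k.+1) -[k.+1]addn1 !tnA !tn1_ev.
by rewrite -{1}[k]addn0 op_tnr op_B1.
Qed.
End Low.

(** * Column vectors *)
Section Geometric.
Variables (R : comPzRingType) (t : R) (d : nat).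
Implicit Types A : {set 'I_d}.

Definition above A (b : 'I_d) := #|[set y in A | (b < y)%N]|.

(** In decreasing order the elements of A have exponents 0, 1, 2, ..., so this is a geometric
    series; removing the maximum lowers all other exponents by one. *)
Lemma sum_above A : (t - 1) * \sum_(b in A) t ^+ above A b = t ^+ #|A| - 1.
Proof.
move: {2}#|A| (erefl #|A|) => k; elim: k A => [|k IH] A cA.
  by move/cards0_eq: cA => ->; rewrite big_set0 cards0 expr0 subrr mulr0.
have /card_gt0P [b0 hb0] : (0 < #|A|)%N by rewrite cA.
pose b := [arg max_(i > b0 in A) (i : nat)].
have [bA hb] : b \in A /\ forall y, y \in A -> (y <= b)%N.
  by rewrite /b; case: arg_maxnP.
have cAb : #|A :\ b| = k by move: cA; rewrite (cardsD1 b) bA => -[].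
rewrite (big_setD1 b) //=.
have -> : above A b = 0%N.
  apply/eqP; rewrite cards_eq0; apply/eqP/setP => y; rewrite !inE.
  by apply/negP => /andP [/hb]; rewrite ltnNge => ->.
rewrite (eq_bigr (fun i => t * t ^+ above (A :\ b) i)); last first.
  move=> i; rewrite !inE => /andP [nib iA]; rewrite -exprS; congr (t ^+ _).
  rewrite /above (cardsD1 b) !inE bA /= ltn_neqAle hb // -val_eqE in nib *.
  rewrite nib /=; congr (_.+1); apply: eq_card => y; rewrite !inE.
  by rewrite andbA.
rewrite -big_distrr /= mulrDr mulrCA (IH _ cAb) cA exprS expr0 cAb; ring.
Qed.

Lemma aboveU1 A b j : j \notin A -> above (j |: A) b = (above A b + (b < j))%N.
Proof.
move=> jA; rewrite /above; case: (ltnP b j) => h.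
  rewrite (cardsD1 j) !inE eqxx h /= addnC; congr (_ + _)%N.
  apply: eq_card => y; rewrite !inE; case: eqP => [->|] //=.
  by rewrite (negbTE jA).
rewrite addn0; apply: eq_card => y; rewrite !inE; case: eqP => [->|] //=.
by rewrite (negbTE jA) ltnNge h.
Qed.

Lemma aboveD1 A b j : b \in A -> above A j = (above (A :\ b) j + (j < b))%N.
Proof. by move=> bA; rewrite -{1}(setD1K bA) aboveU1 // !inE eqxx. Qed.
End Geometric.

Section Columns.
Variables (K : comPzRingType) (q qi : K) (m : nat).
Hypothesis qqi : q * qi = 1.
Local Notation I := 'I_(m.*2).
Local Notation vc := (vec K I).
Local Notation e := (@ev K I).
Local Notation B := (@betaV K q qi m).
Local Notation C := (@gammaV K q qi m).
Local Notation S := (@Smat K q qi m).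
Local Notation z := (qgap q qi).
Local Notation al := (alg (@gen K q qi m)).
Local Notation low := (@lowvec K m).
Local Notation ML := (@pull_left K q qi m).
Local Notation MR := (@push_right K q qi m).
Local Notation cup := (@cup_vec K q qi m).

Lemma tnA1 p (x y w : vc) : tn p.+1 (tn p x y) w = tn p x (tn 1 y w).
Proof. by rewrite -[p.+1]addn1 tnA. Qed.

(** Quantum exterior product, expanded along its last letter and meant for k = #|A|. A word listing
    A once gets (-q) to the number of its inversions, since the letters counted by [above A b] all
    stand before b. *)
Fixpoint qwedge (k : nat) (A : {set I}) : vc :=
  if k is k'.+1 then
    \sum_(b in A) (- q) ^+ above A b *: tn k' (qwedge k' (A :\ b)) (e [:: b])
  else e [::].

(** Sum over the k + 1 shortest coset representatives that insert the last letter among the first k,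
    weighted by (-q)^length. The full antisymmetrizer would multiply a wedge by a quantum factorial,
    which may vanish in K. *)
Fixpoint antisymmetrizer k : vc -> vc :=
  if k is k'.+1 then fun f => (- q) *: antisymmetrizer k' (op k' S f) + f else id.

Lemma antisymmetrizer_alg k : al k.+1 (antisymmetrizer k).
Proof.
elim: k => [|k IH]; first exact: alg_id.
apply: (@alg_lc _ _ _ _ (- q) (fun f => antisymmetrizer k (op k S f)) id); last exact: alg_id.
apply: (@alg_comp _ _ _ _ (antisymmetrizer k) (op k S)); first exact: alg_mono IH.
by apply: alg_op => //; exact: gen_S.
Qed.

(** The wedge is expanded along its last letter b. Crossing b with j gives the exchanged pair, to
    which induction applies, and for b > j also a multiple of z that rebuilds the wedge of A
    followed by j. These multiples form a geometric series. *)
Lemma antisymmetrizer_qwedge k (A : {set I}) (j : I) : #|A| = k ->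
  {in A, forall a : I, (a < m)%N} -> (j < m)%N ->
  antisymmetrizer k (tn k (qwedge k A) (e [:: j])) =
    if j \in A then 0 else (- q) ^+ above A j *: qwedge k.+1 (j |: A).
Proof.
elim: k A j => [|k IH] A j cA hA jm.
  move/cards0_eq: cA => ->; rewrite inE /= tn_nil.
  have h0 (x : I) : above set0 x = 0%N.
    by apply/eqP; rewrite cards_eq0; apply/eqP/setP => y; rewrite !inE.
  have h1 : above [set j] j = 0%N.
    by apply/eqP; rewrite cards_eq0; apply/eqP/setP => y; rewrite !inE; case: eqP => [->|]; rewrite ?ltnn.
  by rewrite setU0 big_set1 h0 h1 !expr0 !scale1r tn_nil.
have cAb b : b \in A -> #|A :\ b| = k by move=> bA; move: cA; rewrite (cardsD1 b) bA => -[].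
have linQ := alg_lin (antisymmetrizer_alg k).
pose f := tn k.+1 (qwedge k.+1 A) (e [:: j]).
have step b : b \in A ->
    antisymmetrizer k (op k S (tn k.+1 (tn k (qwedge k (A :\ b)) (e [:: b])) (e [:: j]))) =
    (if b == j then qi else 1) *: tn k.+1 (antisymmetrizer k (tn k (qwedge k (A :\ b)) (e [:: j]))) (e [:: b])
    - (z * (j < b)%:R * (- q) ^+ above A b) *: f.
  move=> bA; rewrite -[k.+1]addn1 tnA tn1_ev -{2}[k]addn0 op_tnr.
  rewrite -(tn2_ev_nil) op_S ?(hA b bA) // !tn2_ev_nil -scaleNr tnDr !tnZr -!tn1_ev -!(tnA k 1) addn1.
  rewrite (islinD linQ) !(islinZ linQ) !(alg_local _ _ (antisymmetrizer_alg k) (leqnn k.+1)).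
  rewrite (IH (A :\ b) b) ?cAb ?(hA b bA) //; last by move=> a; rewrite inE => /andP [_ /hA].
  rewrite !inE eqxx /= setD1K // (aboveD1 _ bA) ltnn addn0.
  by rewrite tnZl -!scaleNr scalerA mulNr.
have IHb b : b \in A -> antisymmetrizer k (tn k (qwedge k (A :\ b)) (e [:: j])) =
   if j \in A :\ b then 0 else (- q) ^+ above (A :\ b) j *: qwedge k.+1 (j |: (A :\ b)).
  by move=> bA; apply: IH; rewrite ?cAb // => a; rewrite inE => /andP [_ /hA].
have fE : f = \sum_(b in A) (- q) ^+ above A b *:
     tn k.+1 (tn k (qwedge k (A :\ b)) (e [:: b])) (e [:: j]).
  by rewrite /f /= tn_suml; apply: eq_bigr => b _; rewrite tnZl.
rewrite -/f [LHS]/=.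
(* Since q z = (-q)^2 - 1, this is [sum_above] for the elements of A above j. *)
have tel : q * z * \sum_(b in A | (j < b)%N) ((- q) ^+ 2) ^+ above A b = ((-q) ^+ 2) ^+ above A j - 1.
  rewrite /above -(sum_above ((- q) ^+ 2) [set y in A | (j < y)%N]); congr (_ * _).
    by rewrite /qgap mulrBr qqi; ring.
  rewrite (eq_bigl (fun b => b \in [set y in A | (j < y)%N])); last by move=> b; rewrite inE.
  apply: eq_bigr => b; rewrite inE => /andP [_ jb]; congr (_ ^+ _).
  apply: eq_card => y; rewrite !inE; case: (ltnP b y) => h; rewrite ?andbF //.
  by rewrite (ltn_trans jb h) !andbT.
have e1 : (-q) *: antisymmetrizer k (op k S f) + f =
   (-q) *: (\sum_(b in A) ((- q) ^+ above A b * (if b == j then qi else 1)) *: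
       tn k.+1 (antisymmetrizer k (tn k (qwedge k (A :\ b)) (e [:: j]))) (e [:: b]))
   + ((-q) ^+ 2) ^+ above A j *: f.
  rewrite {1}fE (islin_sum op_lin) (islin_sum linQ).
  rewrite (eq_bigr (fun b => ((- q) ^+ above A b * (if b == j then qi else 1)) *:
       tn k.+1 (antisymmetrizer k (tn k (qwedge k (A :\ b)) (e [:: j]))) (e [:: b])
     + (- (z * ((j < b)%:R * ((- q)^+ 2) ^+ above A b))) *: f)); last first.
    move=> b bA; rewrite (islinZ op_lin) (islinZ linQ) step //.
    rewrite scalerBr !scalerA -scaleNr; congr (_ + _ *: _).
    rewrite -exprM mulnC exprM; ring.
  rewrite big_split /= scalerDr -addrA; congr (_ + _).
  rewrite -scaler_suml scalerA -{2}[f]scale1r -scalerDl; congr (_ *: _).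
  rewrite sumrN mulrN mulNr opprK -big_distrr mulrA /=.
  rewrite (_ : \sum_(i in A) _ = \sum_(b in A | (j < b)%N) ((- q) ^+ 2) ^+ above A b) ?tel ?subrK //.
  rewrite big_mkcondr; apply: eq_bigr => b _.
  by case: ifP; rewrite ?mul1r ?mul0r.
(* If j is in A, only b = j survives, because every other wedge still contains j; its factor - q *
   qi = -1 cancels the multiple of f. Otherwise the summands are those of the wedge of A and j, with
   last letter j or b. *)
rewrite e1; case: ifP => jA.
  rewrite (bigD1 j) //= big1 ?addr0; last first.
    move=> b /andP [bA nbj]; rewrite IHb // !inE jA [j == b]eq_sym nbj /=.
    by rewrite tn0l scaler0.
  rewrite IHb // eqxx !inE eqxx /= setD1K // tnZl !scalerA -scalerDl.
  rewrite -[RHS](scale0r f); congr (_ *: _).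
  rewrite (aboveD1 _ jA) ltnn addn0 -exprM mulnC exprM.
  rewrite expr2; move: (_ ^+ above _ _) => u.
  rewrite (_ : _ + _ = (1 - q * qi) * u * u); last by ring.
  by rewrite qqi subrr !mul0r.
have nj b : b \in A -> (b == j) = false.
  by move=> bA; apply/eqP => ebj; rewrite -ebj bA in jA.
rewrite [qwedge k.+2 _]/= big_setU1 ?jA //= scalerDr addrC; congr (_ + _).
  rewrite setU1K ?jA // scalerA aboveU1 ?jA // ltnn addn0; congr (_ *: _).
  by rewrite -exprM mulnC exprM expr2.
rewrite !scaler_sumr; apply: eq_bigr => b bA; rewrite IHb // !inE jA andbF tnZl !scalerA.
have -> : (j |: A) :\ b = j |: A :\ b.
  by apply/setP => y; rewrite !inE; case: (y =P j) => [->|] //=; rewrite ?andbT // eq_sym nj.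
congr (_ *: _); rewrite nj // mulr1 -mulrA -!exprD -exprS; congr (_ ^+ _).
rewrite aboveU1 ?jA // [in RHS](aboveD1 _ bA).
have := nj b bA; rewrite -val_eqE /=; lia.
Qed.

Definition initial_letters (c : nat) : {set I} := [set i : I | (i < c)%N].
Definition column_vec (c : nat) : vc := qwedge c (initial_letters c).

Lemma qwedge_low c k (A : {set I}) : {in A, forall a : I, (a < c)%N} -> low c k (qwedge k A).
Proof.
elim: k A => [|k IH] A hA; first exact: lowvec_nil.
apply: lowvec_sum => b bA; apply: lowvecZ; rewrite -[k.+1]addn1; apply: lowvec_tn.
  by apply: IH => a; rewrite inE => /andP [_ /hA].
exact/lowvec_ev/hA.
Qed.

Lemma column_vec_low c : low c c (column_vec c).
Proof. by apply: qwedge_low => a; rewrite inE. Qed.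

Lemma card_initial_letters c : (c <= m.*2)%N -> #|initial_letters c| = c.
Proof.
move=> hc; have wi : injective (widen_ord hc) by move=> i j /(congr1 val) /= /val_inj.
rewrite -[RHS](card_ord c) -(card_image wi).
apply: eq_card => i; rewrite inE; apply/idP/imageP => [h|[j _ ->]] //=.
by exists (Ordinal h) => //; exact: val_inj.
Qed.

Lemma initial_lettersS (c : I) : initial_letters c.+1 = c |: initial_letters c.
Proof. by apply/setP => y; rewrite !inE ltnS leq_eqVlt -val_eqE. Qed.

Lemma notin_initial_letters (c : I) : c \notin initial_letters c.
Proof. by rewrite inE ltnn. Qed.

Lemma above_top (c : I) : above (initial_letters c.+1) c = 0%N.
Proof.
apply/eqP; rewrite cards_eq0; apply/eqP/setP => y; rewrite !inE ltnS.
by case: leqP.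
Qed.

Lemma antisymmetrizer_kill (c j : I) : (c < m)%N -> (j < c)%N -> antisymmetrizer c (tn c (column_vec c) (e
    [:: j])) = 0.
Proof.
move=> cm jc; rewrite antisymmetrizer_qwedge ?card_initial_letters ?inE ?jc //; last exact: ltn_trans jc cm.
- by apply: ltnW; exact: ltn_ord.
- by move=> a; rewrite inE => h; exact: ltn_trans h cm.
Qed.

Lemma antisymmetrizer_top (c : I) : (c < m)%N -> antisymmetrizer c (tn c (column_vec c) (e [:: c])) =
    column_vec c.+1.
Proof.
move=> cm; rewrite antisymmetrizer_qwedge ?card_initial_letters ?(negbTE (notin_initial_letters c)) //.
- rewrite /column_vec initial_lettersS [X in _ ^+ X](_ : _ = 0%N) ?expr0 ?scale1r //.
  by apply/eqP; rewrite cards_eq0; apply/eqP/setP => y; rewrite !inE; case: ltngtP.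
- by apply: ltnW; exact: ltn_ord.
- by move=> a; rewrite inE => h; exact: ltn_trans h cm.
Qed.

Lemma column_vec_topE (c : I) : column_vec c.+1 = tn c (column_vec c) (e [:: c]) +
  \sum_(b in initial_letters c) (- q) ^+ above (initial_letters c.+1) b *: tn c (qwedge c (initial_letters
      c.+1 :\ b)) (e [:: b]).
Proof.
rewrite {1}/column_vec {1}initial_lettersS /= big_setU1 ?notin_initial_letters //= -initial_lettersS
    above_top expr0 scale1r.
congr (tn _ (qwedge _ _) _ + _).
by rewrite initial_lettersS setU1K ?notin_initial_letters.
Qed.

Fixpoint columns_vec (s : seq nat) : vc := if s is c :: s' then tn c (column_vec c) (columns_vec s') else e
    [::].

Lemma columns_vec_cat s t : columns_vec (s ++ t) = tn (sumn s) (columns_vec s) (columns_vec t).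
Proof. by elim: s => [|c s IH] /=; rewrite ?tn_nil // IH tnA. Qed.

Lemma columns_vec_low c s : all (fun d => d <= c)%N s -> low c (sumn s) (columns_vec s).
Proof.
elim: s => [|d s IH] /=; first by move=> _; exact: lowvec_nil.
move=> /andP [hd hs]; apply: lowvec_tn; last exact: IH.
exact: (lowvec_mono hd (@column_vec_low d)).
Qed.

(** The letter j is pulled left through the columns of b and antisymmetrized into the column of
    height c. Those columns involve only letters below c, so j = c passes cleanly. For j < c there
    may be corrections, but whichever letter arrives is below c, hence already in the column, and is
    killed. *)
Lemma add_box_operator (c : I) (p b : seq nat) : (c < m)%N -> all (fun d => d <= c)%N b ->
  exists2 G, al (sumn (p ++ (c : nat) :: b)).+1 G &
    forall (j : I) y, (j <= c)%N ->
      G (tn (sumn (p ++ (c : nat) :: b)) (columns_vec (p ++ (c : nat) :: b)) (tn 1 (e [:: j]) y)) =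
      if j == c then tn (sumn (p ++ c.+1 :: b)) (columns_vec (p ++ c.+1 :: b)) y else 0.
Proof.
move=> cm hb; set sb := sumn b; have lb : low c sb (columns_vec b) := columns_vec_low hb.
have [G1 aG1 hG1] := alg_shift c (pull_left_alg q qi m sb).
have [G2 aG2 hG2] := alg_shift (sumn p) (alg_comp (alg_mono (leq_addr sb c.+1) (antisymmetrizer_alg c))
    (alg_mono (leqnn _) (eq_rect _ (fun k => al k G1) aG1 _ (addnS c sb)))).
exists G2; first by rewrite sumn_cat /= -addnS.
move=> j y jc; rewrite sumn_cat /= -/sb.
rewrite !columns_vec_cat /= tnA tnA -[in LHS](tnA sb 1) hG2 hG1.
rewrite (alg_local _ _ (pull_left_alg q qi m sb)) ?addn1 //.
have linQ := alg_lin (antisymmetrizer_alg c).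
case: eqP => [->|njc].
  rewrite pull_left_main // -[sb.+1]add1n tnA -tnA addn1 (alg_local _ _ (antisymmetrizer_alg c)) //
      antisymmetrizer_top //.
  by rewrite sumn_cat /= -/sb !tnA.
have ltjc : (j < c)%N by rewrite ltn_neqAle jc andbT; apply/eqP => /val_inj.
have : low c (sb + 1) (ML sb (tn sb (columns_vec b) (e [:: j]))).
  by apply: pull_left_low; [ | exact: ltnW | apply: lowvec_tn => //; exact: lowvec_ev].
rewrite addn1 => lx; rewrite (lowvec_consE lx) tn_suml tn_sumr (islin_sum linQ).
rewrite big1 ?tn0r // => a ac.
by rewrite -[sb.+1]add1n tnA -tnA addn1 (alg_local _ _ (antisymmetrizer_alg c)) // antisymmetrizer_kill // tn0l.
Qed.

(** The column of height c + 1 is split before its last letter, which is pushed right through b. The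
    part ending in c passes cleanly with coefficient 1. Of the other parts only the letter that
    comes out matters; it is again below c, and the vectors left behind stay unspecified as x j. *)
Lemma remove_box_operator (c : I) (p b : seq nat) : (c < m)%N -> all (fun d => d <= c)%N b ->
  exists2 H, al (sumn (p ++ (c : nat) :: b)).+1 H &
    exists x : I -> vc, forall y,
      H (tn (sumn (p ++ c.+1 :: b)) (columns_vec (p ++ c.+1 :: b)) y) =
      tn (sumn (p ++ (c : nat) :: b)) (columns_vec (p ++ (c : nat) :: b)) (tn 1 (e [:: c]) y)
      + \sum_(j | (val j < c)%N) tn (sumn (p ++ (c : nat) :: b)) (x j) (tn 1 (e [:: j]) y).
Proof.
move=> cm hb; set sb := sumn b; have lb : low c sb (columns_vec b) := columns_vec_low hb.
have aMR := push_right_alg q qi m sb; have linM := alg_lin aMR.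
have [G2 aG2 hG2] := alg_shift (sumn p + c) aMR.
exists G2; first by rewrite sumn_cat /= addnA -addnS.
pose xx (a : I) := MR sb (tn 1 (e [:: a]) (columns_vec b)).
exists (fun j => \sum_(a in initial_letters c) (- q) ^+ above (initial_letters c.+1) a *:
     tn (sumn p + c) (tn (sumn p) (columns_vec p) (qwedge c (initial_letters c.+1 :\ a))) (fun w => xx a
         (rcons w j))) => y.
have assoc (A : vc) (a : I) :
    G2 (tn (sumn p + (c.+1 + sb)) (tn (sumn p) (columns_vec p) (tn c.+1 (tn c A (e [:: a])) (columns_vec b))) y)
    = tn (sumn p + c) (tn (sumn p) (columns_vec p) A) (tn sb.+1 (xx a) y).
  rewrite -(alg_local _ _ aMR) // -hG2; congr G2.
  by rewrite -[sb.+1]/(1 + sb)%N !(tnA, tnA1).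
rewrite !sumn_cat /= -/sb !columns_vec_cat /= column_vec_topE !tnDl tnDr tnDl (islinD (alg_lin aG2)).
rewrite assoc; congr (_ + _).
  by rewrite /xx push_right_main // !(tnA, tnA1).
rewrite tn_suml tn_sumr tn_suml (islin_sum (alg_lin aG2)).
under [in RHS]eq_bigr => j _ do rewrite tn_suml.
rewrite exchange_big /=; apply: eq_bigr => a; rewrite inE => ac.
have la : low c sb.+1 (xx a).
  by apply: push_right_low; [ | exact: ltnW | apply: (@lowvec_tn _ _ _ 1 sb) => //; exact: lowvec_ev].
under [in RHS]eq_bigr => j _ do rewrite tnZl.
rewrite -scaler_sumr !(tnZl, tnZr) (islinZ (alg_lin aG2)); congr (_ *: _).
rewrite assoc {1}(lowvec_rconsE la) tn_suml tn_sumr; apply: eq_bigr => j _.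
by rewrite addnA !(tnA, tnA1).
Qed.

Lemma tn2_cons (a b : I) y : tn 2 (e [:: a; b]) y = tn 1 (e [:: a]) (tn 1 (e [:: b]) y).
Proof. by rewrite -tn1_ev tnA1. Qed.

(** Zigzag relation: γ' is a cap followed by a cup, and the cap joining j to the left leg
    straightens the strand, as [kappa] and [kappai] are inverse. *)
Lemma gamma_cupr (j : I) y :
  op 0 C (tn 1 (e [:: j]) (tn 2 cup y)) = tn 2 cup (tn 1 (e [:: j]) y).
Proof.
transitivity (\sum_a (kappai q qi a * ((j == prim a)%:R * kappa q qi a)) *:
   tn 2 cup (tn 1 (e [:: prim a]) y)).
  rewrite {1}/cup_vec tn_suml tn_sumr (islin_sum op_lin); apply: eq_bigr => a _.
  by rewrite tnZl tnZr (islinZ op_lin) tn2_cons -(tn2_cons j a) op_gamma // scalerA.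
rewrite (bigD1 (prim j)) //= primK eqxx mul1r mulrC kappa_kappai // scale1r big1 ?addr0 // => a naj.
by rewrite -eq_prim [_ == a]eq_sym (negbTE naj) mul0r mulr0 scale0r.
Qed.

Lemma gamma_cupl (j : I) y :
  op 1 C (tn 2 cup (tn 1 (e [:: j]) y)) = tn 1 (e [:: j]) (tn 2 cup y).
Proof.
transitivity (\sum_a (kappai q qi a * ((prim a == prim j)%:R * kappa q qi j)) *:
   tn 1 (e [:: a]) (tn 2 cup y)).
  rewrite {1}/cup_vec tn_suml (islin_sum op_lin); apply: eq_bigr => a _.
  rewrite tnZl (islinZ op_lin) tn2_cons -(tn2_cons (prim a) j).
  by rewrite -[op 1 C]/(op (1 + 0)%N C) op_tnr op_gamma // tnZr scalerA.
rewrite (bigD1 j) //= eqxx mul1r mulrC kappa_kappai // scale1r big1 ?addr0 // => a naj.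
by rewrite (inj_eq (@prim_inj m)) (negbTE naj) mul0r mulr0 scale0r.
Qed.

Fixpoint cups_vec f : vc := if f is f'.+1 then tn 2 cup (cups_vec f') else e [::].

(** Passing the cups by γ' instead of β' works for every letter, primed or not, and leaves no
    correction. *)
Lemma move_right_cups f : exists2 B, al f.*2.+1 B &
  forall (j : I) y, B (tn 1 (e [:: j]) (tn f.*2 (cups_vec f) y)) = tn f.*2 (cups_vec f) (tn 1 (e [:: j]) y).
Proof.
elim: f => [|f [B0 aB hB]].
  by exists id; [exact: alg_id | move=> j y; rewrite /= !tn_nil].
have [B' aB' hB'] := alg_shift 2 aB.
exists (fun f => B' (op 0 C f)).
  apply: (@alg_comp _ _ _ _ B' (op 0 C)); first by rewrite doubleS.
  by apply: alg_op => //; exact: gen_C.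
by move=> j y; rewrite doubleS -[cups_vec f.+1]/(tn 2 cup (cups_vec f)) -[f.*2.+2]add2n !tnA gamma_cupr hB' hB.
Qed.

Lemma move_left_cups f : exists2 B, al f.*2.+1 B &
  forall (j : I) y, B (tn f.*2 (cups_vec f) (tn 1 (e [:: j]) y)) = tn 1 (e [:: j]) (tn f.*2 (cups_vec f) y).
Proof.
elim: f => [|f [B0 aB hB]].
  by exists id; [exact: alg_id | move=> j y; rewrite /= !tn_nil].
have [B' aB' hB'] := alg_shift 2 aB.
exists (fun f => op 1 C (B' f)).
  apply: (@alg_comp _ _ _ _ (op 1 C) B'); last by rewrite doubleS.
  by apply: alg_op; [rewrite doubleS | exact: gen_C].
by move=> j y; rewrite doubleS -[cups_vec f.+1]/(tn 2 cup (cups_vec f)) -[f.*2.+2]add2n !tnA hB' hB gamma_cupl.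
Qed.
End Columns.

(** * Words, weights and diagrams *)
Section Shapes.
Variable m : nat.
Local Notation I := 'I_(m.*2).
Local Notation N := (m.*2).
Implicit Types (w v : seq I) (a b : I).

(* On words of equal length, code compares lexicographically. *)
Fixpoint code (w : seq I) : nat := if w is a :: u then (a * N ^ size u + code u)%N else 0%N.

Lemma code_lt w : (code w < N ^ size w)%N.
Proof.
elim: w => [|a w IH] //=; rewrite expnS.
apply: (@leq_trans (a * N ^ size w + N ^ size w)); first by rewrite ltn_add2l.
by rewrite -mulSnr leq_mul2r ltn_ord orbT.
Qed.

Lemma code_rcons w a : code (rcons w a) = (code w * N + a)%N.
Proof.
elim: w => [|b w IH] /=; first by rewrite muln1 addn0.
by rewrite IH size_rcons expnSr mulnDl addnA mulnA.
Qed.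

Lemma code_inj w v : size w = size v -> code w = code v -> w = v.
Proof.
elim: w v => [|a w IH] [|b v] //= [sz] hc.
have ltw := code_lt w; have hv := code_lt v; rewrite -sz in hc hv.
have N0 : (0 < N ^ size w)%N by apply: leq_ltn_trans ltw.
have eab : a = b.
  apply: val_inj; have := congr1 (divn^~ (N ^ size w)%N) hc.
  by rewrite !divnMDl // !divn_small // !addn0.
by move: hc; rewrite eab => /addnI /(IH _ sz) ->.
Qed.

Lemma code_rcons_lt v w b a : size v = size w ->
  (code (rcons v b) < code (rcons w a))%N -> (code v < code w)%N \/ v = w /\ (b < a)%N.
Proof.
move=> sz; rewrite !code_rcons => h; case: (ltngtP (code v) (code w)) => h2; first by left.
  have := ltn_ord a; nia.
by right; split; [apply: code_inj | move: h; rewrite h2 ltn_add2l].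
Qed.

Lemma code_cons_ltl v w b a : size v = size w -> (b < a)%N -> (code (b :: v) < code (a :: w))%N.
Proof.
move=> sz ba /=; rewrite sz; have := code_lt v; rewrite sz => h.
have : (b.+1 * N ^ size w <= a * N ^ size w)%N by rewrite leq_mul2r ba orbT.
by rewrite mulSn; lia.
Qed.

Lemma code_cons_ltr v w a : size v = size w -> (code v < code w)%N -> (code (a :: v) < code (a :: w))%N.
Proof. by move=> sz h /=; rewrite sz ltn_add2l. Qed.

(** Coefficient of ε_{g+1} in the weight of v_{j+1}. So [shape_row] gives the rows of a diagram,
    whereas [weight] gives the pairings with simple coroots. *)
Definition omega_coef (j g : nat) : int := (j == g)%:Z - (j == pr m g)%:Z.
Definition shape_row w (g : nat) : int := \sum_(a <- w) omega_coef a g.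
Definition weight (g : 'I_m) w : int := \sum_(a <- w) wt g a.

Lemma wt_omega_coef (g : 'I_m) (a : I) :
  wt g a = if (g < m.-1)%N then omega_coef a g - omega_coef a g.+1 else omega_coef a g.
Proof.
rewrite /wt /omega_coef /pr /=; have := ltn_ord g; have := ltn_ord a.
move: (nat_of_ord a) (nat_of_ord g) => j k hj hk; rewrite -muln2 in hj *.
case: ifP => hk2.
  by case: (j =P k); case: (j =P k.+1); case: (j =P _ - k)%N; case: (j =P _ - k.+1)%N => /=; lia.
have -> : k = m.-1 by lia.
have -> : ((m * 2).-1 - m.-1)%N = m by lia.
by case: (j =P m.-1); case: (j =P m) => /=; lia.
Qed.

Lemma weight_shape_row (g : 'I_m) w :
  weight g w = if (g < m.-1)%N then shape_row w g - shape_row w g.+1 else shape_row w g.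
Proof.
rewrite /weight /shape_row; case: ifP => hg; rewrite -?sumrB; apply: eq_bigr => a _; by rewrite
    wt_omega_coef hg.
Qed.

Lemma weight_rcons g w a : weight g (rcons w a) = weight g w + wt g a.
Proof. by rewrite /weight big_rcons /= addrC. Qed.
Lemma shape_row_rcons g w a : shape_row (rcons w a) g = shape_row w g + omega_coef a g.
Proof. by rewrite /shape_row big_rcons /= addrC. Qed.

Definition partition_below (l : nat -> int) := (forall g, (g.+1 < m)%N -> l g.+1 <= l g) /\ 0 <= l m.-1.

Lemma partition_shape_row w : (0 < m)%N -> (forall g, 0 <= weight g w) -> partition_below (shape_row w).
Proof.
move=> m0 h; split=> [g hg|].
  have := h (Ordinal (ltnW hg)); rewrite weight_shape_row /=.
  by have -> : (g < m.-1)%N by [lia]; rewrite subr_ge0.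
have hm : (m.-1 < m)%N by lia.
by have := h (Ordinal hm); rewrite weight_shape_row /= ltnn.
Qed.

Lemma partition_le l g k : partition_below l -> (g <= k)%N -> (k < m)%N -> l k <= l g.
Proof.
move=> [hl _]; elim: k => [|k IH]; first by rewrite leqn0 => /eqP ->.
rewrite leq_eqVlt => /orP [/eqP -> //|]; rewrite ltnS => gk km.
by apply: le_trans (IH gk (ltnW km)); exact: hl.
Qed.

Lemma partition_ge0 l g : partition_below l -> (g < m)%N -> 0 <= l g.
Proof.
move=> hl gm; apply: le_trans hl.2 _; apply: partition_le => //; lia.
Qed.

Definition col_height (l : nat -> int) (t : nat) : nat := count (fun g => t%:Z < l g) (iota 0 m).
(** The number L of columns is fixed and diagrams are padded with zeros, so that a new box always
    raises an existing entry by one. *)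
Definition cols L (l : nat -> int) := [seq col_height l t | t <- iota 0 L].

Lemma count_ltn c k : count (fun g => g < c)%N (iota 0 k) = minn c k.
Proof.
elim: k => [|k IH]; first by rewrite minn0.
rewrite -addn1 iotaD count_cat IH /= add0n addn0; case: ltnP; lia.
Qed.

(** The new box in row c lies in column l c, counted from 0. That column has height c because the
    rows above must be longer for l' to be a partition; the later columns are no higher because l is
    one. *)
Lemma cols_add_box L l l' c : partition_below l -> partition_below l' -> (c < m)%N ->
  (forall g, (g < m)%N -> l' g = l g + (g == c)%:Z) -> l c < L%:Z ->
  exists p : seq nat, exists b : seq nat, [/\ cols L l = p ++ c :: b, cols L l' = p ++ c.+1 :: b & all (fun
      d => d <= c)%N b].
Proof.
move=> pl pl' cm hl hL; have l0 := partition_ge0 pl cm.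
have [t et] : exists t : nat, l c = t%:Z by exists `|l c|%N; lia.
have tL : (t < L)%N by lia.
have hup g : (g < c)%N -> l c < l g.
  move=> gc; have gm := ltn_trans gc cm.
  have := partition_le pl' (ltnW gc) cm; rewrite (hl _ gm) (hl _ cm) eqxx ltn_eqF //; lia.
have hdown g : (c < g)%N -> (g < m)%N -> l g <= l c.
  by move=> cg gm; apply: partition_le => //; exact: ltnW.
have cnt (P : pred nat) k : (k <= m)%N -> (forall g, (g < m)%N -> P g = (g < k)%N) -> count P (iota 0 m) = k.
  move=> km hP; rewrite -[RHS](minn_idPl km) -count_ltn; apply: eq_in_count => g.
  by rewrite mem_iota add0n => /hP.
have ct : col_height l t = c.
  apply: cnt => [|g gm]; first exact: ltnW.
  case: (ltngtP g c) => h; last by rewrite h -et ltxx.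
    by rewrite -et hup.
  by rewrite -et; apply/negP; rewrite ltNge hdown.
have ct' : col_height l' t = c.+1.
  apply: cnt => // g gm; rewrite hl // ltnS leq_eqVlt; have [->|/eqP ngc] := eqVneq g c.
    by rewrite et; lia.
  rewrite /= addr0; case: (ltngtP g c) => h //.
    by rewrite -et hup.
  by rewrite -et; apply/negP; rewrite ltNge hdown.
have cne s : s != t -> col_height l' s = col_height l s.
  move=> st; apply: eq_in_count => g; rewrite mem_iota add0n => gm; rewrite (hl _ gm).
  by case: eqP => [->|]; [rewrite et; lia | rewrite addr0].
exists [seq col_height l s | s <- iota 0 t], [seq col_height l s | s <- iota t.+1 (L - t.+1)].
have eL : L = (t + (1 + (L - t.+1)))%N by lia.
split.
- by rewrite /cols {1}eL iotaD map_cat /= ct.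
- rewrite /cols {1}eL iotaD map_cat /= ct'; congr (_ ++ _ :: _); apply/eq_in_map => s; rewrite mem_iota =>
    hs; apply: cne; lia.
apply/allP => d /mapP [s]; rewrite mem_iota => /andP [ts _] ->.
rewrite -[X in (_ <= X)%N](minn_idPl (ltnW cm)) -count_ltn /col_height -!size_filter.
apply: uniq_leq_size => [|g]; first by rewrite filter_uniq ?iota_uniq.
rewrite !mem_filter mem_iota add0n => /andP [h gm]; rewrite gm andbT ltnNge; apply/negP => cg.
have := partition_le pl cg gm; lia.
Qed.

Lemma cols_nil L : cols L (shape_row [::]) = nseq L 0%N.
Proof.
apply: (@eq_from_nth _ 0%N); rewrite size_map size_iota ?size_nseq // => t tL.
rewrite (nth_map 0%N) ?size_iota // nth_nseq if_same /col_height.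
rewrite (eq_count (a2 := pred0)) ?count_pred0 // => g; rewrite /shape_row big_nil /=.
by apply/negP; lia.
Qed.

Lemma shape_row_le w g : shape_row w g <= (size w)%:Z.
Proof.
elim: w => [|a w IH]; first by rewrite /shape_row big_nil.
rewrite /shape_row big_cons -/(shape_row w g) /omega_coef /=.
by case: (_ == g); case: (_ == _) => /=; lia.
Qed.

Lemma omega_coef_low a g : (a < m)%N -> (g < m)%N -> omega_coef a g = (g == a :> nat)%:Z.
Proof.
move=> am gm; rewrite /omega_coef /pr eq_sym; case: (nat_of_ord a =P (N.-1 - g)%N) => [|_]; last by rewrite
    subr0.
have := muln2 m; lia.
Qed.

Lemma omega_coef_high a g : (m <= a)%N -> (g < m)%N -> omega_coef a g = - (g == prim a :> nat)%:Z.
Proof.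
move=> am gm; have := ltn_ord a; rewrite /omega_coef /pr [nat_of_ord (prim a)]val_prim; have := muln2 m =>
    e2 ha.
case: eqP => [|_]; first by lia.
by do 2 case: eqP; lia.
Qed.

(** Such words are walks in the dominant chamber: a letter below m adds a box to the diagram, any
    other letter removes one. *)
Definition dominant w := forall p g, 0 <= weight g (take p w).

Lemma dominant_rcons w a : dominant (rcons w a) ->
  [/\ dominant w, forall g, 0 <= weight g w & forall g, 0 <= weight g (rcons w a)].
Proof.
move=> h; have hd : dominant w.
  move=> p g; have [hp|hp] := leqP p (size w).
    by have := h p g; rewrite -cats1 takel_cat.
  by rewrite take_oversize ?(ltnW hp) //; have := h (size w) g; rewrite -cats1 take_size_cat.
split=> // g; first by have := hd (size w) g; rewrite take_size.
by have := h (size w).+1 g; rewrite take_oversize // size_rcons.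
Qed.
End Shapes.

(** * Operators with a given leading entry *)
Section LightLeaves.
Variables (K : comPzRingType) (q qi : K) (m L : nat).
Hypothesis qqi : q * qi = 1.
Hypothesis m0 : (0 < m)%N.
Local Notation I := 'I_(m.*2).
Local Notation vc := (vec K I).
Local Notation e := (@ev K I).
Local Notation C := (@gammaV K q qi m).
Local Notation al := (alg (@gen K q qi m)).
Local Notation kap := (kappa q qi).
Local Notation kapi := (kappai q qi).
Local Notation cup := (@cup_vec K q qi m).
Local Notation cups := (@cups_vec K q qi m).
Local Notation zcol := (@columns_vec K q m).
Implicit Types (w v : seq I) (a b c : I).

Local Notation shape w := (cols m L (@shape_row m w)).

Lemma cols_rcons_low w a : dominant (rcons w a) -> (size w < L)%N -> (a < m)%N ->
  exists p b : seq nat, [/\ shape w = p ++ (a : nat) :: b, shape (rcons w a) = p ++ a.+1 :: b &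
    all (fun d => d <= a)%N b].
Proof.
move=> /dominant_rcons [_ h1 h2] sL am; apply: cols_add_box => //; try exact: partition_shape_row.
  by move=> g gm; rewrite shape_row_rcons omega_coef_low.
by apply: le_lt_trans (shape_row_le w a) _; lia.
Qed.

Lemma prim_ltm a : (m <= a)%N -> (prim a < m)%N.
Proof. by move=> h; rewrite [nat_of_ord (prim a)]val_prim; have := ltn_ord a; lia. Qed.

Lemma prim_ltP a b : (a < b)%N = (prim b < prim a)%N.
Proof.
rewrite [nat_of_ord (prim a)]val_prim [nat_of_ord (prim b)]val_prim.
by have := ltn_ord a; have := ltn_ord b; lia.
Qed.

Lemma cols_rcons_high w a : dominant (rcons w a) -> (size w < L)%N -> (m <= a)%N ->
  exists p b : seq nat, [/\ shape w = p ++ (prim a).+1 :: b, shape (rcons w a) = p ++ (prim a : nat) :: b &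
    all (fun d => d <= prim a)%N b].
Proof.
move=> /dominant_rcons [_ h1 h2] sL am.
have [|||g gm||p [b [e1 e2 hb]]] := @cols_add_box m L (shape_row (rcons w a)) (shape_row w) (prim a).
- exact: partition_shape_row.
- exact: partition_shape_row.
- exact: prim_ltm.
- by rewrite shape_row_rcons omega_coef_high // subrK.
- apply: le_lt_trans (_ : (size w)%:Z < _); last by lia.
  rewrite shape_row_rcons omega_coef_high ?prim_ltm // eqxx.
  by apply: le_trans (shape_row_le w (prim a)); lia.
by exists p, b; rewrite e1 e2.
Qed.

Lemma cols_sum w : dominant w -> (size w <= L)%N ->
  exists f, (sumn (shape w) + f.*2 = size w)%N.
Proof.
elim/last_ind: w => [|w a IH] hd; first by exists 0%N; rewrite cols_nil sumn_nseq.
rewrite size_rcons => sL; have [dw _ _] := dominant_rcons hd.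
have [f hf] := IH dw (ltnW sL).
have [am|am] := ltnP a m.
  have [p [b [e1 e2 _]]] := cols_rcons_low hd sL am.
  by exists f; rewrite e2 -hf e1 !sumn_cat /=; lia.
have [p [b [e1 e2 _]]] := cols_rcons_high hd sL am.
by exists f.+1; rewrite e2 -hf e1 !sumn_cat /=; lia.
Qed.

Lemma columns_vec_nil y : tn (sumn (shape [::])) (zcol (shape [::])) y = y.
Proof.
rewrite cols_nil sumn_nseq mul0n.
rewrite (_ : zcol _ = e [::]) ?tn_nil //.
by elim: L => //= k ->; rewrite tn_nil.
Qed.

Lemma ev_rcons w a y : tn (size w).+1 (e (rcons w a)) y = tn (size w) (e w) (tn 1 (e [:: a]) y).
Proof. by rewrite -tnA1 tn_ev cats1. Qed.

(** The next letter a is first moved left over the cups to the columns. If a < m it becomes a new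
    box. Otherwise γ' caps it with the letter [prim a] released from a column, and the cup that γ'
    leaves joins the others. The coefficient is a product of values of [kappa], hence a unit. *)
Lemma collapse_operator w f : dominant w -> (size w <= L)%N -> (sumn (shape w) + f.*2 = size w)%N ->
  exists2 B, al (size w) B & exists u ui : K, [/\ u * ui = 1,
    forall y, B (tn (size w) (e w) y) = u *: tn (sumn (shape w)) (zcol (shape w)) (tn f.*2 (cups f) y) &
    forall v y, size v = size w -> (code v < code w)%N -> B (tn (size w) (e v) y) = 0].
Proof.
elim/last_ind: w f => [|w a IH] f hd.
  rewrite cols_nil sumn_nseq mul0n add0n => _ /= /eqP; rewrite double_eq0 => /eqP ->.
  exists id; first exact: alg_id.
  exists 1, 1; split; rewrite ?mulr1 //.
  by move=> y; have := columns_vec_nil; rewrite cols_nil sumn_nseq mul0n => ->; rewrite /= !tn_nil scale1r.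
rewrite size_rcons => sL hf; have [dw _ _] := dominant_rcons hd.
have [f0 hf0] := cols_sum dw (ltnW sL).
have [B0 aB0 [u [ui [hu hB0 hB0v]]]] := IH f0 dw (ltnW sL) hf0.
have linB0 := alg_lin aB0.
have [M aM hM] := move_left_cups m qqi f0.
have [M' aM' hM'] := alg_shift (sumn (shape w)) aM.
have linM' := alg_lin aM'.
have start b y : M' (B0 (tn (size w).+1 (e (rcons w b)) y)) =
    u *: tn (sumn (shape w)) (zcol (shape w)) (tn 1 (e [:: b]) (tn f0.*2 (cups f0) y)).
  by rewrite ev_rcons hB0 (islinZ linM') hM' hM.
have startv v b y : size v = size w -> (code v < code w)%N ->
    M' (B0 (tn (size w).+1 (e (rcons v b)) y)) = 0.
  by move=> sv cv; rewrite -sv ev_rcons sv hB0v // (islin0 linM').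
have aMB : al (size w).+1 (fun x => M' (B0 x)).
  apply: alg_comp; last exact: alg_mono aB0.
  by apply: alg_mono aM'; rewrite -hf0 addnS.
(* A smaller word is either smaller before its last letter, where B0 kills it, or differs from w
   only by a smaller last letter b, which is left to F. *)
have fin F k ki : al (size w).+1 F -> k * ki = 1 ->
   (forall y, F (tn (sumn (shape w)) (zcol (shape w)) (tn 1 (e [:: a]) (tn f0.*2 (cups f0) y)))
      = k *: tn (sumn (shape (rcons w a))) (zcol (shape (rcons w a))) (tn f.*2 (cups f) y)) ->
   (forall b y, (b < a)%N -> F (tn (sumn (shape w)) (zcol (shape w)) (tn 1 (e [:: b]) (tn f0.*2 (cups f0)
       y))) = 0) ->
  exists2 B, al (size w).+1 B & exists u ui : K, [/\ u * ui = 1,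
    forall y, B (tn (size w).+1 (e (rcons w a)) y) = u *: tn (sumn (shape (rcons w a))) (zcol (shape (rcons
        w a))) (tn f.*2 (cups f) y) &
    forall v y, size v = (size w).+1 -> (code v < code (rcons w a))%N -> B (tn (size w).+1 (e v) y) = 0].
  move=> aF hk hF hFb; have linF := alg_lin aF; exists (fun x => F (M' (B0 x))); first exact: (alg_comp aF aMB).
  exists (u * k), (ui * ki); split.
  - by rewrite mulrACA hu hk mulr1.
  - by move=> y; rewrite start (islinZ linF) hF scalerA.
  move=> v y; case/lastP: v => // v b; rewrite size_rcons => -[sv] /(code_rcons_lt sv) [hv|[-> hb]].
    by rewrite startv // (islin0 linF).
  by rewrite start (islinZ linF) hFb // scaler0.
have [am|am] := ltnP a m.
  have [p [b [e1 e2 hb]]] := cols_rcons_low hd sL am.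
  have ff0 : f0 = f by move: hf hf0; rewrite e1 e2 !sumn_cat /=; lia.
  have [G aG hG] := add_box_operator qqi p am hb.
  apply: (fin G 1 1); rewrite ?mulr1 //.
  - by apply: alg_mono aG; rewrite -e1 -hf0 ltnS leq_addr.
  - by move=> y; rewrite e1 hG // eqxx -e2 ff0 scale1r.
  - move=> j y ja; rewrite e1 hG ?(ltnW ja) // ifF //.
    by apply/eqP => ej; rewrite ej ltnn in ja.
have [p [b [e1 e2 hb]]] := cols_rcons_high hd sL am; have pm := prim_ltm am.
have [H aH [x hH]] := remove_box_operator qqi p pm hb.
have es : sumn (shape w) = (sumn (shape (rcons w a))).+1 by rewrite e1 e2 !sumn_cat /=; lia.
have ff0 : f = f0.+1 by move: hf hf0; rewrite es; lia.
have aop : al (size w).+1 (op (sumn (shape (rcons w a))) C).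
  by apply: alg_op; [rewrite -hf0 es; lia | exact: gen_C].
have linop := @op_lin K I (sumn (shape (rcons w a))) C.
have opj j a' x0 y : op (sumn (shape (rcons w a))) C (tn (sumn (shape (rcons w a))) x0 (tn 1 (e [:: j]) (tn
    1 (e [:: a']) y)))
    = ((j == prim a')%:R * kap a') *: tn (sumn (shape (rcons w a))) x0 (tn 2 cup y).
  by rewrite -tn2_cons -[X in op X]addn0 op_tnr op_gamma // tnZr.
apply: (fin (fun x => op (sumn (shape (rcons w a))) C (H x)) (kap a) (kapi a)).
- apply: (alg_comp (B := op (sumn (shape (rcons w a))) C) (C := H)) => //.
  by apply: alg_mono aH; rewrite -e2 -es -hf0; lia.
- exact: kappa_kappai.
- move=> y; rewrite {1 2}e1 hH -e2 (islinD linop) (islin_sum linop) opj eqxx mul1r big1.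
    by rewrite addr0 ff0 doubleS -[cups f0.+1]/(tn 2 cup (cups f0)) -[f0.*2.+2]add2n tnA.
  move=> j ja; rewrite opj [_ == _](_ : _ = false) ?mul0r ?scale0r //.
  by apply/eqP => ej; rewrite ej ltnn in ja.
(* Now [prim b'] exceeds [prim a], while all released letters are at most [prim a], so every cap
   vanishes. *)
move=> b' y ba; rewrite e1 hH -e2 (islinD linop) (islin_sum linop) opj big1.
  by rewrite addr0 (inj_eq (@prim_inj m)) [_ == _](_ : _ = false) ?mul0r ?scale0r //;
   apply/eqP => ej; rewrite ej ltnn in ba.
move=> j ja; rewrite opj [_ == _](_ : _ = false) ?mul0r ?scale0r //.
apply/eqP => ej; move: ja; rewrite ej /= -prim_ltP; lia.
Qed.

(** The collapse is run backwards, emitting the last letter first, so an error has a smaller last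
    letter or the same one and an error further left; hence the comparison of reversed words. If a
    >= m, a cup is opened: its left leg b is absorbed into the column of height [prim a] and its
    right leg [prim b] is emitted. Legs b below [prim a] are killed, b = [prim a] emits a, and
    larger b emit letters below a, whatever the column becomes. *)
Lemma expand_operator w f : dominant w -> (size w <= L)%N -> (sumn (shape w) + f.*2 = size w)%N ->
  exists2 B, al (size w) B & exists (u ui : K) x, [/\ u * ui = 1,
    forall v, size v = size w -> ~~ (code (rev v) < code (rev w))%N -> x v = 0 &
    forall y, B (tn (sumn (shape w)) (zcol (shape w)) (tn f.*2 (cups f) y)) = tn (size w) (u *: e w + x) y].
Proof.
elim/last_ind: w f => [|w a IH] f hd.
  rewrite cols_nil sumn_nseq mul0n add0n => _ /= /eqP; rewrite double_eq0 => /eqP ->.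
  exists id; first exact: alg_id.
  exists 1, 1, 0; split; rewrite ?mulr1 //.
  by move=> y; have := columns_vec_nil; rewrite cols_nil sumn_nseq mul0n => ->; rewrite /= scale1r addr0.
rewrite size_rcons => sL hf; have [dw _ _] := dominant_rcons hd.
have [f0 hf0] := cols_sum dw (ltnW sL).
have [B0 aB0 [u [ui [x0 [hu hx0 hB0]]]]] := IH f0 dw (ltnW sL) hf0.
have linB0 := alg_lin aB0.
have [M aM hM] := move_right_cups m qqi f0.
have [M' aM' hM'] := alg_shift (sumn (shape w)) aM.
have linM' := alg_lin aM'.
have fin F k ki (X : I -> vc) : al (size w).+1 F -> k * ki = 1 ->
   (forall y, F (tn (sumn (shape (rcons w a))) (zcol (shape (rcons w a))) (tn f.*2 (cups f) y)) =
     k *: tn (sumn (shape w)) (zcol (shape w)) (tn 1 (e [:: a]) (tn f0.*2 (cups f0) y)) +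
     \sum_(j : I | (j < a)%N) tn (sumn (shape w)) (X j) (tn 1 (e [:: j]) (tn f0.*2 (cups f0) y))) ->
  exists2 B, al (size w).+1 B & exists (u ui : K) x, [/\ u * ui = 1,
    forall v, size v = (size w).+1 -> ~~ (code (rev v) < code (rev (rcons w a)))%N -> x v = 0 &
    forall y, B (tn (sumn (shape (rcons w a))) (zcol (shape (rcons w a))) (tn f.*2 (cups f) y)) = tn (size
        w).+1 (u *: e (rcons w a) + x) y].
  move=> aF hk hF; exists (fun y => B0 (M' (F y))).
    apply: (alg_comp (B := B0) (C := fun y => M' (F y))); first exact: alg_mono aB0.
    by apply: (alg_comp (B := M')) => //; apply: alg_mono aM'; rewrite -hf0 addnS.
  pose Y j := B0 (tn (sumn (shape w)) (X j) (cups f0)).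
  exists (k * u), (ki * ui), (k *: tn (size w) x0 (e [:: a]) + \sum_(j : I | (j < a)%N) tn (size w) (Y j)
      (e [:: j])); split.
  - by rewrite mulrACA hu hk mulr1.
  - move=> v; case/lastP: v => // v b; rewrite size_rcons => -[sv]; rewrite !rev_rcons => hv.
    have tnr xx (j : I) : tn (size w) xx (e [:: j]) (rcons v b) = xx v * (b == j)%:R.
      by rewrite /tn -cats1 -sv take_size_cat // drop_size_cat // /ev eqseq_cons andbT.
    have nba : ~~ (b < a)%N.
      by apply: contra hv => ba; apply: code_cons_ltl; rewrite ?size_rev ?sv.
    rewrite vec_addE vec_scaleE vec_sumE tnr big1 ?addr0; last first.
      move=> j ja; rewrite tnr; case: eqP => [ebj|]; last by rewrite mulr0.
      by rewrite ebj ja in nba.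
    case: eqP => [eba|]; last by rewrite !mulr0.
    rewrite hx0 ?mul0r ?mulr0 //; apply: contra hv => hv; rewrite eba.
    by apply: code_cons_ltr; rewrite ?size_rev ?sv.
  move=> y; rewrite hF (islinD linM') (islinZ linM') (islin_sum linM') hM' hM.
  rewrite (islinD linB0) (islinZ linB0) (islin_sum linB0) hB0.
  rewrite !tnDl !tnZl !tnA1 ev_rcons scalerDr scalerA -addrA.
  rewrite tn_suml; congr (_ + (_ + _)).
  apply: eq_bigr => j _; rewrite hM' hM tnA1 -(alg_local _ _ aB0) // -hf0.
  by rewrite tnA.
have [am|am] := ltnP a m.
  have [p [b [e1 e2 hb]]] := cols_rcons_low hd sL am.
  have ff0 : f0 = f by move: hf hf0; rewrite e1 e2 !sumn_cat /=; lia.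
  have [H aH [x hH]] := remove_box_operator qqi p am hb.
  apply: (fin H 1 1 x); rewrite ?mulr1 //.
  - by apply: alg_mono aH; rewrite -e1 -hf0; lia.
  - by move=> y; rewrite {1 2}e2 hH -e1 ff0 scale1r.
have [p [b [e1 e2 hb]]] := cols_rcons_high hd sL am; have pm := prim_ltm am.
have [G aG hG] := add_box_operator qqi p pm hb.
have es : sumn (shape w) = (sumn (shape (rcons w a))).+1 by rewrite e1 e2 !sumn_cat /=; lia.
have ff0 : f = f0.+1 by move: hf hf0; rewrite es; lia.
have linG := alg_lin aG.
pose s := sumn (shape (rcons w a)).
apply: (fin G (kapi (prim a)) (kap (prim a)) (fun j => kapi (prim j) *: G (tn s (zcol (shape (rcons w a)))
    (e [:: prim j])))).
- by apply: alg_mono aG; rewrite -e2 -es -hf0; lia.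
- by rewrite mulrC kappa_kappai.
move=> y; rewrite ff0 doubleS -[cups f0.+1]/(tn 2 cup (cups f0)) -[f0.*2.+2]add2n tnA.
rewrite {1}/cup_vec tn_suml tn_sumr (islin_sum linG).
rewrite (bigD1 (prim a)) //= primK tnZl tnZr (islinZ linG) tn2_cons {1 2}e2 hG // eqxx -e1; congr (_ + _).
rewrite (bigID (fun i : I => (i < prim a)%N)) /= big1 ?add0r; last first.
  move=> i /andP [_ ia]; rewrite tnZl tnZr (islinZ linG) tn2_cons e2 hG ?(ltnW ia) // ifF ?scaler0 //.
  by apply/eqP => ei; rewrite ei ltnn in ia.
rewrite (reindex_inj (@prim_inj m)) /=; apply: eq_big => i.
  rewrite (inj_eq (@prim_inj m)) -prim_ltP -leqNgt ltn_neqAle.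
  by rewrite -(inj_eq val_inj).
move=> _; rewrite tnZl tnZr (islinZ linG) tn2_cons primK tnZl; congr (_ *: _).
by rewrite -tnA1 -es (alg_local _ _ aG) // es e2.
Qed.

(** Equal weight and length give the two words the same diagram and number of cups, so the expansion
    of w can follow the collapse of c. *)
Theorem leading_operator w (c : seq I) : dominant w -> dominant c -> size w = size c -> (size w <= L)%N ->
  (forall g, weight g w = weight g c) ->
  exists2 B, al (size w) B & exists (u ui : K) x, [/\ u * ui = 1,
    forall v, size v = size w -> ~~ (code (rev v) < code (rev w))%N -> x v = 0,
    B (tn (size w) (e c) (e [::])) = tn (size w) (u *: e w + x) (e [::]) &
    forall v, size v = size w -> (code v < code c)%N -> B (tn (size w) (e v) (e [::])) = 0].
Proof.
move=> dw dc sz sL hwc.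
(* The pairings with the simple coroots determine the rows, starting from the last one. *)
have lamE g : (g < m)%N -> shape_row w g = shape_row c g.
  move=> gm; have [k hk] : exists k, (m.-1 - g = k)%N by exists (m.-1 - g)%N.
  elim: k g gm hk => [|k IH] g gm hk; have := hwc (Ordinal gm); rewrite !weight_shape_row /=.
    by have -> : (g < m.-1)%N = false by lia.
  have -> : (g < m.-1)%N by lia.
  by rewrite (IH g.+1) => [/addIr| |]; lia.
have ec : shape w = shape c.
  apply/eq_map => t; apply: eq_in_count => g; rewrite mem_iota add0n => gm.
  by rewrite lamE.
have [f hf] := cols_sum dw sL.
have [B aB [u [ui [x [hu hx hB]]]]] := expand_operator dw sL hf.
have sLc : (size c <= L)%N by rewrite -sz.
have hfc : (sumn (shape c) + f.*2 = size c)%N by rewrite -ec -sz.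
have [R aR [t [ti [ht hR hRv]]]] := collapse_operator dc sLc hfc.
have linB := alg_lin aB.
exists (fun y => B (R y)); first by apply: (alg_comp aB); rewrite sz.
exists (t * u), (ti * ui), (t *: x); split.
- by rewrite mulrACA ht hu mulr1.
- by move=> v sv hv; rewrite vec_scaleE hx // mulr0.
- by rewrite sz hR (islinZ linB) -ec hB -sz -tnZl scalerDr scalerA.
by move=> v sv hv; rewrite sz hRv ?(islin0 linB) // sv sz.
Qed.
End LightLeaves.

(** * From operators on words to matrices of endomorphisms *)

Section Words.
Variables (T : finType) (n : nat).

Definition letters (f : {ffun 'I_n -> T}) : seq T := [seq f i | i <- enum 'I_n].

Lemma size_letters f : size (letters f) = n.
Proof. by rewrite size_map size_enum_ord. Qed.

Lemma nth_letters x0 f (i : 'I_n) : nth x0 (letters f) i = f i.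
Proof. by rewrite (nth_map i) ?size_enum_ord // nth_ord_enum. Qed.

Lemma letters_inj : injective letters.
Proof.
move=> f g h; apply/ffunP => i; rewrite -(nth_letters (f i) f i) -(nth_letters (f i) g i).
by rewrite h.
Qed.

Lemma letters_surj (w : seq T) : size w = n -> exists f, w = letters f.
Proof.
move=> sw; case: (posnP n) => [n0|n0].
  (* T may be empty, so for n = 0 the function must come from the emptiness of its domain. *)
  exists [ffun i : 'I_n => False_rect T (notF (eq_ind n (fun k => i < k)%N (ltn_ord i) 0%N n0))].
  by rewrite [LHS]size0nil ?sw // [RHS]size0nil ?size_letters.
case: w sw => [|x w] sw; first by rewrite -sw in n0.
exists [ffun i : 'I_n => nth x (x :: w) i].
apply: (@eq_from_nth _ x) => [|i]; first by rewrite size_letters.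
by rewrite sw => hi; rewrite (nth_letters x _ (Ordinal hi)) ffunE.
Qed.
End Words.

Section Bridge.
Variables (K : comPzRingType) (q qi : K) (m n : nat).
Hypothesis qqi : q * qi = 1.
Local Notation I := 'I_(m.*2).
Local Notation vc := (vec K I).
Local Notation e := (@ev K I).
Local Notation al := (alg (@gen K q qi m)).
Local Notation sq := (@letters I n).
Local Notation TB := (tbasis m n).

Lemma op_nth (x0 : I) l (M : mat2 K I) (f : vc) w : (l.+1 < size w)%N ->
  op l M f w = \sum_c \sum_d M (nth x0 w l) (nth x0 w l.+1) c d * f (take l w ++ c :: d :: drop l.+2 w).
Proof.
elim: l f w => [|l IH] f [|a w] //=.
  by case: w => [|b w] // _; apply: eq_bigr => c _; apply: eq_bigr => d _ /=; rewrite drop0.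
by rewrite ltnS => h; rewrite -/(op l M) IH.
Qed.

(** Only the tensors that agree with r away from i and j contribute, and [upd] parametrizes them by
    their two free letters. *)
Lemma atpos2_sum (M : mat2 K I) (i j : 'I_n) (f : vc) (r : TB) : val j = (val i).+1 ->
  \sum_(k : TB) atpos2 M i j r k * f (sq k) = op i M f (sq r).
Proof.
move=> hij; have nji : (j == i) = false by rewrite -val_eqE hij gtn_eqF.
have hj : (i.+1 < n)%N by rewrite -[i.+1]hij ltn_ord.
rewrite (op_nth (r i)) ?size_letters // nth_letters.
have -> : nth (r i) (sq r) i.+1 = r j by rewrite -[X in nth _ _ X]hij nth_letters.
pose P (k : TB) := [forall l, (l != i) && (l != j) ==> (r l == k l)].
pose upd (p : I * I) : TB := [ffun l => if l == i then p.1 else if l == j then p.2 else r l].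
have prodP (k : TB) : \prod_(l < n | (l != i) && (l != j)) (r l == k l)%:R = (P k)%:R :> K.
  case: (boolP (P k)) => [/forallP h|].
    by rewrite big1 // => l hl; have := h l; rewrite hl /= => ->.
  rewrite negb_forall => /existsP [l]; rewrite negb_imply => /andP [hl /negbTE hn].
  by rewrite (bigD1 l) //= hn mul0r.
transitivity (\sum_(k | P k) M (r i) (r j) (k i) (k j) * f (sq k)).
  rewrite [RHS]big_mkcond; apply: eq_bigr => k _.
  by rewrite /atpos2 prodP; case: (P k); rewrite ?mulr1 // mulr0 mul0r.
rewrite (reindex_onto upd (fun k : TB => (k i, k j))); last first.
  move=> k /forallP h; apply/ffunP => l; rewrite ffunE /=.
  case: eqP => [-> //|/eqP n1]; case: eqP => [-> //|/eqP n2].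
  by have := h l; rewrite n1 n2 => /eqP.
rewrite pair_bigA; apply: eq_big => [p|[c d] _] /=.
  rewrite !ffunE !eqxx nji -surjective_pairing eqxx andbT.
  by apply/forallP => l; apply/implyP => /andP [/negbTE n1 /negbTE n2]; rewrite ffunE n1 n2.
rewrite !ffunE !eqxx nji; congr (_ * f _).
apply: (@eq_from_nth _ (r i)) => [|l].
  rewrite size_letters size_cat /= size_take size_drop size_letters ltn_ord; have := hj; lia.
rewrite size_letters => hl; rewrite (nth_letters _ _ (Ordinal hl)) ffunE -!val_eqE /= hij.
have si : size (take i (sq r)) = i by rewrite size_takel // size_letters ltnW.
rewrite nth_cat si; case: (ltngtP l i) => h.
- by rewrite ltn_eqF ?nth_take ?(nth_letters _ _ (Ordinal hl)) // ltnW.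
- have -> : (l - i = (l - i.+1).+1)%N by lia.
  rewrite /=; case: eqP => [->|n2]; first by rewrite subnn.
  have -> : (l - i.+1 = (l - i.+2).+1)%N by lia.
  by rewrite /= nth_drop subnKC ?(nth_letters _ _ (Ordinal hl)) //; lia.
by rewrite h subnn.
Qed.

Notation phi := (@in_phiC K q qi m n).

Lemma word_cat u v (r c : TB) : word q qi (u ++ v) r c = opmul (word q qi u) (word q qi v) r c.
Proof.
elim: u r c => [|p u IH] r c /=.
  rewrite /opmul /opone (bigD1 r) //= eqxx mul1r big1 ?addr0 // => k nk.
  by rewrite eq_sym (negbTE nk) mul0r.
rewrite /opmul; under eq_bigr => k _ do rewrite IH /opmul big_distrr /=.
rewrite exchange_big /=; apply: eq_bigr => k _; rewrite big_distrl; apply: eq_bigr => t _ /=.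
by rewrite mulrA.
Qed.

Lemma phi_eq (A B : Op K m n) : (forall r c, A r c = B r c) -> phi A -> phi B.
Proof. by move=> h [s [h1 h2]]; exists s; split=> // r c; rewrite -h. Qed.

Lemma phi_word w : all (@adjpos n) w -> phi (@word K q qi m n w).
Proof. by move=> h; exists [:: (1, w)]; split=> [|r c] /=; rewrite ?h // big_seq1 mul1r. Qed.

Lemma phi_lc k A B : phi A -> phi B -> phi (fun r c => k * A r c + B r c).
Proof.
move=> [s [h1 h2]] [t [h3 h4]]; exists ([seq (k * p.1, p.2) | p <- s] ++ t); split.
  by rewrite all_cat h3 andbT all_map; apply: sub_all h1.
move=> r c; rewrite big_cat big_map h2 h4 big_distrr /=; congr (_ + _).
by apply: eq_bigr => p _; rewrite mulrA.
Qed.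

Lemma phi_zero : phi (fun _ _ => 0).
Proof. by exists [::]; split=> // r c; rewrite big_nil. Qed.

Lemma phi_mul A B : phi A -> phi B -> phi (opmul A B).
Proof.
move=> [s [h1 h2]] [t [h3 h4]].
exists [seq (p.1 * p'.1, p.2 ++ p'.2) | p <- s, p' <- t]; split.
  apply/allP => _ /allpairsP [[p p'] /= [hp hp' ->]] /=.
  by rewrite all_cat (allP h1 _ hp) (allP h3 _ hp').
move=> r c; rewrite big_allpairs_dep /= /opmul.
under [LHS]eq_bigr => k _ do rewrite h2 h4 big_distrl /=.
rewrite exchange_big /=; apply: eq_bigr => p _.
under eq_bigr => k _ do rewrite big_distrr /=.
rewrite exchange_big /=; apply: eq_bigr => p' _; rewrite word_cat /opmul big_distrr /=.
by apply: eq_bigr => k _; rewrite mulrACA.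
Qed.

Lemma alg_phi B : al n B -> exists2 Y, phi Y &
  forall (f : vc) r, B f (sq r) = \sum_c Y r c * f (sq c).
Proof.
elim=> {B} [|l M hl [k1 [k2 [k3 hM]]]|B C _ [Y pY hY] _ [Z pZ hZ]|k B C _ [Y pY hY] _ [Z pZ hZ]].
- exists (@opone K m n); first exact: (phi_word (w := [::])).
  move=> f r; rewrite /opone (bigD1 r) //= eqxx mul1r big1 ?addr0 // => c nc.
  by rewrite eq_sym (negbTE nc) mul0r.
- have hl1 : (l < n)%N by exact: ltnW.
  pose i := Ordinal hl1; pose j := Ordinal hl.
  exists (fun r c => k1 * word q qi [:: (true, (i, j))] r c + (k2 * word q qi [:: (false, (i, j))] r c
     + (k3 * word q qi [::] r c + 0))).
    apply: phi_lc; first by apply: phi_word; rewrite /= /adjpos /= eqxx.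
    apply: phi_lc; first by apply: phi_word; rewrite /= /adjpos /= eqxx.
    by apply: phi_lc; [exact: phi_word | exact: phi_zero].
  have w1 b (r c : TB) : word q qi [:: (b, (i, j))] r c = genop q qi (b, (i, j)) r c.
    rewrite /= /opmul /opone (bigD1 c) //= eqxx mulr1 big1 ?addr0 // => k nk.
    by rewrite (negbTE nk) mulr0.
  have aM (r c : TB) : atpos2 M i j r c = k1 * genop q qi (true, (i, j)) r c +
      k2 * genop q qi (false, (i, j)) r c + k3 * (@opone K m n) r c.
    rewrite /genop /atpos2 /= hM mulrDl mulrDl !mulrA; congr (_ + _).
    rewrite -mulrA; congr (_ * _); rewrite /opone.
    case: (r =P c) => [->|nrc].
      by rewrite !eqxx big1 ?mulr1 // => k _; rewrite eqxx.
    case: (r i =P c i) => [ei|_]; last by rewrite mul0r.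
    case: (r j =P c j) => [ej|_]; last by rewrite mul0r.
    have /existsP [k hk] : [exists k, r k != c k].
      rewrite -negb_forall; apply/negP => /forallP h; apply: nrc; apply/ffunP => k.
      exact/eqP/h.
    rewrite mul1r (bigD1 k) /= ?(negbTE hk) ?mul0r //.
    by apply/andP; split; apply: contraNN hk => /eqP ->; apply/eqP.
  move=> f r; rewrite -[l]/(val i) -(@atpos2_sum M i j) //; apply: eq_bigr => c _; congr (_ * _).
  by rewrite !w1 aM /= addr0 addrA.
- exists (opmul Y Z); first exact: phi_mul.
  move=> f r; rewrite hY; under eq_bigr => c _ do rewrite hZ big_distrr /=.
  rewrite exchange_big /=; apply: eq_bigr => c _; rewrite /opmul big_distrl.
  by apply: eq_bigr => k _ /=; rewrite mulrA.
exists (fun r c => k * Y r c + Z r c); first exact: phi_lc.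
move=> f r; rewrite vec_addE vec_scaleE hY hZ big_distrr -big_split.
by apply: eq_bigr => c _ /=; rewrite mulrA -mulrDl.
Qed.
End Bridge.

(** * Commutation with the Chevalley generators *)
Section TwoSite.
Variables (K : comPzRingType) (q qi : K) (m : nat).
Hypothesis qqi : q * qi = 1.
Local Notation I := 'I_(m.*2).
Local Notation vc := (vec K I).
Local Notation e := (@ev K I).
Local Notation B := (@betaV K q qi m).
Local Notation C := (@gammaV K q qi m).
Local Notation z := (qgap q qi).
Local Notation cup := (@cup_vec K q qi m).
Local Notation kap := (kappa q qi).
Local Notation kapi := (kappai q qi).

Definition mulm2 (M M' : mat2 K I) : mat2 K I := fun a b c d =>
  \sum_k \sum_l M a b k l * M' k l c d.

Lemma op0_e2 (M : mat2 K I) c d :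
  op 0 M (e [:: c; d]) = \sum_k \sum_l M k l c d *: e [:: k; l].
Proof.
rewrite -tn2_ev_nil op0_ev tn2_nil // => w hw; rewrite vec_sumE big1 // => a _.
rewrite vec_sumE big1 // => b _; rewrite vec_scaleE /ev.
by case: eqP => [ew|_]; [rewrite ew in hw | rewrite mulr0].
Qed.

Lemma op0_e2E (M : mat2 K I) a b c d : op 0 M (e [:: c; d]) [:: a; b] = M a b c d.
Proof.
rewrite op0_e2 vec_sumE (bigD1 a) //= [X in _ + X]big1 ?addr0 => [|i ni]; last first.
  rewrite vec_sumE big1 // => j _; rewrite vec_scaleE /ev !eqseq_cons.
  by rewrite [a == i]eq_sym (negbTE ni) mulr0.
rewrite vec_sumE (bigD1 b) //= [X in _ + X]big1 ?addr0 => [|i ni]; last first.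
  by rewrite vec_scaleE /ev !eqseq_cons [b == i]eq_sym (negbTE ni) andbF mulr0.
by rewrite vec_scaleE /ev eqxx mulr1.
Qed.

Lemma op0_mulm2 (M M' : mat2 K I) a b c d :
  op 0 M (op 0 M' (e [:: c; d])) [:: a; b] = mulm2 M M' a b c d.
Proof.
rewrite op0_e2 (islin_sum op_lin) vec_sumE; apply: eq_bigr => k _.
rewrite (islin_sum op_lin) vec_sumE; apply: eq_bigr => l _.
by rewrite (islinZ op_lin) vec_scaleE op0_e2E mulrC.
Qed.

(** Truncated cup: the γ' part of β' sends the pair [prim d], d to a multiple of it, with k = d. *)
Definition partial_cup (k : nat) : vc := \sum_(a : I | (a < k)%N) kapi a *: e [:: a; prim a].

Lemma partial_cupS (a : I) : partial_cup a.+1 = partial_cup a + kapi a *: e [:: a; prim a].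
Proof.
rewrite /partial_cup (bigD1 a) //= addrC; congr (_ + _); apply: eq_bigl => i.
by rewrite ltnS ltn_neqAle -(inj_eq val_inj) andbC.
Qed.

Lemma cup_partial_cup : cup = partial_cup m.*2.
Proof. by rewrite /cup_vec /partial_cup; apply: eq_bigl => a; rewrite ltn_ord. Qed.

Lemma gamma_ev c d : op 0 C (e [:: c; d]) = ((c == prim d)%:R * kap d) *: cup.
Proof.
rewrite -tn2_ev_nil op_gamma // tn2_nil // => w hw; rewrite /cup_vec vec_sumE big1 // => b _.
by rewrite vec_scaleE /ev; case: eqP => [ew|_]; [rewrite ew in hw | rewrite mulr0].
Qed.

Lemma beta_ev c d : op 0 B (e [:: c; d]) =
  (if c == d then q else if c == prim d then qi else 1) *: e [:: d; c]
  + (z * (c < d)%:R) *: e [:: c; d] - (z * ((c == prim d)%:R * kap d)) *: partial_cup d.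
Proof.
rewrite op0_e2.
transitivity (\sum_k \sum_l (((k == d) && (l == c))%:R * (if c == d then q else if c == prim d then qi else
    1)) *: e [:: k; l]
  + \sum_k \sum_l (((k == c) && (l == d))%:R * (z * (c < d)%:R)) *: e [:: k; l]
  - \sum_(k : I | (k < d)%N) (z * ((c == prim d)%:R * kap d) * kapi k) *: e [:: k; prim k]); last first.
  rewrite !sum_e2; congr (_ - _); rewrite /partial_cup scaler_sumr; apply: eq_bigr => k _.
  by rewrite scalerA.
rewrite (big_mkcond (fun k : I => (k < d)%N)) -big_split -sumrB; apply: eq_bigr => k _ /=.
transitivity (\sum_l (((k == d) && (l == c))%:R * (if c == d then q else if c == prim d then qi else 1)) *:
    e [:: k; l]
  + \sum_l (((k == c) && (l == d))%:R * (z * (c < d)%:R)) *: e [:: k; l]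
  - \sum_l (l == prim k)%:R *: ((z * ((c == prim d)%:R * kap d * (k < d)%:R) * kapi k) *: e [:: k; l])).
  rewrite -big_split -sumrB; apply: eq_bigr => l _ /=.
  rewrite scalerA -scalerDl -scalerBl; congr (_ *: _); rewrite betaE //.
  rewrite -!mulnb !natrM; move: (if c == d then _ else _) => u; ring.
rewrite sum_pred1v; congr (_ - _); case: ifP => h; rewrite ?mulr1 //.
by rewrite !mulr0 mul0r scale0r.
Qed.

(* e_g on V (x) V is the case where a1 is the diagonal of k~_g. *)
Definition Etwo (M : I -> I -> K) (a1 : I -> K) : mat2 K I := fun a b c d =>
  M a c * (b == d)%:R + a1 a * (a == c)%:R * M b d.

Section Short.
(** For a short root, t1, s1, t2, s2 are v_i, v_{i+1}, v_{(i+1)'}, v_{i'}; e_i sends s1 to t1 and s2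
    to - t2. *)
Variables t1 s1 t2 s2 : I.
Hypotheses (p1 : prim t1 = s2) (p2 : prim s1 = t2).
Hypotheses (v1 : s1 = t1.+1 :> nat) (v2 : s2 = t2.+1 :> nat) (v3 : (s1 < t2)%N) (v4 : (s1 < m)%N).
Variables (M : I -> I -> K) (a1 : I -> K).
Hypothesis hM : forall r c, M r c = ((c == s1) && (r == t1))%:R - ((c == s2) && (r == t2))%:R.
Hypothesis ha : forall c, a1 c = if (c == t1) || (c == t2) then q else if (c == s1) || (c == s2) then qi else 1.
Local Notation E := (Etwo M a1).

Lemma sum_e1 (t : I) (k : K) (F : I -> vc) : \sum_k' ((k' == t)%:R * k) *: F k' = k *: F t.
Proof.
under eq_bigr => i _ do rewrite -scalerA.
by rewrite sum_pred1v.
Qed.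

Lemma Etwo_ev c d : op 0 E (e [:: c; d]) =
  (c == s1)%:R *: e [:: t1; d] - (c == s2)%:R *: e [:: t2; d]
  + ((a1 c * (d == s1)%:R) *: e [:: c; t1] - (a1 c * (d == s2)%:R) *: e [:: c; t2]).
Proof.
rewrite op0_e2.
transitivity (\sum_k (k == t1)%:R *: (\sum_l ((l == d)%:R * (c == s1)%:R) *: e [:: k; l])
  - \sum_k (k == t2)%:R *: (\sum_l ((l == d)%:R * (c == s2)%:R) *: e [:: k; l])
  + (\sum_k (k == c)%:R *: (\sum_l ((l == t1)%:R * (a1 c * (d == s1)%:R)) *: e [:: k; l])
  - \sum_k (k == c)%:R *: (\sum_l ((l == t2)%:R * (a1 c * (d == s2)%:R)) *: e [:: k; l]))).
  rewrite -!sumrB -big_split; apply: eq_bigr => k _ /=.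
  rewrite !scaler_sumr -!sumrB -big_split; apply: eq_bigr => l _ /=.
  rewrite !scalerA -!scalerBl -!scalerDl; congr (_ *: _); rewrite /Etwo !hM -!mulnb !natrM.
  case: (k =P c) => [->|_]; rewrite ?eqxx /=; ring.
by rewrite !sum_pred1v !sum_e1.
Qed.

Let k := kap t1.
Let ki := kapi t1.
Let kk : k * ki = 1. Proof. exact: kappa_kappai. Qed.

Let rs1 : rho s1 = rho t1 - 1.
Proof. by rewrite /rho /= v1; have := v4; rewrite v1; case: ifP; case: ifP; lia. Qed.
Let es1 : eps K s1 = eps K t1.
Proof. by rewrite /eps /= v4; have := v4; rewrite v1 => h; rewrite ltnW. Qed.
Let kaps1 : kap s1 = qi * k.
Proof. by rewrite /kappa rs1 es1 zpowB1 // mulrAC [RHS]mulrC. Qed.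
Let kapis1 : kapi s1 = q * ki.
Proof. by rewrite /kappai rs1 es1 opprB [1 - _]addrC zpowD1 // mulrAC [RHS]mulrC. Qed.
Let kaps2 : kap s2 = - ki. Proof. by rewrite -p1 kappa_prim. Qed.
Let kapis2 : kapi s2 = - k. Proof. by rewrite -p1 kappai_prim. Qed.
Let kapt2 : kap t2 = - (q * ki). Proof. by rewrite -p2 kappa_prim // kapis1. Qed.
Let kapit2 : kapi t2 = - (qi * k). Proof. by rewrite -p2 kappai_prim // kaps1. Qed.
Let p3 : prim s2 = t1. Proof. by rewrite -p1 primK. Qed.
Let p4 : prim t2 = s1. Proof. by rewrite -p2 primK. Qed.

Let dis : ((t1 == s1) = false) * ((t1 == t2) = false) * ((t1 == s2) = false) *
  ((s1 == t1) = false) * ((s1 == t2) = false) * ((s1 == s2) = false) *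
  ((t2 == t1) = false) * ((t2 == s1) = false) * ((t2 == s2) = false) *
  ((s2 == t1) = false) * ((s2 == s1) = false) * ((s2 == t2) = false).
Proof. by do !split; rewrite -val_eqE /=; lia. Qed.

Let ord : ((t1 < s1)%N = true) * ((t1 < t2)%N = true) * ((t1 < s2)%N = true) *
  ((s1 < t1)%N = false) * ((s1 < t2)%N = true) * ((s1 < s2)%N = true) *
  ((t2 < t1)%N = false) * ((t2 < s1)%N = false) * ((t2 < s2)%N = true) *
  ((s2 < t1)%N = false) * ((s2 < s1)%N = false) * ((s2 < t2)%N = false).
Proof. by do !split; lia. Qed.

(** The contributions of the terms t1 and s1 of the cup cancel, and so do those of t2 and s2. A
    truncation leaves something only where it separates such a pair; in particular the full cup is
    invariant. *)
Lemma Etwo_partial_cup (j : nat) : op 0 E (partial_cup j) =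
  (q * ki * ((s1 < j)%:R - (t1 < j)%:R)) *: e [:: t1; t2]
  + (k * ((s2 < j)%:R - (t2 < j)%:R)) *: e [:: t2; t1].
Proof.
rewrite /partial_cup (islin_sum op_lin).
transitivity (\sum_(a : I) ((a == s1)%:R *: ((kapi a * (a < j)%:R) *: e [:: t1; prim a])
   - (a == s2)%:R *: ((kapi a * (a < j)%:R) *: e [:: t2; prim a])
   + ((a == t2)%:R *: ((kapi a * (a < j)%:R * a1 a) *: e [:: a; t1])
    - (a == t1)%:R *: ((kapi a * (a < j)%:R * a1 a) *: e [:: a; t2])))).
  rewrite big_mkcond; apply: eq_bigr => a _.
  case: ifP => ha'; last by rewrite !(mulr0, mul0r, scale0r, scaler0, subrr, addr0).
  rewrite (islinZ op_lin) Etwo_ev !eq_prim p2 p3.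
  rewrite !(scalerDr, scalerN) !scalerA; congr (_ *: _ - _ *: _ + (_ *: _ - _ *: _)); rewrite ?mulr1 //; ring.
rewrite !(big_split, sumrN) /= !sum_pred1v p2 p3 !ha !dis !eqxx /= kapis1 kapis2 kapit2 -/ki.
apply/funext => w; rewrite !(vec_addE, vec_scaleE, vec_oppE); ring: qqi.
Qed.

Let pcs1 : partial_cup s1 = partial_cup t1 + ki *: e [:: t1; s2].
Proof. by rewrite v1 partial_cupS p1. Qed.
Let pcs2 : partial_cup s2 = partial_cup t2 + kapi t2 *: e [:: t2; s1].
Proof. by rewrite v2 partial_cupS p4. Qed.

(** A letter outside the four lies neither between t1 and s1 nor between t2 and s2, so it compares
    in the same way with both; its prime is outside the four as well. *)
Let oth (x : I) : x != t1 -> x != s1 -> x != t2 -> x != s2 ->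
  ((x == t1) = false) * ((x == s1) = false) * ((x == t2) = false) * ((x == s2) = false) *
  ((t1 == x) = false) * ((s1 == x) = false) * ((t2 == x) = false) * ((s2 == x) = false) *
  ((t1 == prim x) = false) * ((s1 == prim x) = false) * ((t2 == prim x) = false) * ((s2 == prim x) = false) *
  ((x < s1)%N = (x < t1)%N) * ((s1 < x)%N = (t1 < x)%N) *
  ((x < s2)%N = (x < t2)%N) * ((s2 < x)%N = (t2 < x)%N).
Proof.
move=> n1 n2 n3 n4; rewrite -!eq_prim p1 p2 p3 p4.
rewrite ![_ == x]eq_sym (negbTE n1) (negbTE n2) (negbTE n3) (negbTE n4).
by move: n1 n2 n3 n4; rewrite -!val_eqE /= => n1 n2 n3 n4; do !split; lia.
Qed.

(** Each of c and d is one of the four letters or none of them. In each of the 25 cases all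
    comparisons are decided, the truncated cups differ by explicit terms, and a ring identity
    remains. *)
Lemma beta_Etwo_short a b c d : mulm2 B E a b c d = mulm2 E B a b c d.
Proof.
rewrite -!op0_mulm2; congr (_ [:: a; b]).
have lB : islin (op 0 B) := op_lin; have lE : islin (op 0 E) := op_lin.
rewrite Etwo_ev (beta_ev c d) !(islinB lB, islinD lB, islinZ lB).
rewrite !(islinB lE, islinD lE, islinZ lE) !beta_ev !Etwo_ev !Etwo_partial_cup.
apply/funext => w; rewrite !(vec_addE, vec_scaleE, vec_oppE) !ha.
have [->|c1] := eqVneq c t1; [|have [->|c2] := eqVneq c s1; [|have [->|c3] := eqVneq c t2; [|have [->|c4]
    := eqVneq c s2]]];
(have [->|d1] := eqVneq d t1; [|have [->|d2] := eqVneq d s1; [|have [->|d3] := eqVneq d t2; [|have [->|d4]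
    := eqVneq d s2]]]);
 try (have oc := oth c1 c2 c3 c4); try (have od := oth d1 d2 d3 d4);
 rewrite ?(p1, p2, p3, p4, dis, ord, ltnn, eqxx) /=;
 try rewrite ?oc; try rewrite ?od; rewrite /=;
 rewrite ?(pcs1, pcs2) ?(vec_addE, vec_scaleE) ?(kaps1, kaps2, kapt2, kapit2) -/k -/ki /qgap.
all: ring: qqi kk.
Qed.

Lemma gamma_Etwo_short a b c d : mulm2 C E a b c d = mulm2 E C a b c d.
Proof.
rewrite -!op0_mulm2; congr (_ [:: a; b]).
have lC : islin (op 0 C) := op_lin; have lE : islin (op 0 E) := op_lin.
rewrite Etwo_ev (gamma_ev c d) !(islinB lC, islinD lC, islinZ lC) (islinZ lE).
rewrite cup_partial_cup Etwo_partial_cup !ltn_ord !subrr !mulr0 !scale0r addr0 scaler0 !gamma_ev.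
apply/funext => w; rewrite !(vec_addE, vec_scaleE, vec_oppE, vec_zeroE) !ha.
have [->|c1] := eqVneq c t1; [|have [->|c2] := eqVneq c s1; [|have [->|c3] := eqVneq c t2; [|have [->|c4]
    := eqVneq c s2]]];
(have [->|d1] := eqVneq d t1; [|have [->|d2] := eqVneq d s1; [|have [->|d3] := eqVneq d t2; [|have [->|d4]
    := eqVneq d s2]]]);
 try (have oc := oth c1 c2 c3 c4); try (have od := oth d1 d2 d3 d4);
 rewrite ?(p1, p2, p3, p4, dis, ord, ltnn, eqxx) /=;
 try rewrite ?oc; try rewrite ?od; rewrite /=;
 rewrite ?(kaps1, kaps2, kapt2, kapit2) -/k -/ki; ring: qqi kk.
Qed.
End Short.

End TwoSite.

Section TwoSiteLong.
Variables (K : comPzRingType) (q qi : K) (m : nat).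
Hypothesis qqi : q * qi = 1.
Local Notation I := 'I_(m.*2).
Local Notation vc := (vec K I).
Local Notation e := (@ev K I).
Local Notation B := (@betaV K q qi m).
Local Notation C := (@gammaV K q qi m).
Local Notation z := (qgap q qi).
Local Notation cup := (@cup_vec K q qi m).
Local Notation kap := (kappa q qi).
Local Notation kapi := (kappai q qi).

Section Long.
(** For the long root, t = v_m and s = v_{m'}; since k~_m = k_m^2, squares appear in [ha]. *)
Variables t s : I.
Hypotheses (p1 : prim t = s) (v1 : s = t.+1 :> nat) (v2 : s = m :> nat).
Variables (M : I -> I -> K) (a1 : I -> K).
Hypothesis hM : forall r c, M r c = ((c == s) && (r == t))%:R.
Hypothesis ha : forall c, a1 c = if c == t then q * q else if c == s then qi * qi else 1.
Local Notation E := (Etwo M a1).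
Local Notation pc := (@partial_cup K q qi m).

Lemma Etwo_ev_long c d : op 0 E (e [:: c; d]) =
  (c == s)%:R *: e [:: t; d] + (a1 c * (d == s)%:R) *: e [:: c; t].
Proof.
rewrite op0_e2.
transitivity (\sum_k (k == t)%:R *: (\sum_l ((l == d)%:R * (c == s)%:R) *: e [:: k; l])
  + \sum_k (k == c)%:R *: (\sum_l ((l == t)%:R * (a1 c * (d == s)%:R)) *: e [:: k; l])).
  rewrite -big_split; apply: eq_bigr => k _ /=.
  rewrite !scaler_sumr -big_split; apply: eq_bigr => l _ /=.
  rewrite !scalerA -!scalerDl; congr (_ *: _); rewrite /Etwo !hM -!mulnb !natrM.
  case: (k =P c) => [->|_]; rewrite ?eqxx /=; ring.
by rewrite !sum_pred1v !sum_e1.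
Qed.

Let p2 : prim s = t. Proof. by rewrite -p1 primK. Qed.
Let kapt : kap t = q.
Proof.
have h : (t < m)%N by rewrite -[X in (_ < X)%N]v2 v1.
rewrite /kappa /rho /eps /= h mulr1.
by have -> : (m - t = 1)%N by lia.
Qed.
Let kapit : kapi t = qi.
Proof. by rewrite -[LHS]mul1r -qqi mulrAC -{1}kapt kappa_kappai ?mul1r. Qed.
Let kaps : kap s = - qi. Proof. by rewrite -p1 kappa_prim kapit. Qed.
Let kapis : kapi s = - q. Proof. by rewrite -p1 kappai_prim kapt. Qed.

Let dis : ((t == s) = false) * ((s == t) = false).
Proof. by do !split; rewrite -val_eqE /=; lia. Qed.
Let ord : ((t < s)%N = true) * ((s < t)%N = false).
Proof. by do !split; lia. Qed.

Lemma Etwo_partial_cup_long (j : nat) : op 0 E (pc j) = (q * ((t < j)%:R - (s < j)%:R)) *: e [:: t; t].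
Proof.
rewrite /pc (islin_sum op_lin).
transitivity (\sum_(a : I) ((a == s)%:R *: ((kapi a * (a < j)%:R) *: e [:: t; prim a])
   + (a == t)%:R *: ((kapi a * (a < j)%:R * a1 a) *: e [:: a; t]))).
  rewrite big_mkcond; apply: eq_bigr => a _.
  case: ifP => ha'; last by rewrite !(mulr0, mul0r, scale0r, scaler0, subrr, addr0).
  rewrite (islinZ op_lin) Etwo_ev_long !eq_prim p2.
  rewrite !scalerDr !scalerA; congr (_ *: _ + _ *: _); rewrite ?mulr1 //; ring.
rewrite !big_split /= !sum_pred1v p2 !ha !dis !eqxx /= kapis kapit.
apply/funext => w; rewrite !(vec_addE, vec_scaleE, vec_oppE); ring: qqi.
Qed.

Let pcs : pc s = pc t + qi *: e [:: t; s].
Proof. by rewrite v1 partial_cupS p1 kapit. Qed.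

Let oth (x : I) : x != t -> x != s ->
  ((x == t) = false) * ((x == s) = false) * ((t == x) = false) * ((s == x) = false) *
  ((t == prim x) = false) * ((s == prim x) = false) *
  ((x < s)%N = (x < t)%N) * ((s < x)%N = (t < x)%N).
Proof.
move=> n1 n2; rewrite -!eq_prim p1 p2 ![_ == x]eq_sym (negbTE n1) (negbTE n2).
by move: n1 n2; rewrite -!val_eqE /= => n1 n2; do !split; lia.
Qed.

Lemma beta_Etwo_long a b c d : mulm2 B E a b c d = mulm2 E B a b c d.
Proof.
rewrite -!op0_mulm2; congr (_ [:: a; b]).
have lB : islin (op 0 B) := op_lin; have lE : islin (op 0 E) := op_lin.
rewrite Etwo_ev_long (beta_ev qqi c d) !(islinB lB, islinD lB, islinZ lB).
rewrite !(islinB lE, islinD lE, islinZ lE) !(beta_ev qqi) !Etwo_ev_long !Etwo_partial_cup_long.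
apply/funext => w; rewrite !(vec_addE, vec_scaleE, vec_oppE) !ha.
have [->|c1] := eqVneq c t; [|have [->|c2] := eqVneq c s];
(have [->|d1] := eqVneq d t; [|have [->|d2] := eqVneq d s]);
 try (have oc := oth c1 c2); try (have od := oth d1 d2);
 rewrite ?(p1, p2, dis, ord, ltnn, eqxx) /=;
 try rewrite ?oc; try rewrite ?od; rewrite /=;
 rewrite ?pcs ?(vec_addE, vec_scaleE) ?(kaps, kapt, kapit) /qgap; ring: qqi.
Qed.

Lemma gamma_Etwo_long a b c d : mulm2 C E a b c d = mulm2 E C a b c d.
Proof.
rewrite -!op0_mulm2; congr (_ [:: a; b]).
have lC : islin (op 0 C) := op_lin; have lE : islin (op 0 E) := op_lin.
rewrite Etwo_ev_long (gamma_ev qqi c d) !(islinD lC, islinZ lC) (islinZ lE).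
rewrite cup_partial_cup Etwo_partial_cup_long !ltn_ord !subrr !mulr0 !scale0r scaler0 !(gamma_ev qqi).
apply/funext => w; rewrite !(vec_addE, vec_scaleE, vec_oppE, vec_zeroE) !ha.
have [->|c1] := eqVneq c t; [|have [->|c2] := eqVneq c s];
(have [->|d1] := eqVneq d t; [|have [->|d2] := eqVneq d s]);
 try (have oc := oth c1 c2); try (have od := oth d1 d2);
 rewrite ?(p1, p2, dis, ord, ltnn, eqxx) /=;
 try rewrite ?oc; try rewrite ?od; rewrite /=;
 rewrite ?(kaps, kapt, kapit); ring: qqi.
Qed.
End Long.

(** The condition on phi holds for the eigenvalues of k_g and k~_g and for their inverses, so all of
    them are treated at once. *)
Lemma beta_wt (phi : I -> K) a b c d : (forall c, phi c * phi (prim c) = 1) ->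
  B a b c d * (phi c * phi d) = phi a * phi b * B a b c d.
Proof.
move=> hphi; rewrite betaE // mulrDl [RHS]mulrDr; congr (_ + _).
  case: (altP (a =P d)) => [->|_]; last by rewrite !mul0r mulr0.
  case: (altP (b =P c)) => [->|_]; last by rewrite !mul0r mulr0.
  by rewrite [RHS]mulrC [phi d * _]mulrC.
rewrite -mulrA [RHS]mulrCA; congr (_ * _); rewrite mulrBl mulrBr; congr (_ - _).
  case: (altP (a =P c)) => [->|_]; last by rewrite !mul0r mulr0.
  case: (altP (b =P d)) => [->|_]; last by rewrite !mul0r mulr0.
  by rewrite [RHS]mulrC.
case: (altP (b =P prim a)) => [->|_]; last by rewrite !mul0r mulr0.
case: (altP (c =P prim d)) => [->|_]; last by rewrite !mul0r mulr0.
by rewrite hphi [phi (prim d) * _]mulrC hphi mulr1 mul1r.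
Qed.

Lemma gamma_wt (phi : I -> K) a b c d : (forall c, phi c * phi (prim c) = 1) ->
  C a b c d * (phi c * phi d) = phi a * phi b * C a b c d.
Proof.
move=> hphi; rewrite gammaE //.
case: (altP (b =P prim a)) => [->|_]; last by rewrite !mul0r mulr0.
case: (altP (c =P prim d)) => [->|_]; last by rewrite !mul0r mulr0.
by rewrite hphi [phi (prim d) * _]mulrC hphi mulr1 mul1r.
Qed.

(** The truncation is symmetric because a < [prim c] and c < [prim a] are equivalent, and the two
    signs from [kappa_prim] cancel. *)
Lemma beta_sym a b c d : B a b c d = B c d a b.
Proof.
rewrite !betaE // [d == a]eq_sym [c == b]eq_sym [(b == c) && _]andbC [c == a]eq_sym [d == b]eq_sym; congr
    (_ + _ * (_ - _)).
- case: (altP (a =P d)) => [->|_]; last by rewrite !mul0r.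
  case: (altP (b =P c)) => [->|_]; last by rewrite !mul0r.
  by rewrite [d == c]eq_sym -eq_prim [prim c == d]eq_sym.
- by case: (altP (a =P c)) => [->|_] //; case: (altP (b =P d)) => [->|_].
case: (altP (b =P prim a)) => [->|n1]; last first.
  by rewrite [a == prim b](_ : _ = false) ?andbF ?mul0r //; apply/negP => /eqP ea; rewrite ea primK eqxx in n1.
case: (altP (d =P prim c)) => [->|n1]; last first.
  by rewrite [c == prim d](_ : _ = false) ?mul0r //; apply/negP => /eqP ea; rewrite ea primK eqxx in n1.
rewrite !primK !eqxx /= kappa_prim // kappa_prim //.
have := ltn_ord a; have := ltn_ord c => hc ha.
have -> : (a < prim c)%N = (c < prim a)%N.
  by rewrite [nat_of_ord (prim a)]val_prim [nat_of_ord (prim c)]val_prim; lia.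
by rewrite !mulrN [kapi c * _]mulrC.
Qed.

Lemma gamma_sym a b c d : C a b c d = C c d a b.
Proof.
rewrite !gammaE //.
case: (altP (b =P prim a)) => [->|n1]; last first.
  by rewrite [a == prim b](_ : _ = false) ?andbF ?mul0r //; apply/negP => /eqP ea; rewrite ea primK eqxx in n1.
case: (altP (d =P prim c)) => [->|n1]; last first.
  by rewrite [c == prim d](_ : _ = false) ?mul0r //; apply/negP => /eqP ea; rewrite ea primK eqxx in n1.
by rewrite !primK !eqxx /= !kappa_prim !mulrN [kapi c * _]mulrC.
Qed.
End TwoSiteLong.

(** * The iterated coproduct on words *)

Section ListAction.
Variables (K : comPzRingType) (m : nat).
Local Notation I := 'I_(m.*2).
Local Notation vc := (vec K I).
Local Notation e := (@ev K I).
Variables (M : I -> I -> K) (a1 : I -> K).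

(** Δ(e) = e ⊗ 1 + k~ ⊗ e, split into the first factor and the rest; this recursion reduces
    commutation to two adjacent factors. *)
Fixpoint coprod_act (f : vc) (w : seq I) : K :=
  if w is j :: u then \sum_k M j k * f (k :: u) + a1 j * coprod_act (fun v => f (j :: v)) u else 0.

Lemma coprod_act_lin : islin (coprod_act : vc -> vc).
Proof.
move=> k f g; apply/funext => w; rewrite vec_addE vec_scaleE.
elim: w f g => [|j u IH] f g /=; first by rewrite mulr0 addr0.
rewrite (IH (fun v => f (j :: v)) (fun v => g (j :: v))).
rewrite (_ : \sum_i _ = k * (\sum_i M j i * f (i :: u)) + \sum_i M j i * g (i :: u)); last first.
  rewrite big_distrr -big_split; apply: eq_bigr => i _ /=.
  by rewrite vec_addE vec_scaleE mulrDr mulrCA.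
ring.
Qed.

Lemma coprod_act2 f c d u : coprod_act f [:: c, d & u] =
  \sum_k \sum_l Etwo M a1 c d k l * f [:: k, l & u] + a1 c * a1 d * coprod_act (fun v => f [:: c, d & v]) u.
Proof.
rewrite /= mulrDr addrA mulrA; congr (_ + _).
transitivity (\sum_k (M c k * f [:: k, d & u] + (k == c)%:R * (a1 c * \sum_l M d l * f [:: k, l & u]))).
  by rewrite big_split /= (sum_pred1 _ _ predT) mul1r.
apply: eq_bigr => k _.
transitivity (\sum_l ((l == d)%:R * (M c k * f [:: k, l & u]) + (k == c)%:R * (a1 c * (M d l * f [:: k, l &
    u])))).
  by rewrite big_split /= (sum_pred1 _ _ predT) mul1r !big_distrr.
apply: eq_bigr => l _; rewrite /Etwo [d == l]eq_sym [c == k]eq_sym; ring.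
Qed.

(** At the two factors moved by M2, either e acts on them, as [Etwo], or it acts further right and
    they receive k~ ⊗ k~; the two hypotheses cover these cases. An e further left does not meet
    M2. *)
Lemma op_coprod_act l (M2 : mat2 K I) f w : (l.+1 < size w)%N ->
  (forall a b c d, M2 a b c d * (a1 c * a1 d) = a1 a * a1 b * M2 a b c d) ->
  (forall a b c d, mulm2 M2 (Etwo M a1) a b c d = mulm2 (Etwo M a1) M2 a b c d) ->
  op l M2 (coprod_act f) w = coprod_act (op l M2 f) w.
Proof.
move=> sw hW hC; elim: l f w sw => [|l IH] f [|a w] // sw.
  case: w sw => [|b u] // _; rewrite coprod_act2 -[LHS]/(\sum_c \sum_d M2 a b c d * coprod_act f [:: c, d & u]).
  transitivity (\sum_c \sum_d (M2 a b c d * (\sum_k \sum_l Etwo M a1 c d k l * f [:: k, l & u])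
     + a1 a * a1 b * (M2 a b c d * coprod_act (fun v => f [:: c, d & v]) u))).
    apply: eq_bigr => c _; apply: eq_bigr => d _; rewrite coprod_act2 mulrDr; congr (_ + _).
    by rewrite !mulrA -[M2 _ _ _ _ * _ * _]mulrA hW.
  under eq_bigr => c _ do rewrite big_split.
  rewrite big_split /=; congr (_ + _).
    transitivity (\sum_k \sum_l mulm2 M2 (Etwo M a1) a b k l * f [:: k, l & u]).
      under eq_bigr => c _ do under eq_bigr => d _ do rewrite big_distrr.
      under eq_bigr => c _ do rewrite exchange_big.
      rewrite exchange_big; apply: eq_bigr => k _ /=.
      under eq_bigr => c _ do under eq_bigr => d _ do rewrite big_distrr.
      under eq_bigr => c _ do rewrite exchange_big.
      rewrite exchange_big; apply: eq_bigr => l _ /=.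
      rewrite /mulm2 big_distrl; apply: eq_bigr => c _ /=; rewrite big_distrl; apply: eq_bigr => d _ /=.
      by rewrite mulrA.
    transitivity (\sum_k \sum_l mulm2 (Etwo M a1) M2 a b k l * f [:: k, l & u]).
      by apply: eq_bigr => k _; apply: eq_bigr => l _; rewrite hC.
    rewrite /op /=.
    under [RHS]eq_bigr => c _ do under eq_bigr => d _ do rewrite big_distrr.
    under [RHS]eq_bigr => c _ do rewrite exchange_big.
    rewrite [RHS]exchange_big; apply: eq_bigr => k _ /=.
    under [RHS]eq_bigr => c _ do under eq_bigr => d _ do rewrite big_distrr.
    under [RHS]eq_bigr => c _ do rewrite exchange_big.
    rewrite [RHS]exchange_big; apply: eq_bigr => l _ /=.
    rewrite /mulm2 big_distrl; apply: eq_bigr => c _ /=; rewrite big_distrl; apply: eq_bigr => d _ /=.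
    by rewrite mulrA.
  under eq_bigr => c _ do rewrite -big_distrr.
  rewrite -big_distrr; congr (_ * _).
  transitivity ((\sum_c \sum_d M2 a b c d *: (coprod_act (fun v => f [:: c, d & v]) : vc)) u).
    rewrite vec_sumE; apply: eq_bigr => c _; rewrite vec_sumE; apply: eq_bigr => d _.
    by rewrite vec_scaleE.
  have -> : (fun v => op 0 M2 f [:: a, b & v]) = \sum_c \sum_d M2 a b c d *: ((fun v => f [:: c, d & v]) : vc).
    apply/funext => v; rewrite vec_sumE; apply: eq_bigr => c _; rewrite vec_sumE; apply: eq_bigr => d _.
    by rewrite vec_scaleE.
  rewrite (islin_sum coprod_act_lin); congr (_ u); apply: eq_bigr => c _.
  rewrite (islin_sum coprod_act_lin); apply: eq_bigr => d _.
  by rewrite (islinZ coprod_act_lin).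
rewrite -[LHS]/(op l M2 (fun v => coprod_act f (a :: v)) w) -[RHS]/(\sum_k M a k * op l M2 (fun v => f (k
    :: v)) w + a1 a * coprod_act (op l M2 (fun v => f (a :: v))) w).
have -> : (fun v => coprod_act f (a :: v)) = (\sum_k M a k *: ((fun v => f (k :: v)) : vc)) + a1 a *:
    (coprod_act (fun v => f (a :: v)) : vc).
  apply/funext => v; rewrite vec_addE vec_sumE vec_scaleE /=; congr (_ + _).
rewrite (islinD op_lin) vec_addE (islinZ op_lin) vec_scaleE IH //; congr (_ + _).
rewrite (islin_sum op_lin) vec_sumE; apply: eq_bigr => k _.
by rewrite (islinZ op_lin) vec_scaleE.
Qed.

Lemma coprod_act_rcons f w j : coprod_act f (rcons w j) = coprod_act (fun u => f (rcons u j)) w +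
  (\prod_(b <- w) a1 b) * \sum_k M j k * f (rcons w k).
Proof.
elim: w f => [|a w IH] f /=; first by rewrite big_nil mul1r mulr0 addr0 add0r.
by rewrite IH big_cons mulrDr addrA -mulrA.
Qed.

Lemma coprod_actE (x0 : I) f w : coprod_act f w = \sum_(j < size w) (\prod_(b <- take j w) a1 b) *
  \sum_k M (nth x0 w j) k * f (take j w ++ k :: drop j.+1 w).
Proof.
elim: w f => [|a w IH] f; first by rewrite big_ord0.
rewrite /= big_ord_recl /= big_nil mul1r drop0; congr (_ + _).
rewrite IH big_distrr; apply: eq_bigr => j _ /=.
by rewrite big_cons mulrA.
Qed.
End ListAction.

(** * The Chevalley generators on the tensor power *)

Section Sites.
Variables (K : comPzRingType) (q qi : K) (m n : nat).
Hypothesis qqi : q * qi = 1.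
Local Notation I := 'I_(m.*2).
Local Notation vc := (vec K I).
Local Notation e := (@ev K I).
Local Notation sq := (@letters I n).
Local Notation TB := (tbasis m n).
Local Notation zp := (zpow q qi).
Local Notation a1 g := (fun c : I => zp (dg g * wt g (val c))).

Lemma sum_upd (x0 : I) (j : 'I_n) (A : I -> K) (f : vc) (r : TB) :
  \sum_(c : TB) A (c j) * (\prod_(l < n | l != j) (r l == c l)%:R) * f (sq c) =
  \sum_k A k * f (take j (sq r) ++ k :: drop j.+1 (sq r)).
Proof.
pose P (k : TB) := [forall l, (l != j) ==> (r l == k l)].
pose upd (k : I) : TB := [ffun l => if l == j then k else r l].
have prodP (k : TB) : \prod_(l < n | l != j) (r l == k l)%:R = (P k)%:R :> K.
  case: (boolP (P k)) => [/forallP h|].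
    by rewrite big1 // => l hl; have := h l; rewrite hl /= => ->.
  rewrite negb_forall => /existsP [l]; rewrite negb_imply => /andP [hl /negbTE hn].
  by rewrite (bigD1 l) //= hn mul0r.
transitivity (\sum_(k | P k) A (k j) * f (sq k)).
  rewrite [RHS]big_mkcond; apply: eq_bigr => k _.
  by rewrite prodP; case: (P k); rewrite ?mulr1 // mulr0 mul0r.
rewrite (reindex_onto upd (fun k : TB => k j)); last first.
  move=> k /forallP h; apply/ffunP => l; rewrite ffunE /=.
  by case: eqP => [-> //|/eqP n1]; have := h l; rewrite n1 => /eqP.
apply: eq_big => [k|k _] /=.
  rewrite !ffunE !eqxx andbT; apply/forallP => l; apply/implyP => /negbTE n1.
  by rewrite ffunE n1.
rewrite !ffunE !eqxx; congr (_ * f _).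
apply: (@eq_from_nth _ x0) => [|l].
  rewrite size_letters size_cat /= size_take size_drop size_letters ltn_ord; have := ltn_ord j; lia.
rewrite size_letters => hl; rewrite (nth_letters _ _ (Ordinal hl)) ffunE -!val_eqE /=.
have si : size (take j (sq r)) = j by rewrite size_takel // size_letters ltnW.
rewrite nth_cat si; case: (ltngtP l j) => h.
- by rewrite nth_take ?(nth_letters _ _ (Ordinal hl)).
- have -> : (l - j = (l - j.+1).+1)%N by lia.
  by rewrite /= nth_drop subnKC ?(nth_letters _ _ (Ordinal hl)).
by rewrite h subnn.
Qed.

Lemma DeltaE_coprod_act (x0 : I) g (f : vc) (r : TB) :
  \sum_(c : TB) DeltaE q qi g r c * f (sq c) = coprod_act (eV K g) (a1 g) f (sq r).
Proof.
rewrite (coprod_actE _ _ x0) size_letters /DeltaE.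
under eq_bigr => c _ do rewrite big_distrl /=.
rewrite exchange_big /=; apply: eq_bigr => j _.
rewrite (nth_letters x0) -(sum_upd x0) big_distrr; apply: eq_bigr => c _ /=.
rewrite mulrA; congr (_ * _); rewrite /tens (bigD1 j) //= ltnn eqxx mulrCA; congr (_ * _).
have -> : \prod_(b <- take j (sq r)) zp (dg g * wt g b) = \prod_(l < n | (l < j)%N) zp (dg g * wt g (r l)).
  rewrite (big_nth x0) size_takel ?size_letters 1?ltnW // big_mkord.
  rewrite (big_ord_widen n (fun l => zp (dg g * wt g (nth x0 (take j (sq r)) l)))) 1?ltnW //.
  by apply: eq_bigr => l lj; rewrite nth_take // nth_letters.
rewrite [X in X * _](_ : _ = \prod_(l < n | l != j) (if (l < j)%N then zp (dg g * wt g (r l)) else 1));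
    last first.
  rewrite [LHS]big_mkcond [RHS]big_mkcond; apply: eq_bigr => l _.
  by case: eqP => [->|]; rewrite ?ltnn.
rewrite -big_split; apply: eq_bigr => l nlj /=; rewrite /kV /idV (negbTE nlj).
by case: ifP => _; rewrite ?mul1r //; case: eqP => [->|_]; rewrite ?mul1r ?mulr1 ?mul0r ?mulr0.
Qed.

Definition dgop (phi : I -> K) : Op K m n := fun r c => (r == c)%:R * \prod_(l < n) phi (c l).

Lemma DeltaK_dgop g s (r c : TB) : DeltaK q qi g s r c = dgop (fun a => zp (s * wt g (val a))) r c.
Proof.
rewrite /DeltaK /tens /dgop /kV; rewrite big_split /=; congr (_ * _).
case: (r =P c) => [->|nrc]; first by rewrite big1 // => l _; rewrite eqxx.
have /existsP [k hk] : [exists k, r k != c k].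
  rewrite -negb_forall; apply/negP => /forallP h; apply: nrc; apply/ffunP => k; exact/eqP/h.
by rewrite (bigD1 k) //= (negbTE hk) mul0r.
Qed.

Definition scale_comm (phi : I -> K) (X : Op K m n) := forall r c : TB,
  X r c * (\prod_(l < n) phi (c l)) = (\prod_(l < n) phi (r l)) * X r c.

Lemma dgop_comm phi X : opcomm X (dgop phi) <-> scale_comm phi X.
Proof.
have e1 (r c : TB) : opmul X (dgop phi) r c = X r c * (\prod_(l < n) phi (c l)).
  rewrite /opmul (bigD1 c) //= big1 ?addr0 /dgop ?eqxx ?mul1r // => k nk.
  by rewrite (negbTE nk) mul0r mulr0.
have e2 (r c : TB) : opmul (dgop phi) X r c = (\prod_(l < n) phi (r l)) * X r c.
  rewrite /opmul (bigD1 r) //= big1 ?addr0 /dgop ?eqxx ?mul1r // => k nk.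
  by rewrite eq_sym (negbTE nk) !mul0r.
by split=> h r c; have := h r c; rewrite e1 e2.
Qed.

Lemma wt_prim (g : 'I_m) (c : I) : wt g (val (prim c)) = - wt g (val c).
Proof.
rewrite /wt /pr val_prim /=; have := ltn_ord g; have := ltn_ord c; have := muln2 m.
move: (nat_of_ord c) (nat_of_ord g) => j k hN hj hk.
by do ! (case: ifP => //); lia.
Qed.

Lemma genop_scale p phi : (forall c, phi c * phi (prim c) = 1) -> adjpos p ->
  scale_comm phi (genop q qi p).
Proof.
move=> hphi; case: p => b [i j]; rewrite /adjpos /= => /eqP hij r c; rewrite /genop /atpos2 /=.
have nji : j != i by rewrite -val_eqE /= hij gtn_eqF.
have prodD (x : TB) : \prod_(l < n) phi (x l) = phi (x i) * phi (x j) * \prod_(l < n | (l != i) && (l !=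
    j)) phi (x l).
  by rewrite (bigD1 i) //= (bigD1 j) //= mulrA.
rewrite !prodD; set G := (if b then _ else _).
have hG : G (r i) (r j) (c i) (c j) * (phi (c i) * phi (c j)) = phi (r i) * phi (r j) * G (r i) (r j) (c i)
    (c j).
  by rewrite /G; case: b @G; [exact: beta_wt | exact: gamma_wt].
have hP : (\prod_(l < n | (l != i) && (l != j)) (r l == c l)%:R) * (\prod_(l < n | (l != i) && (l != j))
    phi (c l)) =
 (\prod_(l < n | (l != i) && (l != j)) phi (r l)) * (\prod_(l < n | (l != i) && (l != j)) (r l == c l)%:R) :> K.
  by rewrite -!big_split; apply: eq_bigr => l _ /=; case: eqP => [->|]; rewrite ?mulr0 ?mul0r // mulrC.
by rewrite mulrACA hG hP mulrACA.
Qed.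

Lemma genop_sym p (r c : TB) : genop q qi p r c = genop q qi p c r.
Proof.
case: p => b [i j]; rewrite /genop /atpos2 /=; congr (_ * _).
  by case: b; [exact: beta_sym | exact: gamma_sym].
by apply: eq_bigr => l _; rewrite eq_sym.
Qed.

Lemma eV_short (g : 'I_m) : (g < m.-1)%N -> exists t s : I,
  [/\ s = t.+1 :> nat, prim t = (prim s).+1 :> nat, (s < prim s)%N, (s < m)%N &
    (forall r c, eV K g r c = ((c == s) && (r == t))%:R - ((c == prim t) && (r == prim s))%:R) /\
    (forall c, a1 g c = if (c == t) || (c == prim s) then q else if (c == s) || (c == prim t) then qi else 1)].
Proof.
move=> hg; have gm := ltn_ord g; have m2 := muln2 m.
have ht : (g < m.*2)%N by lia.
have hs : (g.+1 < m.*2)%N by lia.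
exists (Ordinal ht), (Ordinal hs).
have e1 : (m.*2 - g.+2 = m.*2.-1 - g.+1)%N by lia.
have e2 : (m.*2 - g.+1 = m.*2.-1 - g)%N by lia.
split; rewrite /=; try lia; split=> [r c|c]; first by rewrite /eV hg -!val_eqE /= /pr e1 e2.
rewrite /dg /wt hg mul1r -!val_eqE /= /pr e1 e2.
by case: ifP => _; [rewrite /= expr1 | case: ifP => _; rewrite /= ?expr1 ?expr0].
Qed.

Lemma eV_long (g : 'I_m) : ~~ (g < m.-1)%N -> exists t s : I,
  [/\ prim t = s, s = t.+1 :> nat, s = m :> nat &
    (forall r c, eV K g r c = ((c == s) && (r == t))%:R) /\
    (forall c, a1 g c = if c == t then q * q else if c == s then qi * qi else 1)].
Proof.
move=> hg; have gm := ltn_ord g; have m2 := muln2 m.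
have ht : (m.-1 < m.*2)%N by lia.
have hs : (m < m.*2)%N by lia.
exists (Ordinal ht), (Ordinal hs); split; rewrite /=; try lia.
  by apply: val_inj; rewrite val_prim /=; lia.
split=> [r c|c]; first by rewrite /eV (negbTE hg) -!val_eqE.
rewrite /dg /wt (negbTE hg) -!val_eqE /=.
by case: ifP => _; [rewrite mulr1 /= expr2 | case: ifP => _; rewrite /= ?expr2 ?mulr0 ?expr0].
Qed.

Lemma Etwo_eV_comm (g : 'I_m) a b c d :
  mulm2 (@betaV K q qi m) (Etwo (eV K g) (a1 g)) a b c d = mulm2 (Etwo (eV K g) (a1 g)) (@betaV K q qi m) a
      b c d /\
  mulm2 (@gammaV K q qi m) (Etwo (eV K g) (a1 g)) a b c d = mulm2 (Etwo (eV K g) (a1 g)) (@gammaV K q qi m)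
      a b c d.
Proof.
have [/eV_short [t [s [v1 v2 v3 v4 [hM ha]]]]|/eV_long [t [s [p1 v1 v2 [hM ha]]]]] := boolP (g < m.-1)%N.
  by split; [exact: (beta_Etwo_short qqi erefl erefl v1 v2 v3 v4 hM ha) | exact: (gamma_Etwo_short qqi
      erefl erefl v1 v2 v3 v4 hM ha)].
by split; [exact: (beta_Etwo_long qqi p1 v1 v2 hM ha) | exact: (gamma_Etwo_long qqi p1 v1 v2 hM ha)].
Qed.

Lemma genop_DeltaE (g : 'I_m) p : adjpos p -> opcomm (genop q qi p) (@DeltaE K q qi m n g).
Proof.
case: p => b [i j]; rewrite /adjpos /= => /eqP hij r c; set M2 := if b then @betaV K q qi m else @gammaV K
    q qi m.
have DE (k c' : TB) : DeltaE q qi g k c' = coprod_act (eV K g) (a1 g) (e (sq c')) (sq k).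
  rewrite -(DeltaE_coprod_act (r i)) (bigD1 c') //= /ev eqxx mulr1 big1 ?addr0 // => k' nk.
  by rewrite (inj_eq (@letters_inj _ _)) (negbTE nk) mulr0.
have GE (k c' : TB) : genop q qi (b, (i, j)) k c' = op i M2 (e (sq c')) (sq k).
  rewrite -(atpos2_sum _ _ _ hij) (bigD1 c') //= /ev eqxx mulr1 big1 ?addr0 // => k' nk.
  by rewrite (inj_eq (@letters_inj _ _)) (negbTE nk) mulr0.
rewrite /opmul; under eq_bigr => k _ do rewrite DE.
rewrite (atpos2_sum M2 _ _ hij) op_coprod_act.
- by rewrite -(DeltaE_coprod_act (r i)); apply: eq_bigr => k _; rewrite GE.
- by rewrite size_letters -[i.+1]hij ltn_ord.
- have hw : forall c0 : I, a1 g c0 * a1 g (prim c0) = 1.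
    by move=> c0; rewrite wt_prim mulrN zpowN.
  move=> a' b' c' d'; have h1 := beta_wt qqi a' b' c' d' hw; have h2 := gamma_wt qqi a' b' c' d' hw.
  by rewrite /M2; case: b {GE} @M2.
- move=> a' b' c' d'; have [h1 h2] := Etwo_eV_comm g a' b' c' d'.
  by rewrite /M2; case: b {GE} @M2.
Qed.

Lemma opcomm_mul (A B X : Op K m n) : opcomm A X -> opcomm B X -> opcomm (opmul A B) X.
Proof.
move=> hA hB r c.
have as_ (P Q R : Op K m n) r' c' : opmul (opmul P Q) R r' c' = opmul P (opmul Q R) r' c'.
  rewrite /opmul; under eq_bigr => k _ do rewrite big_distrl /=.
  rewrite exchange_big /=; apply: eq_bigr => k _; rewrite big_distrr; apply: eq_bigr => l _ /=.
  by rewrite mulrA.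
rewrite as_; transitivity (opmul A (opmul X B) r c); first by apply: eq_bigr => k _; rewrite hB.
by rewrite -as_; transitivity (opmul (opmul X A) B r c); [apply: eq_bigr => k _; rewrite hA | rewrite as_].
Qed.

Lemma opcomm_sym (A B : Op K m n) : opcomm A B -> opcomm B A.
Proof. by move=> h r c; rewrite h. Qed.

Lemma opcomm_ext (A A' B : Op K m n) : (forall r c, A r c = A' r c) -> opcomm A B -> opcomm A' B.
Proof.
move=> h hA r c; transitivity (opmul A B r c); first by apply: eq_bigr => k _; rewrite h.
by rewrite hA; apply: eq_bigr => k _; rewrite h.
Qed.

Lemma opcomm_one (X : Op K m n) : opcomm (@opone K m n) X.
Proof.
move=> r c; rewrite /opmul /opone (bigD1 r) //= eqxx mul1r big1 ?addr0 => [|k nk]; last first.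
  by rewrite eq_sym (negbTE nk) mul0r.
rewrite (bigD1 c) //= eqxx mulr1 big1 ?addr0 // => k nk.
by rewrite (negbTE nk) mulr0.
Qed.

Lemma opcomm_pow (A X : Op K m n) a : opcomm A X -> opcomm (oppow A a) X.
Proof.
move=> h; elim: a => [|a IH]; first exact: opcomm_one.
exact: opcomm_mul.
Qed.

Lemma opcomm_scale k (A X : Op K m n) : opcomm A X -> opcomm (fun r c => k * A r c) X.
Proof.
move=> h r c; transitivity (k * opmul A X r c).
  by rewrite /opmul big_distrr; apply: eq_bigr => t _; rewrite -mulrA.
by rewrite h /opmul big_distrr; apply: eq_bigr => t _; rewrite mulrCA.
Qed.

Lemma phi_comm (X A : Op K m n) : (forall p, adjpos p -> opcomm (genop q qi p) A) ->
  in_phiC q qi X -> opcomm X A.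
Proof.
move=> hg [s [/allP hs hX]] r c.
have hw w : all (@adjpos n) w -> opcomm (word q qi w) A.
  elim: w => [|p w IH] /=; first by move=> _; exact: opcomm_one.
  by case/andP => hp /IH; apply: opcomm_mul; exact: hg.
transitivity (\sum_(p <- s) p.1 * opmul (word q qi p.2) A r c).
  rewrite /opmul; under eq_bigr => k _ do rewrite hX big_distrl.
  rewrite exchange_big; apply: eq_bigr => p _ /=; rewrite big_distrr.
  by apply: eq_bigr => k _ /=; rewrite mulrA.
rewrite -[RHS]/(\sum_k A r k * X k c); under [RHS]eq_bigr => k _ do rewrite hX big_distrr.
rewrite [RHS]exchange_big; rewrite big_seq [RHS]big_seq; apply: eq_bigr => p /hs hp /=.
rewrite (hw _ hp) /opmul big_distrr; apply: eq_bigr => k _ /=.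
by rewrite mulrCA.
Qed.

(** The eigenvalue of k~_g^{-1} on the basis tensor c. *)
Definition kdiag (g : 'I_m) (c : TB) : K := \prod_(l < n) zp (- dg g * wt g (c l)).

Lemma eV_wt (g : 'I_m) (r c : I) : eV K g r c != 0 -> wt g r = 1 /\ wt g c = -1.
Proof.
rewrite /eV /wt /=; have gm := ltn_ord g; have m2 := muln2 m; have rm := ltn_ord r; have cm := ltn_ord c.
case: ifP => hg.
  case: (boolP (_ && _)) => [/andP [/eqP -> /eqP ->] _|_].
    by rewrite /pr !eqxx /=; split => //; do ! (case: ifP => //); lia.
  case: (boolP (_ && _)) => [/andP [/eqP -> /eqP ->] _|_]; last by rewrite subrr eqxx.
  by rewrite /pr !eqxx ?orbT /=; split => //; do ! (case: ifP => //); lia.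
case: (boolP (_ && _)) => [/andP [/eqP -> /eqP ->] _|_]; last by rewrite eqxx.
by rewrite !eqxx; split => //; case: ifP => //; lia.
Qed.

Lemma fV_eV (g : 'I_m) (r c : I) : fV K g r c = eV K g c r.
Proof.
rewrite /fV /eV; case: ifP => hg; last by rewrite andbC.
by rewrite andbC [in X in _ - X]andbC.
Qed.

(** Multiplying the transpose of e_g by k~_g^{-1} clears the factors left of the active one and puts
    k~_g^{-1} on those to its right. The active factor picks up q_g^{-1}, its letter in c having
    weight 1; the constant in front undoes this. *)
Lemma DeltaF_E (g : 'I_m) (r c : TB) :
  DeltaF q qi g r c = zp (dg g) * DeltaE q qi g c r * kdiag g c.
Proof.
rewrite /DeltaF /DeltaE /kdiag big_distrr big_distrl; apply: eq_bigr => j _ /=.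
rewrite /tens (bigD1 j) //= ltnn eqxx [in RHS](bigD1 j) //= ltnn eqxx.
rewrite [X in _ = _ * X](bigD1 j) //= fV_eV.
have aux (x y u p d : K) : x * (y * p) * (u * d) = x * (y * u) * (p * d) by ring.
have h : zp (dg g) * (eV K g (c j) (r j) * zp (- dg g * wt g (c j))) = eV K g (c j) (r j).
  have [->|h] := eqVneq (eV K g (c j) (r j)) 0; first by rewrite mul0r mulr0.
  by have [-> _] := eV_wt h; rewrite mulr1 mulrCA zpowN // mulr1.
rewrite aux h; congr (_ * _); rewrite -big_split; apply: eq_bigr => l nlj /=.
rewrite (negbTE nlj); case: ifP => _.
  rewrite /idV /kV eq_sym; case: eqP => [->|_]; last by rewrite !mul0r.
  by rewrite mul1r mulNr zpowN.
by rewrite /idV /kV eq_sym.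
Qed.
End Sites.

(** * Specialization from Q(q) *)
Section Specialization.
Variables (K : comPzRingType) (z zi : K).
Hypothesis zzi : z * zi = 1.

Definition int_eval (p : {poly int}) : K := \sum_(i < size p) (p`_i)%:~R * z ^+ i.

Lemma int_evalE N (p : {poly int}) : (size p <= N)%N -> int_eval p = \sum_(i < N) (p`_i)%:~R * z ^+ i.
Proof.
move=> h; rewrite /int_eval (big_ord_widen _ (fun i => (p`_i)%:~R * z ^+ i) h) big_mkcond.
by apply: eq_bigr => i _; case: ltnP => // hi; rewrite nth_default // mulr0z mul0r.
Qed.

Lemma int_evalD p r : int_eval (p + r) = int_eval p + int_eval r.
Proof.
rewrite (@int_evalE (maxn (size p) (size r)) (p + r)); last exact: size_polyD.
rewrite (@int_evalE (maxn (size p) (size r)) p) ?leq_maxl // (@int_evalE (maxn (size p) (size r)) r)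
    ?leq_maxr //.
by rewrite -big_split; apply: eq_bigr => i _ /=; rewrite coefD intrD mulrDl.
Qed.

Lemma int_evalZ c p : int_eval (c *: p) = c%:~R * int_eval p.
Proof.
rewrite (@int_evalE (size p)) ?size_scale_leq // /int_eval big_distrr; apply: eq_bigr => i _ /=.
by rewrite coefZ intrM mulrA.
Qed.

Lemma int_evalMX p : int_eval (p * 'X) = int_eval p * z.
Proof.
rewrite (@int_evalE (size p).+1); last first.
  by have [->|p0] := eqVneq p 0; rewrite ?mul0r ?size_poly0 // size_mulX.
rewrite big_ord_recl coefMX /= mulr0z mul0r add0r /int_eval big_distrl; apply: eq_bigr => i _ /=.
by rewrite coefMX /= exprSr mulrA.
Qed.

Lemma int_eval0 : int_eval 0 = 0. Proof. by rewrite /int_eval size_poly0 big_ord0. Qed.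

Lemma int_evalC c : int_eval c%:P = c%:~R.
Proof. by rewrite (@int_evalE 1) ?size_polyC_leq1 // big_ord1 coefC eqxx expr0 mulr1. Qed.

Lemma int_evalM p r : int_eval (p * r) = int_eval p * int_eval r.
Proof.
elim/poly_ind: r => [|r c IH]; first by rewrite mulr0 int_eval0 mulr0.
by rewrite mulrDr mulrA !int_evalD !int_evalMX IH [p * _%:P]mulrC mul_polyC int_evalZ int_evalC; ring.
Qed.

Lemma int_evalMXn p N : int_eval (p * 'X^N) = int_eval p * z ^+ N.
Proof.
elim: N p => [|N IH] p; first by rewrite !expr0 !mulr1.
by rewrite exprS mulrA IH int_evalMX exprS mulrA.
Qed.

Lemma qF0 : qF != 0.
Proof. by rewrite /qF tofrac_eq0 polyX_eq0. Qed.

Lemma qFqi : qF * qF^-1 = 1.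
Proof. by rewrite mulfV // qF0. Qed.

Local Notation sp := (spec z zi).

Lemma expr_zzi N : z ^+ N * zi ^+ N = 1.
Proof. by rewrite -exprMn zzi expr1n. Qed.

Lemma tofracXn N : FracField.tofrac ('X^N : {poly int}) = qF ^+ N.
Proof. by rewrite rmorphXn. Qed.

(** Clearing denominators turns an equality in Q(q) into one in Z[q], which can be evaluated at z;
    powers of the unit z are cancelled afterwards. *)
Lemma spec_uniq y k k' : sp y k -> sp y k' -> k = k'.
Proof.
move=> [p [N [-> ->]]] [r [N' [e ->]]]; rewrite -!/(int_eval _).
have qn M : qF ^+ M != 0 by rewrite expf_neq0 // qF0.
have : int_eval (p * 'X^N') = int_eval (r * 'X^N).
  congr int_eval; apply/eqP; rewrite -tofrac_eq !rmorphM /= !tofracXn -eqr_div ?qn //; exact/eqP.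
rewrite !int_evalMXn => h.
have -> : int_eval p * zi ^+ N = int_eval p * z ^+ N' * (zi ^+ N * zi ^+ N').
  by rewrite -mulrA [z ^+ N' * _]mulrCA expr_zzi mulr1.
by rewrite h -mulrA [z ^+ N * _]mulrA expr_zzi mul1r.
Qed.

Lemma spec_tofrac p : sp (FracField.tofrac p) (int_eval p).
Proof. by exists p, 0%N; rewrite !expr0 divr1 mulr1. Qed.

Lemma spec0 : sp 0 0.
Proof. by rewrite -(rmorph0 (@FracField.tofrac _)) -[X in sp _ X]int_eval0; exact: spec_tofrac. Qed.

Lemma spec1 : sp 1 1.
Proof.
rewrite -(rmorph1 (@FracField.tofrac _)) (_ : 1 = int_eval 1) //; first exact: spec_tofrac.
by rewrite (int_evalC 1).
Qed.

Lemma specD y1 y2 k1 k2 : sp y1 k1 -> sp y2 k2 -> sp (y1 + y2) (k1 + k2).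
Proof.
move=> [p [N [-> ->]]] [r [N' [-> ->]]]; exists (p * 'X^N' + r * 'X^N), (N + N')%N.
rewrite -!/(int_eval _); have qn M : qF ^+ M != 0 by rewrite expf_neq0 // qF0.
split.
  by rewrite rmorphD !rmorphM /= !tofracXn exprD addf_div.
rewrite int_evalD !int_evalMXn exprD mulrDl; congr (_ + _).
  by rewrite -mulrA [z ^+ N' * _]mulrCA expr_zzi mulr1.
by rewrite -mulrA [z ^+ N * _]mulrA expr_zzi mul1r.
Qed.

Lemma specM y1 y2 k1 k2 : sp y1 k1 -> sp y2 k2 -> sp (y1 * y2) (k1 * k2).
Proof.
move=> [p [N [-> ->]]] [r [N' [-> ->]]]; exists (p * r), (N + N')%N.
rewrite -!/(int_eval _); have qn M : qF ^+ M != 0 by rewrite expf_neq0 // qF0.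
split; first by rewrite rmorphM /= exprD mulf_div.
by rewrite int_evalM exprD mulrACA.
Qed.

Lemma specN1 : sp (- 1) (- 1).
Proof.
rewrite -(rmorph1 (@FracField.tofrac _)) -rmorphN (_ : - 1 = int_eval (- 1)) //; first exact: spec_tofrac.
by rewrite -polyCN int_evalC mulrN1z.
Qed.

Lemma specN y k : sp y k -> sp (- y) (- k).
Proof. by move=> h; rewrite -mulN1r -[- k]mulN1r; exact: specM specN1 h. Qed.

Lemma specB y1 y2 k1 k2 : sp y1 k1 -> sp y2 k2 -> sp (y1 - y2) (k1 - k2).
Proof. by move=> h1 /specN; exact: specD. Qed.

Lemma spec_q : sp qF z.
Proof.
have := spec_tofrac 'X; have -> // : int_eval 'X = z.
by rewrite -['X]mul1r int_evalMX (int_evalC 1) mul1r.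
Qed.

Lemma spec_qi : sp qF^-1 zi.
Proof. by exists 1, 1%N; rewrite rmorph1 expr1 div1r expr1 -/(int_eval 1) (int_evalC 1) mul1r. Qed.

Lemma specX y k N : sp y k -> sp (y ^+ N) (k ^+ N).
Proof. by move=> h; elim: N => [|N IH]; rewrite ?expr0 ?exprS; [exact: spec1 | exact: specM]. Qed.

Lemma spec_zpow a : sp (zpow qF qF^-1 a) (zpow z zi a).
Proof. by case: a => a /=; apply: specX; [exact: spec_q | exact: spec_qi]. Qed.

Lemma spec_bool (b : bool) : sp b%:R b%:R.
Proof. by case: b; [exact: spec1 | exact: spec0]. Qed.

Lemma spec_sum (J : Type) (r : seq J) (P : pred J) (F : J -> Fq) (G : J -> K) :
  (forall j, P j -> sp (F j) (G j)) -> sp (\sum_(j <- r | P j) F j) (\sum_(j <- r | P j) G j).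
Proof. by move=> h; elim/big_rec2: _ => [|j x y Pj]; [exact: spec0 | exact: (specD (h j Pj))]. Qed.

Lemma spec_prod (J : Type) (r : seq J) (P : pred J) (F : J -> Fq) (G : J -> K) :
  (forall j, P j -> sp (F j) (G j)) -> sp (\prod_(j <- r | P j) F j) (\prod_(j <- r | P j) G j).
Proof. by move=> h; elim/big_rec2: _ => [|j x y Pj]; [exact: spec1 | exact: (specM (h j Pj))]. Qed.

Section Ops.
Variables m n : nat.
Local Notation TB := (tbasis m n).
Local Notation spo := (@specOp K z zi m n).

Lemma spec_eps (p : 'I_(m.*2)) : sp (eps Fq p) (eps K p).
Proof. by rewrite /eps; case: ifP => _; [exact: spec1 | exact: specN1]. Qed.

Lemma spec_gamma a b c d : sp (@gammaV Fq qF qF^-1 m a b c d) (gammaV z zi a b c d).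
Proof.
apply: spec_sum => i _; apply: spec_sum => j _.
apply: specM; last exact: spec_bool.
by apply: specM; [apply: specM; [exact: spec_zpow | exact: spec_eps] | exact: spec_eps].
Qed.

Lemma spec_beta a b c d : sp (@betaV Fq qF qF^-1 m a b c d) (betaV z zi a b c d).
Proof.
apply: specD; first apply: specD.
- apply: spec_sum => i _; apply: specD; apply: specM; try exact: spec_bool.
    exact: spec_q.
  exact: spec_qi.
- by apply: spec_sum => i _; apply: spec_sum => j _; exact: spec_bool.
apply: specM; first by apply: specB; [exact: spec_q | exact: spec_qi].
apply: spec_sum => i _; apply: spec_sum => j _; apply: specB; first exact: spec_bool.
apply: specM; last exact: spec_bool.
by apply: specM; [apply: specM; [exact: spec_zpow | exact: spec_eps] | exact: spec_eps].
Qed.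

Lemma spec_genop p : spo (genop qF qF^-1 p) (genop z zi p).
Proof.
move=> r c; rewrite /genop /atpos2; apply: specM; last by apply: spec_prod => l _; exact: spec_bool.
by case: p.1; [exact: spec_beta | exact: spec_gamma].
Qed.

(** Relations are proved over Q(q), where [a]! is invertible, and carried to K by this lemma. *)
Lemma spec_comm A A' G G' : spo A A' -> spo G G' -> opcomm A G -> opcomm A' G'.
Proof.
move=> hA hG h r c; apply: (@spec_uniq (opmul A G r c)).
  by apply: spec_sum => k _; exact: specM.
by rewrite h; apply: spec_sum => k _; exact: specM.
Qed.
End Ops.
End Specialization.

(** * The image of the algebra commutes with the quantum group *)

Section FCommutation.
Variables (K : comPzRingType) (q qi : K) (m n : nat).
Hypothesis qqi : q * qi = 1.
Local Notation TB := (tbasis m n).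

Lemma zpow_wt_prim (g : 'I_m) s (c : 'I_(m.*2)) : zpow q qi (s * wt g (val c)) * zpow q qi (s * wt g (val
    (prim c))) = 1.
Proof. by rewrite wt_prim mulrN zpowN. Qed.

Lemma genop_DeltaF (g : 'I_m) p : adjpos p -> opcomm (genop q qi p) (@DeltaF K q qi m n g).
Proof.
move=> hp r c; have hE := genop_DeltaE qqi g hp.
have hS := genop_scale qqi (zpow_wt_prim g (- dg g)) hp.
rewrite /opmul.
transitivity (zpow q qi (dg g) * kdiag q qi g c * opmul (@DeltaE K q qi m n g) (genop q qi p) c r).
  rewrite /opmul big_distrr; apply: eq_bigr => k _ /=.
  by rewrite DeltaF_E // (genop_sym qqi _ r k); ring.
rewrite -hE /opmul big_distrr; apply: eq_bigr => k _ /=.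
rewrite DeltaF_E // (genop_sym qqi _ c k).
transitivity (zpow q qi (dg g) * DeltaE q qi g k r * (genop q qi p k c * kdiag q qi g c)); first by ring.
by rewrite [genop _ _ _ _ _ * _]hS mulrA.
Qed.
End FCommutation.

Lemma phi_EndU (m n : nat) (K : comPzRingType) (z zi : K) : z * zi = 1 ->
  forall X : Op K m n, in_phiC z zi X -> in_EndU z zi X.
Proof.
move=> zzi X pX g a.
have gF : qF * qF^-1 = 1 := qFqi.
split; last split; last split.
- move=> G hG; apply: phi_comm pX => p hp.
  apply: (spec_comm zzi (spec_genop zzi p) hG).
  (* Over Q(q) a divided power is a scalar times a power of the generator. *)
  apply: opcomm_sym; apply: opcomm_scale; apply: opcomm_pow; apply: opcomm_sym.
  exact: genop_DeltaE.
- move=> G hG; apply: phi_comm pX => p hp.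
  apply: (spec_comm zzi (spec_genop zzi p) hG).
  apply: opcomm_sym; apply: opcomm_scale; apply: opcomm_pow; apply: opcomm_sym.
  exact: genop_DeltaF.
- apply: phi_comm pX => p hp; apply: opcomm_sym.
  apply: (opcomm_ext (A := dgop (fun c => zpow z zi (1 * wt g (val c))))) => [r c|].
    by rewrite DeltaK_dgop.
  apply: opcomm_sym; apply/dgop_comm; apply: genop_scale => //; exact: zpow_wt_prim.
apply: phi_comm pX => p hp; apply: opcomm_sym.
apply: (opcomm_ext (A := dgop (fun c => zpow z zi (-1 * wt g (val c))))) => [r c|].
  by rewrite DeltaK_dgop.
apply: opcomm_sym; apply/dgop_comm; apply: genop_scale => //; exact: zpow_wt_prim.
Qed.

(** * Divided powers and leading words *)
Section Divided.
Variables (K : comPzRingType) (q qi : K) (m : nat).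
Hypothesis qqi : q * qi = 1.
Local Notation I := 'I_(m.*2).
Local Notation vc := (vec K I).
Local Notation zp := (zpow q qi).
Implicit Types (g : 'I_m) (F G : vc) (w v : seq I) (j k l : I).

(* The eigenvalue of k~_g on the word w. *)
Definition kweight g w : K := zp (dg g * weight g w).

Lemma weight_cons g j w : weight g (j :: w) = wt g j + weight g w.
Proof. by rewrite /weight big_cons. Qed.

Lemma weight_nil g : weight g ([::] : seq I) = 0.
Proof. by rewrite /weight big_nil. Qed.

Lemma kweight_cons g j w : kweight g (j :: w) = zp (dg g * wt g j) * kweight g w.
Proof. by rewrite /kweight weight_cons mulrDr zpowD. Qed.

(* The divided power e_g^{(a)}, on words read from right to left: the recursion peels
   off the last tensor factor, which e_g hits at most once since e_g^2 = 0 on V.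
   No quantum factorial is inverted, so this makes sense over every K. *)
Fixpoint Ediv g (a : nat) (F : vc) (w : seq I) : K :=
  if w is j :: u then
    Ediv g a (fun v => F (j :: v)) u +
    (if a is a'.+1 then
      zp (- (dg g * a'%:Z)) * kweight g u * \sum_k eV K g j k * Ediv g a' (fun v => F (k :: v)) u
     else 0)
  else (a == 0%N)%:R * F [::].

Lemma Ediv_cons g a F j u : Ediv g a F (j :: u) = Ediv g a (fun v => F (j :: v)) u +
    (if a is a'.+1 then
      zp (- (dg g * a'%:Z)) * kweight g u * \sum_k eV K g j k * Ediv g a' (fun v => F (k :: v)) u
     else 0).
Proof. by []. Qed.

Lemma Ediv0 g F w : Ediv g 0 F w = F w.
Proof. by elim: w F => [|j u IH] F /=; rewrite ?mul1r // IH addr0. Qed.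

Lemma Ediv_ext g a F G w : (forall v, size v = size w -> F v = G v) -> Ediv g a F w = Ediv g a G w.
Proof.
elim: w a F G => [|j u IH] a F G h /=; first by rewrite h.
rewrite (IH _ _ (fun v => G (j :: v))); last by move=> v sv; rewrite h /= ?sv.
case: a => // a; congr (_ + _ * _); apply: eq_bigr => k _; congr (_ * _).
by apply: IH => v sv; rewrite h /= ?sv.
Qed.

Lemma Ediv_lin g a : islin (Ediv g a : vc -> vc).
Proof.
move=> t F G; apply/funext => w; rewrite vec_addE vec_scaleE.
elim: w a F G => [|j u IH] a F G /=; first by rewrite vec_addE vec_scaleE mulrDr mulrCA.
rewrite (IH a (fun v => F (j :: v)) (fun v => G (j :: v))).
case: a => [|a]; first by rewrite !addr0.
rewrite (_ : \sum_k _ = t * (\sum_k eV K g j k * Ediv g a (fun v => F (k :: v)) u)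
   + \sum_k eV K g j k * Ediv g a (fun v => G (k :: v)) u); last first.
  rewrite big_distrr -big_split; apply: eq_bigr => k _ /=.
  by rewrite (IH a (fun v => F (k :: v)) (fun v => G (k :: v))) mulrDr mulrCA.
ring.
Qed.

Lemma Ediv_zero g a F w : (forall v, size v = size w -> F v = 0) -> Ediv g a F w = 0.
Proof.
move=> h; rewrite (@Ediv_ext _ _ _ (0 : vc)); last by move=> v /h ->.
by rewrite (islin0 (@Ediv_lin g a)).
Qed.

Lemma Ediv_scale g a t F w : Ediv g a (fun v => t * F v) w = t * Ediv g a F w.
Proof. exact: (congr1 (@^~ w) (@islinZ _ _ _ t F (@Ediv_lin g a))). Qed.

Lemma wt_cases g j : wt g j = 0 \/ wt g j = 1 \/ wt g j = -1.
Proof. by rewrite /wt; do ! (case: ifP => _); auto. Qed.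

Lemma eV_lt g j k : eV K g j k != 0 -> (j < k)%N.
Proof.
rewrite /eV /=; have gm := ltn_ord g; have m2 := muln2 m.
case: ifP => hg.
  case: (boolP (_ && _)) => [/andP [/eqP -> /eqP ->] _ //|_].
  case: (boolP (_ && _)) => [/andP [/eqP -> /eqP ->] _|_]; last by rewrite subrr eqxx.
  by rewrite /pr; lia.
case: (boolP (_ && _)) => [/andP [/eqP -> /eqP ->] _|_]; last by rewrite eqxx.
by lia.
Qed.

(* Every wt g-string in V has length at most 2: e_g sends v_k to s v_j. *)
Definition arrow g j k (s : K) := [/\ wt g j = 1, wt g k = -1, s * s = 1 &
  forall G : I -> K, \sum_l eV K g j l * G l = s * G k].

Lemma sum_eV g j k s (G : I -> K) : (forall l, eV K g j l = (l == k)%:R * s) ->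
  \sum_l eV K g j l * G l = s * G k.
Proof.
move=> h; transitivity (\sum_l (l == k)%:R * (s * G l)).
  by apply: eq_bigr => l _; rewrite h mulrA.
by rewrite (sum_pred1 _ _ predT) mul1r.
Qed.

(** There are two arrows for a short root, with signs 1 and -1, and one for the long root. *)
Lemma arrowP g : exists s : seq (I * I * K), (forall x, x \in [seq y.1 | y <- s] -> exists t, arrow g x.1
    x.2 t) /\
  (forall j, wt g j = 1 -> exists k, (j, k) \in [seq y.1 | y <- s]) /\
  (forall k, wt g k = -1 -> exists j, (j, k) \in [seq y.1 | y <- s]).
Proof.
have gm := ltn_ord g; have m2 := muln2 m.
have [hg|hg] := boolP (val g < m.-1)%N.
  have ht : (val g < m.*2)%N by rewrite /=; lia.
  have hs : ((val g).+1 < m.*2)%N by rewrite /=; lia.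
  pose t := Ordinal ht : I; pose s := Ordinal hs : I.
  have e1 : pr m g = prim t :> nat by rewrite /pr [nat_of_ord (prim _)]val_prim /=; lia.
  have e2 : pr m g.+1 = prim s :> nat by rewrite /pr [nat_of_ord (prim _)]val_prim /=; lia.
  have v2 : prim t = (prim s).+1 :> nat by rewrite ![nat_of_ord (prim _)]val_prim /=; move: hg => /=; lia.
  have v3 : (s < prim s)%N by rewrite [nat_of_ord (prim _)]val_prim /=; move: hg => /=; lia.
  have wE (j : I) : wt g j = if (j == t) || (j == prim s) then 1 else if (j == s) || (j == prim t) then -1
      else 0.
    by rewrite /wt hg e1 e2 -!val_eqE.
  have eE (j l : I) : eV K g j l = ((l == s) && (j == t))%:R - ((l == prim t) && (j == prim s))%:R.
    by rewrite /eV hg e1 e2 -!val_eqE.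
  have ne (x y : I) : (x != y :> nat) -> (x == y) = false by move=> h; apply/negbTE.
  have n1 : (s == t) = false by apply: ne => /=; lia.
  have n2 : (s == prim s) = false by apply: ne; rewrite neq_ltn v3.
  have n3 : (t == prim s) = false by apply: ne; move: v3 => /=; lia.
  have n4 : (prim t == prim s) = false by rewrite (inj_eq (@prim_inj m)) eq_sym.
  have n5 : (prim t == t) = false by apply: ne; move: v2 v3 => /=; lia.
  exists [:: (t, s, 1); (prim s, prim t, -1)]; split; last split.
  - move=> x; rewrite !inE => /orP [/eqP ->|/eqP ->].
      exists 1; split; rewrite ?wE ?eqxx ?n1 ?n2 ?mulr1 //= => G.
      by apply: sum_eV => l; rewrite eE eqxx n3 andbF andbT subr0 mulr1.
    exists (-1); split; rewrite ?wE ?eqxx ?orbT ?n4 ?n5 ?mulrNN ?mulr1 //= => G.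
    by apply: sum_eV => l; rewrite eE eqxx [prim s == t]eq_sym n3 andbF andbT sub0r mulrN1.
  - move=> j; rewrite wE; case: ifP => [/orP [/eqP ->|/eqP ->] _|_]; last by case: ifP.
      by exists s; rewrite inE eqxx.
    by exists (prim t); rewrite !inE eqxx orbT.
  move=> k; rewrite wE; case: ifP => // _; case: ifP => // /orP [/eqP ->|/eqP ->] _.
    by exists t; rewrite inE eqxx.
  by exists (prim s); rewrite !inE eqxx orbT.
have ht : (m.-1 < m.*2)%N by lia.
have hs : (m < m.*2)%N by lia.
pose t := Ordinal ht : I; pose s := Ordinal hs : I.
have wE (j : I) : wt g j = if j == t then 1 else if j == s then -1 else 0.
  by rewrite /wt (negbTE hg) -!val_eqE.
have eE (j l : I) : eV K g j l = ((l == s) && (j == t))%:R.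
  by rewrite /eV (negbTE hg) -!val_eqE.
have n1 : (s == t) = false by rewrite -val_eqE /=; lia.
exists [:: (t, s, 1)]; split; last split.
- move=> x; rewrite !inE => /eqP ->.
  exists 1; split; rewrite ?wE ?eqxx ?n1 ?mulr1 //= => G.
  by apply: sum_eV => l; rewrite eE eqxx andbT mulr1.
- by move=> j; rewrite wE; case: ifP => [/eqP -> _|_]; [exists s; rewrite inE eqxx | case: ifP].
by move=> k; rewrite wE; case: ifP => // _; case: ifP => // /eqP -> _; exists t; rewrite inE eqxx.
Qed.

Lemma arrow_from g j : wt g j = 1 -> exists k s, arrow g j k s.
Proof.
by move=> h; have [s [h1 [h2 _]]] := arrowP g; have [k /h1 [t]] := h2 j h; exists k, t.
Qed.
Lemma arrow_to g k : wt g k = -1 -> exists j s, arrow g j k s.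
Proof.
by move=> h; have [s [h1 [_ h2]]] := arrowP g; have [j /h1 [t]] := h2 k h; exists j, t.
Qed.

Lemma eV0 g j k : wt g j != 1 -> eV K g j k = 0.
Proof. by move=> h; apply/eqP; apply: contraTT h => /eV_wt [-> _]; rewrite eqxx. Qed.

Lemma Ediv_low g a F j u : wt g j != 1 -> Ediv g a F (j :: u) = Ediv g a (fun v => F (j :: v)) u.
Proof.
move=> h; rewrite Ediv_cons; case: a => [|a]; rewrite ?addr0 // big1 ?mulr0 ?addr0 // => k _.
by rewrite eV0 ?mul0r.
Qed.

(** As e_g^{(a)} raises weights by 2a, its values at weight lam + 2a depend only on the component of
    F of weight lam. *)
Lemma Ediv_homog g p lam F : (forall w, size w = p -> weight g w = lam -> F w = 0) ->
  forall a w, size w = p -> weight g w = lam + (a.*2)%:Z -> Ediv g a F w = 0.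
Proof.
elim: p lam F => [|p IH] lam F hF a [|j u] //=.
  move=> _; rewrite weight_nil; case: a => [|a] h; last by rewrite mul0r.
  by rewrite hF ?mulr0 ?weight_nil // h; lia.
move=> [su]; rewrite weight_cons => hu.
rewrite (IH (lam - wt g j)) //; last first.
- by move: hu; lia.
- by move=> v sv hv; rewrite hF //= ?sv // weight_cons hv; lia.
case: a hu => [|a] hu; rewrite add0r // big1 ?mulr0 // => k _.
have [->|h] := eqVneq (eV K g j k) 0; first by rewrite mul0r.
have [wj wk] := eV_wt h.
rewrite (IH (lam + 1)) ?mulr0 //; last by move: hu; rewrite wj; lia.
by move=> v sv hv; rewrite hF //= ?sv // weight_cons hv wk; lia.
Qed.

Lemma unit_cancel (x y u : K) : x * y = 1 -> x * u = 0 -> u = 0.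
Proof. by move=> h h2; rewrite -[u]mul1r -h [x * y]mulrC -mulrA h2 mulr0. Qed.

(** A single power such as e_g^{(-lam)} need not be injective on the weight space lam: for four
    strings of length 2 and lam = -2 its determinant at q = 1 is -3. All powers from s on are used
    instead. Removing the first letter changes lam by at most one, and s is adjusted so that lam + s
    stays nonpositive. *)
Lemma sl2_weight_vanish g p : forall (lam : int) (s : nat) F,
  (forall a w, (s <= a)%N -> size w = p -> weight g w = lam + (a.*2)%:Z -> Ediv g a F w = 0) ->
  lam + s%:Z <= 0 -> forall w, size w = p -> weight g w = lam -> F w = 0.
Proof.
elim: p => [|p IH] lam s F hF hs w.
  move=> /size0nil -> ; rewrite weight_nil => el.
  have := hF 0%N [::]; rewrite Ediv0 weight_nil => -> //; first by move: hs; lia.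
  by rewrite -el.
case: s hF hs => [|s] hF hs.
  by move=> sw hw'; have := hF 0%N w; rewrite Ediv0 => -> //; rewrite hw' addr0.
(* Write F_j for F behind the first letter j. For a > s the vector F_k is killed by e^{(a)}, so
   e^{(a+1)} F = 0 read behind j gives e^{(a+1)} F_j = 0: the threshold rises by one while lam drops
   by one. *)
have h1 j t : wt g j = 1 -> size t = p -> weight g (j :: t) = lam -> F (j :: t) = 0.
  move=> wj st ht; have [k [sg [_ wk ss hsum]]] := arrow_from wj.
  have hk a v : (s < a)%N -> size v = p -> weight g v = lam + 1 + (a.*2)%:Z -> Ediv g a (fun u => F (k ::
      u)) v = 0.
    move=> sa sv hv; rewrite -Ediv_low ?wk //; apply: hF; rewrite //= ?sv // weight_cons wk hv; lia.
  apply: (IH (lam - 1) s.+2 (fun u => F (j :: u))) => //.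
  - case=> [|a] v //; rewrite ltnS => sa sv hv.
    have := hF a.+1 (j :: v); rewrite Ediv_cons /= hsum hk ?mulr0 ?addr0 //; last first.
      by rewrite hv; lia.
    by apply; rewrite ?sv //; [lia | rewrite weight_cons wj hv; lia].
  - by move: hs; lia.
  - by move: ht; rewrite weight_cons wj; lia.
case: w => // j t [st] ht; have [wj|[wj|wj]] := wt_cases g j.
- apply: (IH lam s.+1 (fun u => F (j :: u))) => //; last by rewrite -ht weight_cons wj add0r.
  by move=> a v sa sv hv; rewrite -Ediv_low ?wj //; apply: hF; rewrite //= ?sv // weight_cons wj hv add0r.
- exact: h1.
have hj a v : (s < a)%N -> size v = p -> weight g v = lam + 1 + (a.*2)%:Z -> Ediv g a (fun u => F (j :: u))
    v = 0.
  by move=> sa sv hv; rewrite -Ediv_low ?wj //; apply: hF; rewrite //= ?sv // weight_cons wj hv; lia.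
have htl : weight g t = lam + 1 by move: ht; rewrite weight_cons wj; lia.
have [hs2|hs2] := lerP (lam + 1 + s.+1%:Z) 0.
  exact: (IH (lam + 1) s.+1 (fun u => F (j :: u)) hj).
(* Here lam = -(s + 1), and for F_j the power a = s is still missing. It is read off behind the
   letter jp: the term with F_jp vanishes by [h1], and the coefficient of the other term is a
   unit. *)
have [jp [sg [wjp _ ss hsum]]] := arrow_to wj.
apply: (IH (lam + 1) s (fun u => F (j :: u))) => //; last by lia.
move=> a v; rewrite leq_eqVlt => /orP [/eqP <-|]; last exact: hj.
move=> sv hv; have := hF s.+1 (jp :: v) (leqnn _); rewrite Ediv_cons /= sv weight_cons wjp hsum => /(_
    erefl) h0.
have : Ediv g s.+1 (fun u => F (jp :: u)) v = 0.
  apply: (@Ediv_homog g p (lam - 1)) => //; last by rewrite hv; lia.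
  by move=> u su hu; apply: h1 => //; rewrite weight_cons wjp hu; lia.
move=> h3; move: h0; rewrite h3 add0r hv => h0.
have {}h0 : zp (- (dg g * s%:Z)) * kweight g v * sg * Ediv g s (fun u => F (j :: u)) v = 0.
  by rewrite -mulrA h0 //; lia.
apply: unit_cancel h0; rewrite -[_ * _ * sg]mulrA.
instantiate (1 := zp (dg g * s%:Z) * (zp (- (dg g * weight g v)) * sg)).
have := zpowN qqi (dg g * s%:Z); have := zpowN qqi (dg g * weight g v); rewrite -/(kweight g v) => e1 e2.
transitivity ((zp (dg g * s%:Z) * zp (- (dg g * s%:Z))) * (kweight g v * zp (- (dg g * weight g v))) * (sg
    * sg)); first by ring.
by rewrite e1 e2 ss !mulr1.
Qed.

Lemma leading_suffix_weights N F w : (forall g a v, (0 < a)%N -> size v = N -> Ediv g a F v = 0) ->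
  size w = N -> F w != 0 -> (forall v, size v = N -> (code w < code v)%N -> F v = 0) ->
  forall p g, 0 <= weight g (drop p w).
Proof.
elim: N F w => [|N IH] F w hF sw Fw hv p g.
  by move/size0nil: sw => ->; rewrite weight_nil.
case: w sw Fw hv => // j t [st] Fw hv.
have top : 0 <= weight g (j :: t).
  case: lerP => // hneg; case/eqP: Fw; apply: (@sl2_weight_vanish g N.+1 (weight g (j :: t)) 1%N F) => //=.
  - by move=> a v a0 sv _; apply: hF.
  - by lia.
  - by rewrite st.
case: p => [|p]; first by rewrite drop0.
rewrite /=; apply: (IH (fun v => F (j :: v))) => //.
  move=> g' a v a0 sv; have := hF g' a (j :: v) a0; rewrite Ediv_cons /= sv => /(_ erefl).
  case: a a0 => // a _; rewrite big1 ?mulr0 ?addr0 // => k _.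
  have [->|h] := eqVneq (eV K g' j k) 0; first by rewrite mul0r.
  rewrite Ediv_zero ?mulr0 // => u su; apply: hv; rewrite /= ?su ?sv //.
  have := code_cons_ltl (v := t) (w := u); rewrite st su sv => /(_ _ _ erefl (eV_lt h)).
  by rewrite /= st su sv.
by move=> v sv hc; apply: hv; rewrite /= ?sv // st ltn_add2l.
Qed.
End Divided.

(** * Bending an endomorphism into an invariant vector *)

Section Coevaluation.
Variables (K : comPzRingType) (q qi : K) (m n : nat).
Hypothesis qqi : q * qi = 1.
Local Notation I := 'I_(m.*2).
Local Notation vc := (vec K I).
Local Notation zp := (zpow q qi).
Local Notation kapi := (kappai q qi).
Local Notation TB := (tbasis m n).
Local Notation Ed := (Ediv q qi).
Local Notation Aw := (kweight q qi).
Local Notation sq := (@letters I n).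
Implicit Types (g : 'I_m) (F G : vc) (w v : seq I) (j k l : I).

Lemma Etwo_cup g : op 0 (Etwo (eV K g) (fun c : I => zp (dg g * wt g (val c)))) (@cup_vec K q qi m) = 0.
Proof.
have [hg|hg] := boolP (g < m.-1)%N.
  have [t [s [v1 v2 v3 v4 [hM ha]]]] := eV_short q qi hg.
  rewrite cup_partial_cup (Etwo_partial_cup qqi erefl erefl v1 v2 v3 v4 hM ha) !ltn_ord.
  by rewrite !subrr !mulr0 !scale0r addr0.
have [t [s [p1 v1 v2 [hM ha]]]] := eV_long q qi hg.
by rewrite cup_partial_cup (Etwo_partial_cup_long qqi p1 v1 v2 hM ha) !ltn_ord subrr mulr0 scale0r.
Qed.

Lemma cup2 k l : (@cup_vec K q qi m) [:: k; l] = (l == prim k)%:R * kapi k.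
Proof.
rewrite /cup_vec vec_sumE (bigD1 k) //= big1 ?addr0 => [|i ni].
  by rewrite vec_scaleE /ev eqseq_cons eqxx /= eqseq_cons eqxx andbT mulrC.
by rewrite vec_scaleE /ev eqseq_cons eq_sym (negbTE ni) mulr0.
Qed.

Lemma cup_inv g j k : eV K g j (prim k) * kapi (prim k) + zp (dg g * wt g (val j)) * (eV K g k (prim j) *
    kapi j) = 0.
Proof.
have /(congr1 (fun f : vc => f [:: j; k])) := Etwo_cup g; rewrite vec_zeroE /op /= => <-.
transitivity (\sum_c ((c == prim k)%:R * (eV K g j c * kapi c)
  + (c == j)%:R * (zp (dg g * wt g (val j)) * (eV K g k (prim c) * kapi c)))).
  by rewrite big_split /= !(sum_pred1 _ _ predT) !mul1r.
apply: eq_bigr => c _.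
rewrite (eq_bigr (fun d => (d == prim c)%:R * (Etwo (eV K g) (fun c0 : I => zp (dg g * wt g c0)) j k c d *
    kapi c))).
  rewrite (sum_pred1 _ _ predT) mul1r /Etwo.
  have -> : (k == prim c) = (c == prim k) by rewrite -eq_prim eq_sym.
  by rewrite [j == c]eq_sym; ring.
by move=> d _; rewrite cup2; ring.
Qed.

(** e_g acts only on letters of weight -1, while l and [prim l] have opposite weights. *)
Lemma eV_eV_prim g j k l : eV K g j l * eV K g k (prim l) = 0.
Proof.
have [->|h] := eqVneq (eV K g j l) 0; first by rewrite mul0r.
have [->|h2] := eqVneq (eV K g k (prim l)) 0; first by rewrite mulr0.
have [_ w1] := eV_wt h; have [_ w2] := eV_wt h2.
by move: w2; rewrite wt_prim w1.
Qed.

(** Words are read from right to left, so the cup a, [prim a] appears as [prim a], a, behind d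
    letters. *)
Fixpoint insert_cup (d : nat) (F : vc) (w : seq I) : K :=
  match d, w with
  | 0, b :: a :: u => (b == prim a)%:R * kapi a * F u
  | d'.+1, j :: u => insert_cup d' (fun v => F (j :: v)) u
  | _, _ => 0
  end.

Lemma insert_cup_lin d : islin (insert_cup d : vc -> vc).
Proof.
move=> t F G; apply/funext => w; rewrite vec_addE vec_scaleE.
elim: d w F G => [|d IH] [|b w] F G /=; rewrite ?mulr0 ?addr0 //.
  case: w => [|a u]; rewrite ?mulr0 ?addr0 // vec_addE vec_scaleE; ring.
exact: (IH w (fun v => F (b :: v)) (fun v => G (b :: v))).
Qed.

Lemma insert_cup_kweight d g F w : insert_cup d (fun v => Aw g v * F v) w = Aw g w * insert_cup d F w.
Proof.
elim: d w F => [|d IH] [|b w] F /=; rewrite ?mulr0 //.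
  case: w => [|a u]; rewrite ?mulr0 //; case: (altP (b =P prim a)) => [->|_]; last by rewrite !mul0r mulr0.
  rewrite !kweight_cons // wt_prim mulrN.
  have e1 := zpowN qqi (dg g * wt g a); rewrite /=; ring: e1.
rewrite (_ : (fun v => Aw g (b :: v) * F (b :: v)) = zp (dg g * wt g b) *: ((fun v => Aw g v * F (b :: v))
    : vc)).
  have := @islinZ _ _ _ (zp (dg g * wt g b)) ((fun v => Aw g v * F (b :: v)) : vc) (@insert_cup_lin d).
  move/(congr1 (fun f : vc => f w)) => ->; rewrite vec_scaleE.
  by rewrite (IH w (fun v => F (b :: v))) kweight_cons // mulrA.
by apply/funext => v; rewrite kweight_cons // -mulrA.
Qed.

(** Inserting an invariant vector is equivariant: e_g on one leg of the cup cancels e_g on the other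
    by [cup_inv], and it cannot act on both by [eV_eV_prim]. The letters in front are passed by
    induction, since the cup has weight 0 and does not affect k~_g. *)
Lemma Ediv_insert_cup d g a F w : (d.+1 < size w)%N -> Ed g a (insert_cup d F) w = insert_cup d (Ed g a F) w.
Proof.
elim: d w a F => [|d IH] [|b w] // a F sw; last first.
  rewrite Ediv_cons [insert_cup d.+1]lock /= -lock.
  rewrite -[RHS]/(insert_cup d (fun v => Ed g a F (b :: v)) w) -/(insert_cup d).
  rewrite (_ : (fun v => insert_cup d.+1 F (b :: v)) = insert_cup d (fun v => F (b :: v))) // IH //.
  case: a => [|a].
    by rewrite addr0; congr (insert_cup d _ w); apply/funext => v; rewrite Ediv_cons addr0.
  rewrite (_ : (fun v => Ed g a.+1 F (b :: v)) = (Ed g a.+1 (fun v => F (b :: v)) : vc)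
    + zp (- (dg g * a%:Z)) *: ((fun v => Aw g v * (\sum_k eV K g b k *: (Ed g a (fun u => F (k :: u)) :
        vc)) v) : vc)); last first.
    apply/funext => v; rewrite vec_addE vec_scaleE vec_sumE Ediv_cons; congr (_ + _).
    by rewrite -mulrA; congr (_ * (_ * _)).
  rewrite (islinD (@insert_cup_lin d)) vec_addE (islinZ (@insert_cup_lin d)) vec_scaleE; congr (_ + _).
  rewrite insert_cup_kweight -mulrA; congr (_ * (_ * _)).
  rewrite (islin_sum (@insert_cup_lin d)) vec_sumE; apply: eq_bigr => k _.
  by rewrite (islinZ (@insert_cup_lin d)) vec_scaleE -IH.
case: w sw => [|c u] // _.
pose cc (x y : I) : K := (x == prim y)%:R * kapi y.
have base a' x y : Ed g a' (fun v => insert_cup 0 F [:: x, y & v]) u = cc x y * Ed g a' F u.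
  exact: Ediv_scale.
have sums : \sum_l eV K g c l * cc b l + zp (dg g * wt g (val c)) * \sum_k eV K g b k * cc k c = 0.
  apply: etrans (cup_inv g c b); congr (_ + _ * _).
    transitivity (\sum_l (l == prim b)%:R * (eV K g c l * kapi l)).
      by apply: eq_bigr => l _; rewrite /cc -eq_prim [prim b == l]eq_sym; ring.
    by rewrite (sum_pred1 _ _ predT) mul1r.
  transitivity (\sum_k (k == prim c)%:R * (eV K g b k * kapi c)).
    by apply: eq_bigr => k _; rewrite /cc; ring.
  by rewrite (sum_pred1 _ _ predT) mul1r.
have sum2 : \sum_k eV K g b k * (\sum_l eV K g c l * cc k l) = 0.
  apply: big1 => k _; rewrite big_distrr big1 // => l _ /=; rewrite /cc.
  case: (altP (k =P prim l)) => [->|_]; last by rewrite /=; ring.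
  transitivity ((eV K g c l * eV K g b (prim l)) * kapi l); first by rewrite /=; ring.
  by rewrite eV_eV_prim mul0r.
have expand_operator a' x : Ed g a'.+1 (fun v => insert_cup 0 F (x :: v)) (c :: u) = cc x c * Ed g a'.+1 F u
    + zp (- (dg g * a'%:Z)) * Aw g u * (\sum_l eV K g c l * cc x l) * Ed g a' F u.
  rewrite Ediv_cons base; congr (_ + _); rewrite -[RHS]mulrA; congr (_ * _).
  by rewrite big_distrl; apply: eq_bigr => l _; rewrite base mulrA.
case: a => [|a]; first by rewrite Ediv0 [in RHS]/= Ediv0.
rewrite Ediv_cons expand_operator -[RHS]/(cc b c * Ed g a.+1 F u) -addrA -[RHS]addr0; congr (_ + _).
rewrite kweight_cons //.
have -> : \sum_k eV K g b k * Ed g a (fun v => insert_cup 0 F (k :: v)) (c :: u) =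
    (\sum_k eV K g b k * cc k c) * Ed g a F u.
  case: a => [|a].
    by rewrite big_distrl; apply: eq_bigr => k _; rewrite !Ediv0 /cc /=; ring.
  transitivity (\sum_k (eV K g b k * cc k c * Ed g a.+1 F u +
    eV K g b k * (\sum_l eV K g c l * cc k l) * (zp (- (dg g * a%:Z)) * Aw g u * Ed g a F u))).
    by apply: eq_bigr => k _; rewrite expand_operator; ring.
  by rewrite big_split /= -!big_distrl /= sum2 mul0r addr0.
transitivity (zp (- (dg g * a%:Z)) * Aw g u * (\sum_l eV K g c l * cc b l + zp (dg g * wt g (val c)) *
    \sum_k eV K g b k * cc k c) * Ed g a F u); first by rewrite /=; ring.
by rewrite sums mulr0 mul0r.
Qed.

Fixpoint nested_cups (d : nat) : vc := if d is d'.+1 then insert_cup d' (nested_cups d') else ev K [::].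

Lemma Ediv_nested_cups g a d w : (0 < a)%N -> size w = d.*2 -> Ed g a (nested_cups d) w = 0.
Proof.
move=> a0; elim: d w => [|d IH] w; first by move/size0nil => -> /=; case: a a0 => // a _; rewrite mul0r.
move=> sw; rewrite [nested_cups _]/= Ediv_insert_cup; last by rewrite sw -addnn; lia.
have -> : insert_cup d (Ed g a (nested_cups d)) w = insert_cup d (0 : vc) w.
  (* An insertion uses F only on words two letters shorter, the length covered by the induction
     hypothesis. *)
  have gen e' (F G : vc) : (forall v, size v = (d.*2 - (d - e'))%N -> F v = G v) -> (e' <= d)%N ->
      forall u, size u = (d.*2 - (d - e')).+2 -> insert_cup e' F u = insert_cup e' G u.
    elim: e' F G => [|e' IH2] F G h he u su.
      by case: u su => [|x [|y u]] //= [su]; rewrite h.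
    case: u su => [|x u] //= [su]; apply: IH2; [|exact: ltnW|].
      by move=> v sv; apply: h; rewrite /= sv; lia.
    by rewrite su; lia.
  by apply: (gen d) => //; rewrite subnn subn0 // => v /IH.
by rewrite (islin0 (@insert_cup_lin d)).
Qed.

Lemma insert_cup_cat h F b a u : insert_cup (size h) F (h ++ b :: a :: u) = (b == prim a)%:R * kapi a * F
    (h ++ u).
Proof. by elim: h F => [|x h IH] F //=; rewrite IH. Qed.

Lemma nested_cups_cat d h t : size h = d -> size t = d ->
  nested_cups d (h ++ t) = (t == map (@prim m) (rev h))%:R * \prod_(b <- h) kapi (prim b).
Proof.
elim: d h t => [|d IH] h t.
  by move=> /size0nil -> /size0nil ->; rewrite /= /ev eqxx big_nil mulr1.
case/lastP: h => // h b; rewrite size_rcons => -[sh]; case: t => // a u [su].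
rewrite cat_rcons -sh [nested_cups _]/= insert_cup_cat sh IH // rev_rcons /= eqseq_cons big_rcons /=.
rewrite -mulnb natrM [a == _]eq_sym eq_prim.
by case: (altP (b =P prim a)) => [->|_]; rewrite ?primK /=; ring.
Qed.

Variable X : Op K m n.

(** X on words read from right to left; a word of length other than n is the reversal of no basis
    tensor and gets 0. *)
Definition act_rev (F : vc) : vc := fun w =>
  if [pick r : TB | rev (sq r) == w] is Some r then \sum_c X r c * F (rev (sq c)) else 0.

Lemma act_rev_letters F (r : TB) : act_rev F (rev (sq r)) = \sum_c X r c * F (rev (sq c)).
Proof.
rewrite /act_rev; case: pickP => [y|/(_ r)]; last by rewrite eqxx.
by rewrite (inj_eq (can_inj (@revK _))) (inj_eq (@letters_inj _ _)) => /eqP ->.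
Qed.

(** Words being reversed, the letters behind the first d are the leftmost tensor factors. *)
Fixpoint act_suffix (d : nat) (F : vc) (w : seq I) : K :=
  if d is d'.+1 then if w is j :: u then act_suffix d' (fun v => F (j :: v)) u else 0 else act_rev F w.

Lemma act_rev_lin : islin act_rev.
Proof.
move=> t F G; apply/funext => w; rewrite vec_addE vec_scaleE /act_rev; case: pickP => [r _|_]; last by
    rewrite mulr0 addr0.
rewrite big_distrr -big_split; apply: eq_bigr => c _ /=.
by rewrite vec_addE vec_scaleE mulrDr mulrCA.
Qed.

Lemma act_suffix_lin d : islin (act_suffix d : vc -> vc).
Proof.
move=> t F G; apply/funext => w; rewrite vec_addE vec_scaleE.
elim: d w F G => [|d IH] w F G /=.
  by rewrite act_rev_lin vec_addE vec_scaleE.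
case: w => [|j u]; first by rewrite mulr0 addr0.
exact: (IH u (fun v => F (j :: v)) (fun v => G (j :: v))).
Qed.

Lemma act_suffix_zero d F w : size w = (d + n)%N -> (forall v, size v = (d + n)%N -> F v = 0) -> act_suffix
    d F w = 0.
Proof.
elim: d w F => [|d IH] w F sw h /=.
  rewrite /act_rev; case: pickP => // r _; apply: big1 => c _; rewrite h ?mulr0 //.
  by rewrite size_rev size_letters.
by case: w sw => [|j u] //= [su]; apply: IH => // v sv; rewrite h //= sv.
Qed.

Hypothesis XE : forall g a F w, size w = n -> Ed g a (act_rev F) w = act_rev (Ed g a F) w.
Hypothesis XA : forall g F w, size w = n -> act_rev (fun v => Aw g v * F v) w = Aw g w * act_rev F w.

Lemma act_suffix_kweight d g F w : size w = (d + n)%N -> act_suffix d (fun v => Aw g v * F v) w = Aw g w *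
    act_suffix d F w.
Proof.
elim: d w F => [|d IH] w F sw /=; first exact: XA.
case: w sw => [|b w] // [sw].
rewrite (_ : (fun v => Aw g (b :: v) * F (b :: v)) = zp (dg g * wt g b) *: ((fun v => Aw g v * F (b :: v))
    : vc)).
  have := @islinZ _ _ _ (zp (dg g * wt g b)) ((fun v => Aw g v * F (b :: v)) : vc) (@act_suffix_lin d).
  move/(congr1 (fun f : vc => f w)) => ->; rewrite vec_scaleE.
  by rewrite (IH w (fun v => F (b :: v))) // kweight_cons // mulrA.
by apply/funext => v; rewrite kweight_cons // -mulrA.
Qed.

Lemma Ediv_act_suffix d g a F w : size w = (d + n)%N -> Ed g a (act_suffix d F) w = act_suffix d (Ed g a F) w.
Proof.
elim: d w a F => [|d IH] w a F sw; first exact: XE.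
case: w sw => [|b w] // [sw].
rewrite Ediv_cons [act_suffix d.+1]lock /= -lock.
rewrite -[RHS]/(act_suffix d (fun v => Ed g a F (b :: v)) w).
rewrite (_ : (fun v => act_suffix d.+1 F (b :: v)) = act_suffix d (fun v => F (b :: v))) // IH //.
case: a => [|a].
  by rewrite addr0; congr (act_suffix d _ w); apply/funext => v; rewrite Ediv_cons addr0.
rewrite (_ : (fun v => Ed g a.+1 F (b :: v)) = (Ed g a.+1 (fun v => F (b :: v)) : vc)
    + zp (- (dg g * a%:Z)) *: ((fun v => Aw g v * (\sum_k eV K g b k *: (Ed g a (fun u => F (k :: u)) :
        vc)) v) : vc)); last first.
  apply/funext => v; rewrite vec_addE vec_scaleE vec_sumE Ediv_cons; congr (_ + _).
  by rewrite -mulrA; congr (_ * (_ * _)).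
rewrite (islinD (@act_suffix_lin d)) vec_addE (islinZ (@act_suffix_lin d)) vec_scaleE; congr (_ + _).
rewrite act_suffix_kweight // -mulrA; congr (_ * (_ * _)).
rewrite (islin_sum (@act_suffix_lin d)) vec_sumE; apply: eq_bigr => k _.
by rewrite (islinZ (@act_suffix_lin d)) vec_scaleE -IH.
Qed.

(* X bent into a vector of V^{(x) 2n}; it is invariant since nested_cups is. *)
Definition coev_vec : vc := act_suffix n (nested_cups n).

Lemma Ediv_coev_vec g a w : (0 < a)%N -> size w = (n + n)%N -> Ed g a coev_vec w = 0.
Proof.
move=> a0 sw; rewrite Ediv_act_suffix //; apply: act_suffix_zero => // v sv.
by apply: Ediv_nested_cups => //; rewrite sv addnn.
Qed.

(** Bending loses nothing: the entry of X at (r, c) reappears up to a unit. *)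
Lemma coev_vec_cat (r c : TB) : coev_vec (map (@prim m) (sq c) ++ rev (sq r)) =
  X r c * \prod_(b <- sq c) kapi b.
Proof.
have XkE d (F : vc) h t : size h = d -> act_suffix d F (h ++ t) = act_rev (fun v => F (h ++ v)) t.
  by elim: d h F => [|d IH] [|x h] F //= [sh]; rewrite (IH h (fun v => F (x :: v))).
have szc : size (map (@prim m) (sq c)) = n by rewrite size_map; exact: size_letters.
have szr (c' : TB) : size (rev (sq c')) = n by rewrite size_rev; exact: size_letters.
rewrite /coev_vec XkE; last exact: szc.
apply: etrans (act_rev_letters (fun v => nested_cups n (map (@prim m) (sq c) ++ v)) r) _.
rewrite (bigD1 c) //= [X in _ + X]big1 ?addr0 => [|c' nc].
  rewrite (nested_cups_cat szc (szr _)) map_rev (mapK (@primK m)) eqxx mul1r; congr (_ * _).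
  by rewrite big_map; apply: eq_bigr => b _; rewrite primK.
rewrite (nested_cups_cat szc (szr _)) map_rev (mapK (@primK m)) (inj_eq (can_inj (@revK _))).
by rewrite (inj_eq (@letters_inj _ _)) (negbTE nc) mul0r mulr0.
Qed.
End Coevaluation.

(** * Powers of the generators and the divided power recursion *)

Section Powers.
Variables (K : comPzRingType) (q qi : K) (m n : nat).
Hypothesis qqi : q * qi = 1.
Local Notation I := 'I_(m.*2).
Local Notation vc := (vec K I).
Local Notation zp := (zpow q qi).
Local Notation TB := (tbasis m n).
Local Notation Ed := (Ediv q qi).
Local Notation Aw := (kweight q qi).
Local Notation sq := (@letters I n).
Implicit Types (g : 'I_m) (F G : vc) (w v : seq I) (j k l : I).

Lemma weight_rev g w : weight g (rev w) = weight g w.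
Proof.
elim: w => [|j w IH]; first by [].
by rewrite rev_cons weight_rcons IH weight_cons addrC.
Qed.

Lemma kweight_prod g w : Aw g w = \prod_(b <- w) zp (dg g * wt g b).
Proof.
elim: w => [|j w IH]; first by rewrite big_nil /kweight weight_nil mulr0.
by rewrite big_cons kweight_cons // IH.
Qed.

(** Coassociativity: peeling off tensor factors from the left or from the right gives the same
    operator. *)
Lemma coprod_act_Ediv g (f : vc) w : coprod_act (eV K g) (fun c : I => zp (dg g * wt g (val c))) f w
  = Ed g 1 (fun v => f (rev v)) (rev w).
Proof.
elim/last_ind: w f => [|w j IH] f; first by rewrite /= mul0r.
rewrite coprod_act_rcons rev_rcons Ediv_cons IH; congr (_ + _).
  by congr (Ed _ _ _ _); apply/funext => v; rewrite rev_cons.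
rewrite mulr0 oppr0 mul1r /kweight weight_rev -/(Aw g w) kweight_prod; congr (_ * _).
by apply: eq_bigr => k _; rewrite Ediv0 rev_cons revK.
Qed.

Lemma DeltaE_Ediv g F (r : TB) :
  \sum_c DeltaE q qi g r c * F (rev (sq c)) = Ed g 1 F (rev (sq r)).
Proof.
have [n0|n0] := posnP n.
  have z0 (c : TB) : sq c = [::] by apply: size0nil; rewrite size_letters.
  rewrite z0 /= mul0r; apply: big1 => c _; rewrite /DeltaE big1 ?mul0r // => i _.
  by have := ltn_ord i; rewrite [X in (_ < X)%N]n0.
apply: etrans (@DeltaE_coprod_act K q qi m n (r (Ordinal n0)) g (fun v => F (rev v)) r) _.
by rewrite coprod_act_Ediv; congr (Ed _ _ _ _); apply/funext => v; rewrite revK.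
Qed.

Lemma Ediv1_kweight g F w : Ed g 1 (fun v => Aw g v * F v) w = zp (- (dg g * 2)) * Aw g w * Ed g 1 F w.
Proof.
elim: w F => [|j w IH] F; first by rewrite /= !mul0r mulr0.
rewrite !Ediv_cons mulr0 oppr0 !mul1r mulrDr; congr (_ + _).
  transitivity (zp (dg g * wt g j) * Ed g 1 (fun v => Aw g v * F (j :: v)) w).
    rewrite -Ediv_scale; congr (Ed _ _ _ _); apply/funext => v.
    by rewrite kweight_cons // mulrA.
  by rewrite (IH (fun v => F (j :: v))) kweight_cons // ; ring.
rewrite !big_distrr; apply: eq_bigr => k _ /=; rewrite !Ediv0.
have [->|h] := eqVneq (eV K g j k) 0; first by rewrite !(mul0r, mulr0).
have [wj wk] := eV_wt h; rewrite !kweight_cons // wj wk mulr1 mulrN mulr1.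
have -> : - (dg g * 2) = - dg g - dg g by ring.
have e1 := zpowN qqi (dg g); rewrite zpowD // /=; ring: e1.
Qed.

(** This stands for [a]_g, described by its recursion and not as a quotient so that it makes sense
    over K; over Q(q) it becomes [qnum]. *)
Variable nn : 'I_m -> nat -> K.
Hypothesis nn0 : forall g, nn g 0 = 0.
Hypothesis nnS : forall g a, nn g a.+1 = zp (dg g * a%:Z) + zp (- dg g) * nn g a.

(** The relation e e^{(a)} = [a+1] e^{(a+1)}, by which the recursion [Ediv] is recognized as the
    divided power. *)
Lemma Ediv1_Ediv g a F w : Ed g 1 (Ed g a F) w = nn g a.+1 * Ed g a.+1 F w.
Proof.
elim: w a F => [|j w IH] a F; first by rewrite /= !mul0r mulr0.
case: a => [|a].
  have -> : nn g 1 = 1 by rewrite nnS nn0 !mulr0 addr0.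
  rewrite mul1r; apply: Ediv_ext => v _.
  exact: Ediv0.
rewrite Ediv_cons [in RHS]Ediv_cons.
rewrite (_ : (fun v => Ed g a.+1 F (j :: v)) = (Ed g a.+1 (fun v => F (j :: v)) : vc)
    + zp (- (dg g * a%:Z)) *: ((fun v => Aw g v * (\sum_k eV K g j k *: (Ed g a (fun u => F (k :: u)) :
        vc)) v) : vc)); last first.
  apply/funext => v; rewrite vec_addE vec_scaleE vec_sumE Ediv_cons; congr (_ + _).
  by rewrite -mulrA; congr (_ * (_ * _)).
rewrite (islinD (@Ediv_lin K q qi m g 1)) vec_addE (islinZ (@Ediv_lin K q qi m g 1)) vec_scaleE IH
    Ediv1_kweight.
rewrite (islin_sum (@Ediv_lin K q qi m g 1)) vec_sumE.
rewrite (eq_bigr (fun k => nn g a.+1 * (eV K g j k * Ed g a.+1 (fun v => F (k :: v)) w))); last first.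
  move=> k _; rewrite (islinZ (@Ediv_lin K q qi m g 1)) vec_scaleE IH; ring.
rewrite -big_distrr /=.
rewrite [X in _ + _ * X](eq_bigr (fun k => eV K g j k * Ed g a.+1 (fun v => F (k :: v)) w)); last first.
  move=> k _; transitivity (eV K g j k * Ed g a.+1 F (k :: w)); first by rewrite Ediv0.
  have [->|h] := eqVneq (eV K g j k) 0; first by rewrite !mul0r.
  have [wj wk] := eV_wt h; rewrite Ediv_low // wk //.
have e1 : zp (- (dg g * a%:Z)) * zp (- (dg g * 2)) * nn g a.+1 + 1 = nn g a.+2 * zp (- (dg g * a.+1%:Z)).
  rewrite (nnS g a.+1) mulrDl zpowN // addrC; congr (_ + _).
  by rewrite [RHS]mulrAC -!zpowD //; congr (zp _ * _); lia.
move: (\sum_k _) => S; rewrite mulr0 oppr0 [zp 0]/= expr0 mul1r.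
rewrite [RHS]mulrDr -addrA; congr (_ + _).
transitivity ((zp (- (dg g * a%:Z)) * zp (- (dg g * 2)) * nn g a.+1 + 1) * (Aw g w * S)); first by ring.
by rewrite e1; ring.
Qed.

Definition EdivOp g (a : nat) : Op K m n := fun r c => Ed g a (ev K (rev (sq c))) (rev (sq r)).

Lemma oppow_EdivOp g a (r c : TB) : oppow (@DeltaE K q qi m n g) a r c = (\prod_(k < a) nn g k.+1) * EdivOp
    g a r c.
Proof.
elim: a r c => [|a IH] r c.
  rewrite big_ord0 mul1r /= /opone /EdivOp Ediv0 /ev (inj_eq (can_inj (@revK _))).
  by rewrite (inj_eq (@letters_inj _ _)).
transitivity (\sum_k DeltaE q qi g r k * oppow (@DeltaE K q qi m n g) a k c) => //.
transitivity ((\prod_(k < a) nn g k.+1) * \sum_k DeltaE q qi g r k * Ed g a (ev K (rev (sq c))) (rev (sq k))).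
  by rewrite big_distrr; apply: eq_bigr => k _; rewrite IH mulrCA.
by rewrite DeltaE_Ediv Ediv1_Ediv big_ord_recr /= mulrA.
Qed.

Lemma DeltaE_EdivOp g (r c : TB) : DeltaE q qi g r c = EdivOp g 1 r c.
Proof.
rewrite /EdivOp -DeltaE_Ediv (bigD1 c) //= /ev eqxx mulr1 big1 ?addr0 // => k nk.
by rewrite (inj_eq (can_inj (@revK _))) (inj_eq (@letters_inj _ _)) (negbTE nk) mulr0.
Qed.

Local Notation kdiag := (@kdiag K q qi m n).

Lemma kdiag_prod g (c : TB) : kdiag g c = \prod_(b <- sq c) zp (- dg g * wt g b).
Proof. by rewrite /kdiag /sq big_map big_enum. Qed.

Lemma kdiag_kweight g (c : TB) : kdiag g c * Aw g (rev (sq c)) = 1.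
Proof.
rewrite kdiag_prod /kweight weight_rev -/(Aw g (sq c)) kweight_prod -big_split big1 // => b _ /=.
by rewrite mulrC mulNr zpowN.
Qed.

Lemma DeltaE_kdiag g (c k : TB) : DeltaE q qi g c k * kdiag g k = zp (dg g * 2) * kdiag g c * DeltaE q qi g c k.
Proof.
have h : Aw g (rev (sq k)) * DeltaE q qi g c k = zp (- (dg g * 2)) * Aw g (rev (sq c)) * DeltaE q qi g c k.
  rewrite DeltaE_EdivOp /EdivOp -Ediv1_kweight -Ediv_scale; apply: Ediv_ext => v _ /=.
  by rewrite /ev; case: eqP => [->|_]; rewrite ?mulr0.
have e1 := kdiag_kweight g k; have e2 := kdiag_kweight g c; have e3 := zpowN qqi (dg g * 2).
transitivity (zp (dg g * 2) * zp (- (dg g * 2)) * (kdiag g c * Aw g (rev (sq c))) * (DeltaE q qi g c k *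
    kdiag g k)).
  by rewrite e3 e2 !mul1r.
transitivity (zp (dg g * 2) * kdiag g c * kdiag g k * (zp (- (dg g * 2)) * Aw g (rev (sq c)) * DeltaE q qi
    g c k)).
  by ring.
rewrite -h; ring: e1.
Qed.

Lemma pow_kdiag g a (c k : TB) : oppow (@DeltaE K q qi m n g) a c k * kdiag g k
  = zp (dg g * 2 * a%:Z) * kdiag g c * oppow (@DeltaE K q qi m n g) a c k.
Proof.
elim: a c k => [|a IH] c k.
  rewrite /= /opone; case: eqP => [->|_]; last by rewrite mul0r mulr0.
  by rewrite mulr0 /= expr0 mulr1 !mul1r.
transitivity (\sum_l DeltaE q qi g c l * (oppow (@DeltaE K q qi m n g) a l k * kdiag g k)).
  rewrite -[oppow _ a.+1 c k]/(\sum_l DeltaE q qi g c l * oppow (@DeltaE K q qi m n g) a l k).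
  by rewrite [LHS]big_distrl; apply: eq_bigr => l _; rewrite mulrA.
have -> : dg g * 2 * a.+1%:Z = dg g * 2 * a%:Z + dg g * 2 by lia.
rewrite zpowD // -[oppow _ a.+1 c k]/(\sum_l DeltaE q qi g c l * oppow (@DeltaE K q qi m n g) a l k) big_distrr.
apply: eq_bigr => l _; rewrite IH /=.
transitivity (zp (dg g * 2 * a%:Z) * (DeltaE q qi g c l * kdiag g l) * oppow (@DeltaE K q qi m n g) a l k);
    first by ring.
by rewrite DeltaE_kdiag; ring.
Qed.

(** Write f_g as q_g times the transpose of e_g times k~_g^{-1}. Collecting the factors k~_g^{-1}
    costs q_g^{2j} at the j-th multiplication, j counted from 0, and a + 2(0 + ... + (a-1)) =
    a^2. *)
Lemma oppow_F g a (r c : TB) : oppow (@DeltaF K q qi m n g) a r c =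
  zp (dg g * (a * a)%:Z) * oppow (@DeltaE K q qi m n g) a c r * kdiag g c ^+ a.
Proof.
elim: a r c => [|a IH] r c.
  by rewrite /= /opone mulr0 /= expr0 !mulr1 mul1r eq_sym.
transitivity (\sum_k DeltaF q qi g r k * oppow (@DeltaF K q qi m n g) a k c) => //.
have comm : opmul (@DeltaE K q qi m n g) (oppow (@DeltaE K q qi m n g) a) c r =
    opmul (oppow (@DeltaE K q qi m n g) a) (@DeltaE K q qi m n g) c r.
  by symmetry; apply: opcomm_pow.
rewrite -[oppow _ a.+1 c r]/(opmul (@DeltaE K q qi m n g) (oppow (@DeltaE K q qi m n g) a) c r) comm.
rewrite /opmul big_distrr big_distrl; apply: eq_bigr => k _ /=.
rewrite DeltaF_E // IH.
transitivity (zp (dg g) * zp (dg g * (a * a)%:Z) * DeltaE q qi g k r * kdiag g c ^+ a *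
   (oppow (@DeltaE K q qi m n g) a c k * kdiag g k)); first by ring.
rewrite pow_kdiag exprSr.
have -> : dg g * (a.+1 * a.+1)%:Z = dg g + dg g * (a * a)%:Z + dg g * 2 * a%:Z by lia.
by rewrite !zpowD //; ring.
Qed.
End Powers.

(** * Integrality of the divided powers *)

Section SpecDivided.
Variables (K : comPzRingType) (z zi : K) (m n : nat).
Hypothesis zzi : z * zi = 1.
Local Notation sp := (spec z zi).
Local Notation TB := (tbasis m n).
Local Notation EdF := (@Ediv Fq qF qF^-1 m).
Local Notation GEF := (@EdivOp Fq qF qF^-1 m n).
Local Notation GEK := (@EdivOp K z zi m n).

Lemma spec_eV (g : 'I_m) j k : sp (eV Fq g j k) (eV K g j k).
Proof. by rewrite /eV; case: ifP => _; [apply: specB => //|]; exact: spec_bool. Qed.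

Lemma spec_Ediv (g : 'I_m) a F G w : (forall v, sp (F v) (G v)) -> sp (EdF g a F w) (@Ediv K z zi m g a G w).
Proof.
elim: w a F G => [|j w IH] a F G h /=; first by apply: specM => //; exact: spec_bool.
apply: specD => //; first exact: (IH a (fun v => F (j :: v))).
case: a => [|a]; first exact: spec0.
apply: specM => //; first by apply: specM => //; exact: spec_zpow.
apply: spec_sum => // k _; apply: specM => //; first exact: spec_eV.
exact: (IH a (fun v => F (k :: v))).
Qed.

Lemma qF_gap d : (0 < d)%N -> qF ^+ d - qF ^- d != 0.
Proof.
move=> d0; rewrite subr_eq0; apply/eqP => h.
have : qF ^+ d * qF ^+ d = 1 by rewrite {2}h mulfV // expf_neq0 // qF0.
rewrite -exprD -tofracXn -(rmorph1 (@FracField.tofrac _)) => /eqP; rewrite tofrac_eq => /eqP.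
move/(congr1 (fun p : {poly int} => size p)); rewrite size_polyXn size_poly1 => -[]; lia.
Qed.

Lemma qg_E (g : 'I_m) : zpow qF qF^-1 (dg g) = qF ^+ `|dg g|%N /\ (0 < `|dg g|)%N.
Proof. by rewrite /dg; case: ifP. Qed.

Lemma qnum0 (g : 'I_m) : qnum g 0 = 0.
Proof. by rewrite /qnum !expr0 invr1 subrr mul0r. Qed.

Lemma zpowM a (b : nat) : zpow qF qF^-1 (a * b%:Z) = zpow qF qF^-1 a ^+ b.
Proof.
elim: b => [|b IH]; first by rewrite mulr0 /= !expr0.
have -> : a * b.+1%:Z = a * b%:Z + a by lia.
by rewrite zpowD ?qFqi // IH exprSr.
Qed.

Lemma zpowNV a : zpow qF qF^-1 (- a) = (zpow qF qF^-1 a)^-1.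
Proof.
have h := zpowN qFqi a.
have n0 : zpow qF qF^-1 a != 0 by apply/eqP => e; move: h; rewrite e mul0r => /eqP; rewrite eq_sym oner_eq0.
by rewrite -[LHS](mulKf n0) h mulr1.
Qed.

Lemma qnumS (g : 'I_m) a : qnum g a.+1 = zpow qF qF^-1 (dg g * a%:Z) + zpow qF qF^-1 (- dg g) * qnum g a.
Proof.
rewrite zpowM zpowNV /qnum; have [e d0] := qg_E g.
have x0 : zpow qF qF^-1 (dg g) != 0 by rewrite e expf_neq0 // qF0.
have xx : zpow qF qF^-1 (dg g) - (zpow qF qF^-1 (dg g))^-1 != 0 by rewrite e; exact: qF_gap.
move: (zpow _ _ _) x0 xx => x x0 xx.
apply: (mulIf xx); rewrite divfK // mulrDl -mulrA divfK // !exprS invfM.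
move: (x ^+ a) (expf_neq0 a x0) => y y0.
rewrite mulrBr mulrBr [y * x]mulrC [y * _]mulrC; ring.
Qed.

Lemma qfact_neq0 (g : 'I_m) a : qfact g a != 0.
Proof.
rewrite /qfact; apply/prodf_neq0 => k _; rewrite /qnum; have [e d0] := qg_E g.
rewrite mulf_neq0 ?invr_neq0 // e; last exact: qF_gap.
by rewrite -exprM; apply: qF_gap; rewrite muln_gt0 d0.
Qed.

(** Over Q(q) the factor [a]! of [oppow_EdivOp] cancels. What remains is a recursion with
    coefficients in Z[q,q^{-1}], so it specializes to K. *)
Lemma EdivF_EdivOp g a r c : @EdivF m n g a r c = GEF g a r c.
Proof.
rewrite /EdivF (oppow_EdivOp qFqi qnum0 qnumS) mulKf //; exact: qfact_neq0.
Qed.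

Lemma specOp_EdivF g a : specOp z zi (@EdivF m n g a) (GEK g a).
Proof.
move=> r c; rewrite EdivF_EdivOp; apply: spec_Ediv => v; exact: spec_bool.
Qed.

(** The shape of [oppow_F] with [a]! removed, so that f_g^{(a)} needs no recursion of its own. *)
Definition FdivOp g a : Op K m n := fun r c =>
  zpow z zi (dg g * (a * a)%:Z) * GEK g a c r * (@kdiag K z zi m n g c) ^+ a.

Lemma specOp_FdivF g a : specOp z zi (@FdivF m n g a) (FdivOp g a).
Proof.
move=> r c; rewrite /FdivF (oppow_F qFqi) mulrCA mulrA -/(EdivF g a c r).
rewrite [X in spec _ _ X _](_ : _ = zpow qF qF^-1 (dg g * (a * a)%:Z) * EdivF g a c r * (@kdiag Fq qF qF^-1
    m n g c) ^+ a); last first.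
  by rewrite /EdivF; move: (oppow _ _ _ _) ((qfact g a)^-1) (zpow _ _ _) (kdiag _ _ _ _) => A B C D; ring.
apply: specM => //; first by apply: specM => //; [exact: spec_zpow | exact: specOp_EdivF].
by apply: specX => //; apply: spec_prod => // l _; exact: spec_zpow.
Qed.
End SpecDivided.

(** * Weights of an endomorphism and descent on its leading pair *)

Section Converse.
Variables (K : comPzRingType) (z zi : K) (m n : nat).
Hypotheses (zzi : z * zi = 1) (m0 : (0 < m)%N).
Local Notation I := 'I_(m.*2).
Local Notation vc := (vec K I).
Local Notation zp := (zpow z zi).
Local Notation TB := (tbasis m n).
Local Notation Ed := (Ediv z zi).
Local Notation Aw := (kweight z zi).
Local Notation sq := (@letters I n).
Local Notation GEK := (@EdivOp K z zi m n).
Local Notation endo := (@in_EndU K z zi m n).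
Implicit Types (g : 'I_m) (F G : vc) (X : Op K m n).

(* Transposing exchanges the e_g^{(a)} and, up to diagonal factors, the f_g^{(a)}, so
   statements proved from the e_g alone apply to X and to its transpose. *)
Definition optr X : Op K m n := fun r c => X c r.

Definition wt_scale X := forall g, scale_comm (fun a : I => zp (dg g * wt g (val a))) X.

Lemma endo_E X g a : endo X -> opcomm X (GEK g a).
Proof. by move=> h; have [h1 _] := h g a; apply: h1; exact: specOp_EdivF. Qed.

Lemma endo_scale X : endo X -> wt_scale X.
Proof.
move=> h g; have [_ [_ [h3 _]]] := h g 0%N.
have h1 : scale_comm (fun a : I => zp (1 * wt g (val a))) X.
  apply/dgop_comm => r c.
  transitivity (opmul X (@DeltaK K z zi m n g 1) r c); first by apply: eq_bigr => k _; rewrite DeltaK_dgop.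
  by rewrite h3; apply: eq_bigr => k _; rewrite DeltaK_dgop.
(* For the long root k~ is the square of k, so the relation for k is applied twice. *)
rewrite /dg; case: ifP => _ //.
move=> r c; have h2 := h1 r c.
have sqr (x : TB) : \prod_(l < n) zp (2 * wt g (val (x l))) = (\prod_(l < n) zp (1 * wt g (val (x l)))) *
    (\prod_(l < n) zp (1 * wt g (val (x l)))).
  by rewrite -big_split; apply: eq_bigr => l _ /=; rewrite -(zpowD zzi); congr zp; lia.
by rewrite !sqr mulrA h2 -mulrA h2 mulrA.
Qed.

Lemma wt_scale_kdiag X g r c : wt_scale X -> X r c * (@kdiag K z zi m n g c) = (@kdiag K z zi m n g r) * X r c.
Proof.
move=> h; have := h g r c.
have e1 (x : TB) : (\prod_(l < n) zp (dg g * wt g (val (x l)))) * @kdiag K z zi m n g x = 1.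
  by rewrite /kdiag -big_split big1 // => l _ /=; rewrite mulNr zpowN.
move=> hX; have er := e1 r; have ec := e1 c.
transitivity ((\prod_(l < n) zp (dg g * wt g (val (r l)))) * @kdiag K z zi m n g r * (X r c * @kdiag K z zi
    m n g c)).
  by rewrite er mul1r.
transitivity (@kdiag K z zi m n g r * @kdiag K z zi m n g c * ((\prod_(l < n) zp (dg g * wt g (val (r l))))
    * X r c)); first by ring.
rewrite -hX; ring: ec.
Qed.

(** Transposing the relation with f_g^{(a)} gives one with e_g^{(a)} and diagonal factors, which
    pass through X by [wt_scale] and cancel. *)
Lemma endo_optr_E X g a : endo X -> opcomm (optr X) (GEK g a).
Proof.
move=> h r c; have [_ [h2 _]] := h g a.
have hF : opcomm X (@FdivOp K z zi m n g a) by apply: h2; exact: specOp_FdivF.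
have hs := endo_scale h.
have kdX r' c' : X r' c' * (@kdiag K z zi m n g c') ^+ a = (@kdiag K z zi m n g r') ^+ a * X r' c'.
  elim: a {h2 hF} => [|a IH]; first by rewrite !expr0 mulr1 mul1r.
  rewrite !exprS mulrA (wt_scale_kdiag g r' c' hs) -mulrA IH; ring.
have e1 (x : TB) : (\prod_(l < n) zp (dg g * wt g (val (x l)))) ^+ a * @kdiag K z zi m n g x ^+ a = 1.
  rewrite -exprMn (_ : _ * _ = 1) ?expr1n //.
  by rewrite /kdiag -big_split big1 // => l _ /=; rewrite mulNr zpowN.
have e2 := zpowN zzi (dg g * (a * a)%:Z).
have hh := hF c r; rewrite /opmul in hh *.
transitivity (zp (- (dg g * (a * a)%:Z)) * (\prod_(l < n) zp (dg g * wt g (val (r l)))) ^+ a *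
   \sum_k @FdivOp K z zi m n g a c k * X k r).
  rewrite big_distrr; apply: eq_bigr => k _ /=; rewrite /optr /FdivOp.
  transitivity (zp (- (dg g * (a * a)%:Z)) * (\prod_(l < n) zp (dg g * wt g (val (r l)))) ^+ a *
    (zp (dg g * (a * a)%:Z) * GEK g a k c * (X k r * kdiag z zi g r ^+ a))); last first.
    by rewrite kdX; ring.
  have := e1 r => e1r; ring: e1r e2.
rewrite -hh big_distrr; apply: eq_bigr => k _ /=; rewrite /optr /FdivOp.
have := e1 r => e1r; ring: e1r e2.
Qed.

Lemma endo_act_rev_Ediv X : (forall g a, opcomm X (GEK g a)) ->
  forall g a F w, size w = n -> Ed g a (act_rev X F) w = act_rev X (Ed g a F) w.
Proof.
move=> h g a F w sw.
have [r hr] : exists r : TB, w = rev (sq r).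
  have [r hr] := letters_surj (n := n) (w := rev w) (etrans (size_rev w) sw).
  by exists r; rewrite -hr revK.
have EdE G (x : TB) : Ed g a G (rev (sq x)) = \sum_c GEK g a x c * G (rev (sq c)).
  rewrite (@Ediv_ext _ _ _ _ _ _ G (\sum_(c : TB) G (rev (sq c)) *: ev K (rev (sq c)))); last first.
    move=> v; rewrite size_rev size_letters => sv.
    have [y hy] := letters_surj (n := n) (w := rev v) (etrans (size_rev v) sv).
    rewrite -[v]revK hy vec_sumE (bigD1 y) //= big1 ?addr0 => [|c nc].
      by rewrite vec_scaleE /ev eqxx mulr1.
    rewrite vec_scaleE /ev (inj_eq (can_inj (@revK _))) (inj_eq (@letters_inj _ _)) eq_sym (negbTE nc).
    by rewrite mulr0.
  rewrite (islin_sum (@Ediv_lin K z zi m g a)) vec_sumE; apply: eq_bigr => c _.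
  by rewrite (islinZ (@Ediv_lin K z zi m g a)) vec_scaleE mulrC.
rewrite hr EdE act_rev_letters.
transitivity (\sum_c opmul (GEK g a) X r c * F (rev (sq c))).
  under eq_bigr => c _ do rewrite act_rev_letters big_distrr.
  rewrite exchange_big; apply: eq_bigr => c _ /=; rewrite /opmul big_distrl.
  by apply: eq_bigr => k _ /=; rewrite mulrA.
under eq_bigr => c _ do rewrite -h.
under [RHS]eq_bigr => c _ do rewrite EdE big_distrr.
rewrite [RHS]exchange_big; apply: eq_bigr => c _ /=; rewrite /opmul big_distrl.
by apply: eq_bigr => k _ /=; rewrite mulrA.
Qed.

Lemma kweight_letters g (x : TB) : Aw g (rev (sq x)) = \prod_(l < n) zp (dg g * wt g (val (x l))).
Proof.
by rewrite /kweight weight_rev -/(Aw g (sq x)) kweight_prod // /letters big_map big_enum.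
Qed.

Lemma endo_act_rev_kweight X : wt_scale X ->
  forall g F w, size w = n -> act_rev X (fun v => Aw g v * F v) w = Aw g w * act_rev X F w.
Proof.
move=> h g F w sw.
have [r hr] : exists r : TB, w = rev (sq r).
  have [r hr] := letters_surj (n := n) (w := rev w) (etrans (size_rev w) sw).
  by exists r; rewrite -hr revK.
rewrite hr !act_rev_letters big_distrr; apply: eq_bigr => c _ /=.
by rewrite !kweight_letters mulrA h mulrA.
Qed.

Lemma kappai_unit (s : seq I) : exists u, u * \prod_(b <- s) kappai z zi b = 1.
Proof.
exists (\prod_(b <- s) kappa z zi b); rewrite -big_split big1 // => b _ /=.
exact: kappa_kappai.
Qed.

Lemma weight_cat g (u v : seq I) : weight g (u ++ v) = weight g u + weight g v.
Proof. by rewrite /weight big_cat. Qed.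

Lemma weight_prim g (u : seq I) : weight g (map (@prim m) u) = - weight g u.
Proof.
elim: u => [|j u IH] /=; first by rewrite !weight_nil oppr0.
by rewrite !weight_cons wt_prim IH opprD.
Qed.

(** Commuting with k_g only equates powers of z, which do not separate weights when z is a root of
    unity. But the bent word has weight wt r - wt c, and [sl2_weight_vanish] excludes negative
    values; the opposite bound comes from the transpose of X. *)
Lemma wt_ge X : (forall g a, opcomm X (GEK g a)) -> wt_scale X ->
  forall g (r c : TB), X r c != 0 -> weight g (sq c) <= weight g (sq r).
Proof.
move=> hE hs g r c hX; rewrite -subr_ge0 leNgt; apply/negP => hneg.
have [u hu] := kappai_unit (sq c).
case/eqP: hX; rewrite -[X r c]mulr1 -hu [u * _]mulrC mulrA -(coev_vec_cat z zi X r c).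
rewrite (@sl2_weight_vanish K z zi m zzi g (n + n) (weight g (map (@prim m) (sq c) ++ rev (sq r))) 1%N
    (coev_vec z zi X)) ?mul0r //.
- by move=> a w a0 sw _; apply: (Ediv_coev_vec zzi (endo_act_rev_Ediv hE) (endo_act_rev_kweight hs)).
- rewrite weight_cat weight_prim weight_rev; lia.
by rewrite size_cat size_map size_rev !size_letters.
Qed.

Lemma optr_scale X : wt_scale X -> wt_scale (optr X).
Proof.
move=> h g r c; rewrite /optr.
have e1 (x : TB) : (\prod_(l < n) zp (dg g * wt g (val (x l)))) * @kdiag K z zi m n g x = 1.
  by rewrite /kdiag -big_split big1 // => l _ /=; rewrite mulNr zpowN.
have hX := wt_scale_kdiag g c r h.
have er := e1 r; have ec := e1 c.
transitivity ((\prod_(l < n) zp (dg g * wt g (val (r l)))) * (\prod_(l < n) zp (dg g * wt g (val (c l)))) *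
    (@kdiag K z zi m n g r * X c r) ).
  by ring: er.
rewrite [@kdiag _ _ _ _ _ _ _ * _]mulrC hX; ring: ec.
Qed.

Lemma endo_wt X g (r c : TB) : endo X -> X r c != 0 -> weight g (sq r) = weight g (sq c).
Proof.
move=> h hX; apply/eqP; rewrite eq_le; apply/andP; split; last first.
  apply: wt_ge hX => [g' a|]; [exact: endo_E | exact: endo_scale].
apply: (@wt_ge (optr X)) => //; first by move=> g' a; exact: endo_optr_E.
exact/optr_scale/endo_scale.
Qed.

Lemma code_cat (u v : seq I) : code (u ++ v) = (code u * m.*2 ^ size v + code v)%N.
Proof.
elim: u => [|a u IH] //=; by rewrite IH size_cat expnD mulnDl mulnA addnA.
Qed.

(** Priming complements every digit in base 2m, so it reverses the lexicographic order. *)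
Lemma code_prim (u : seq I) : (code (map (@prim m) u) + code u = m.*2 ^ size u - 1)%N.
Proof.
elim: u => [|a u IH] //=; rewrite size_map expnS.
have h1 := ltn_ord a; have h2 : (0 < m.*2 ^ size u)%N by rewrite expn_gt0 double_gt0 m0.
move: IH h2 h1; move: (m.*2 ^ size u)%N (code (map _ u)) (code u) (nat_of_ord a) => P A B k; move: (m.*2)
    => N IH h2 h1.
have e : (N = (N - k.+1) + k + 1)%N by lia.
rewrite [in RHS]e !mulnDl mul1n; move: ((N - k.+1) * P)%N (k * P)%N => U V; lia.
Qed.

Lemma endo_lc k X Y : endo X -> endo Y -> endo (fun r c => X r c + k * Y r c).
Proof.
have lc (A B C : Op K m n) : opcomm A C -> opcomm B C -> opcomm (fun r c => A r c + k * B r c) C.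
  move=> hA hB r c; transitivity (opmul A C r c + k * opmul B C r c).
    by rewrite /opmul big_distrr -big_split; apply: eq_bigr => t _ /=; rewrite mulrDl mulrA.
  rewrite hA hB /opmul big_distrr -big_split; apply: eq_bigr => t _ /=.
  by rewrite mulrDr [in RHS]mulrCA.
move=> hX hY g a; have [h1 [h2 [h3 h4]]] := hX g a; have [k1 [k2 [k3 k4]]] := hY g a.
split; first by move=> G hG; apply: lc; [exact: h1 | exact: k1].
split; first by move=> G hG; apply: lc; [exact: h2 | exact: k2].
by split; apply: lc.
Qed.

(** Suffixes of the reversed r are prefixes of r. A suffix that starts within the primed c has
    weight wt r minus that of a suffix of c, which is the weight of a prefix of c because wt r = wt
    c. *)
Lemma leading_dominant X (r c : TB) : endo X -> X r c != 0 ->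
  (forall r' c' : TB, (code (map (@prim m) (sq c) ++ rev (sq r)) < code (map (@prim m) (sq c') ++ rev (sq
      r')))%N -> X r' c' = 0) ->
  dominant (sq r) /\ dominant (sq c).
Proof.
move=> hX Xrc hgt; have hw0 g := endo_wt g hX Xrc.
have tails : forall p g, 0 <= weight g (drop p (map (@prim m) (sq c) ++ rev (sq r))).
  apply: (@leading_suffix_weights K z zi m zzi (n + n) (coev_vec z zi X)).
  - move=> g a v a0 sv; apply: (Ediv_coev_vec zzi (endo_act_rev_Ediv _) (endo_act_rev_kweight _)) => //;
      first by move=> g' a'; exact: endo_E.
    exact: endo_scale.
  - by rewrite size_cat size_map size_rev !size_letters.
  - rewrite coev_vec_cat; apply: contraNneq Xrc => h; have [u hu] := kappai_unit (sq c).
    by rewrite -[X r c]mulr1 -hu [u * _]mulrC mulrA h mul0r.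
  move=> v sv hc.
  have [c' hc'] : exists c' : TB, map (@prim m) (take n v) = sq c'.
    by apply: letters_surj; rewrite size_map size_takel // sv leq_addr.
  have [r' hr'] : exists r' : TB, rev (drop n v) = sq r'.
    by apply: letters_surj; rewrite size_rev size_drop sv addnK.
  have ev : v = map (@prim m) (sq c') ++ rev (sq r').
    by rewrite -hc' -hr' revK (mapK (@primK m)) cat_take_drop.
  by rewrite ev coev_vec_cat hgt ?mul0r // -ev.
split=> p g.
  have [hp|hp] := leqP p n; last first.
    rewrite take_oversize ?size_letters ?(ltnW hp) //.
    by have := tails n g; rewrite drop_size_cat ?weight_rev // size_map size_letters.
  have := tails (n + (n - p))%N g.
  rewrite addnC -drop_drop drop_size_cat; last by rewrite size_map size_letters.
  by rewrite -[weight g (take p _)]weight_rev drop_rev size_letters subKn.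
have [hp|hp] := leqP p n; last first.
  rewrite take_oversize ?size_letters ?(ltnW hp) // -hw0.
  by have := tails n g; rewrite drop_size_cat ?weight_rev // size_map size_letters.
have := tails p g; rewrite drop_cat size_map size_letters; case: ltngtP hp => // hp _.
  rewrite weight_cat -map_drop weight_prim weight_rev hw0; have := weight_cat g (take p (sq c)) (drop p (sq
      c)); by rewrite cat_take_drop => ->; rewrite addrCA addNr addr0.
by rewrite hp subnn drop0 weight_rev hw0 take_oversize // size_letters.
Qed.

(** Induction on a bound for the codes of the nonzero pairs. The difference stays an endomorphism
    because the operator subtracted lies in the image, so [phi_EndU] applies to it. *)
Lemma endo_phi X : endo X -> in_phiC z zi X.
Proof.
pose cd (r c : TB) := code (map (@prim m) (sq c) ++ rev (sq r)).
have [bd hbd] : exists bd, forall r c, (cd r c < bd)%N.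
  exists (m.*2 ^ (n + n))%N => r c; have := code_lt (map (@prim m) (sq c) ++ rev (sq r)).
  by rewrite size_cat size_map size_rev !size_letters.
have : forall r c, (bd <= cd r c)%N -> X r c = 0.
  by move=> r c; rewrite leqNgt hbd.
elim: bd X {hbd} => [|bd IH] X hX eX.
  apply: phi_eq (@phi_zero K z zi m n) => r c; by rewrite hX.
have [/existsP [r /existsP [c /andP [/eqP hcd Xrc]]]|hno] :=
  boolP [exists r : TB, [exists c : TB, (cd r c == bd) && (X r c != 0)]]; last first.
  apply: IH => // r c; rewrite leq_eqVlt => /orP [/eqP e|]; last exact: hX.
  apply/eqP; apply: contraR hno => h; apply/existsP; exists r; apply/existsP; exists c.
  by rewrite -e eqxx.
have [dr dc] : dominant (sq r) /\ dominant (sq c).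
  by apply: (leading_dominant eX Xrc) => r' c' h; apply: hX; rewrite -hcd.
have szr (x : TB) : size (sq x) = n by exact: size_letters.
have sL : (size (sq r) <= n)%N by rewrite szr.
have src : size (sq r) = size (sq c) by rewrite !szr.
have hwrc g : weight g (sq r) = weight g (sq c) by exact: endo_wt eX Xrc.
have [B aB [u [ui [x [hu hx hB hBv]]]]] := leading_operator zzi m0 dr dc src sL hwrc.
rewrite szr in aB hx hB hBv.
have [Y pY hY] := alg_phi aB.
have evn (v : seq I) : size v = n -> tn n (ev K v) (ev K [::]) = ev K v.
  by move=> sv; rewrite -{1}sv tn_ev cats0.
have YE (r' c' : TB) : Y r' c' = B (ev K (sq c')) (sq r').
  rewrite hY (bigD1 c') //= /ev eqxx mulr1 big1 ?addr0 // => k nk.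
  by rewrite (inj_eq (@letters_inj _ _)) (negbTE nk) mulr0.
have Y0 (r' c' : TB) : (code (sq c') < code (sq c))%N -> Y r' c' = 0.
  by move=> h; rewrite YE -evn ?szr // hBv ?szr.
have Yc (r' : TB) : Y r' c = u * (r' == r)%:R + x (sq r').
  rewrite YE -evn ?szr // hB /tn take_oversize ?szr // drop_oversize ?szr //.
  by rewrite vec_addE vec_scaleE /ev eqxx mulr1 (inj_eq (@letters_inj _ _)).
have Yrc : Y r c = u by rewrite Yc eqxx mulr1 hx ?szr ?ltnn // addr0.
have eY : endo Y by exact: phi_EndU.
(* The entry of Y at (r, c) is the unit u with inverse ui, so this multiple of Y clears that entry
   of X. *)
pose X' : Op K m n := fun r' c' => X r' c' + (- (X r c * ui)) * Y r' c'.
have pX' : in_phiC z zi X'.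
  apply: IH; last exact: endo_lc.
  move=> r' c' hge; rewrite /X'.
  have [e|ne] := eqVneq c' c.
    subst c'; have [->|nr] := eqVneq r' r; first by rewrite Yrc mulNr -mulrA [ui * u]mulrC hu mulr1 subrr.
    have hlt : (code (rev (sq r)) < code (rev (sq r')))%N.
      move: hge; rewrite -hcd /cd !code_cat !size_rev !szr leq_add2l leq_eqVlt => /orP [/eqP e|//].
      have := code_inj _ e; rewrite !size_rev !szr => /(_ erefl) /(can_inj (@revK _)) /letters_inj e2.
      by rewrite e2 eqxx in nr.
    rewrite Yc (negbTE nr) mulr0 add0r hx ?szr //; last by rewrite -leqNgt ltnW.
    rewrite mulr0 addr0; apply: hX; rewrite -hcd /cd !code_cat !size_rev !szr ltn_add2l //.
  (* The column index comes first in the order. So if [c'] differs from c, its primed word is the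
     larger one, [c'] itself is smaller than c, and Y vanishes in that column. *)
  have hlt : (code (map (@prim m) (sq c)) < code (map (@prim m) (sq c')))%N.
    rewrite ltnNge; apply/negP => hle.
    move: hle; rewrite leq_eqVlt => /orP [/eqP e|hlt].
      have := code_inj _ e; rewrite !(size_map (@prim m)) !szr => /(_ erefl) /(inj_map (@prim_inj m))
          /letters_inj e2.
      by rewrite e2 eqxx in ne.
    move: hge; rewrite -hcd /cd !code_cat !size_rev !szr leqNgt; case/negP.
    have := code_lt (rev (sq r')); rewrite size_rev szr => h1.
    have : ((code (map (@prim m) (sq c'))).+1 * m.*2 ^ n <= code (map (@prim m) (sq c)) * m.*2 ^ n)%N by
        rewrite leq_mul2r hlt orbT.
    by rewrite mulSn; lia.
  rewrite Y0; last first.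
    have h1 := code_prim (sq c); have h2 := code_prim (sq c'); rewrite !szr in h1 h2; lia.
  rewrite mulr0 addr0; apply: hX; rewrite -hcd /cd !code_cat !size_rev !szr.
  have := code_lt (rev (sq r)); rewrite size_rev szr => h1.
  have : ((code (map (@prim m) (sq c))).+1 * m.*2 ^ n <= code (map (@prim m) (sq c')) * m.*2 ^ n)%N by
      rewrite leq_mul2r hlt orbT.
  by rewrite mulSn; lia.
apply: phi_eq (phi_lc (X r c * ui) pY pX') => r' c' /=.
by rewrite /X' mulNr addrCA subrr addr0.
Qed.
End Converse.

Theorem theorem1p5 (m n : nat) (K : comPzRingType) (z zi : K) :
  (0 < m)%N -> (0 < n)%N -> z * zi = 1 ->
  forall X : Op K m n, in_phiC z zi X <-> in_EndU z zi X.
Proof.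
move=> m0 _ zzi X; split; first exact: phi_EndU.
exact: endo_phi.
Qed.
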